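(* Let $Y$ and $\hat Y$ be continuous Lagrangian paths on $[a,b]$ and let $Z_Y(t)$, $Z_{\hat Y}(t)$ and $K_Y(t)$, $K_{\hat Y}(t)$ be the associated symplectic orthogonal matrices and normalization factors. Let $\varphi_j(t)$, $j\in\{1,\dots,n\}$, be continuous Lidskii angles on $[a,b]$ of the symplectic matrix $S(t):=Z_Y^{-1}(t)Z_{\hat Y}(t)$, and let $q_j(t)$ be the integers with $\varphi_j(t)\in[2\pi q_j(t),2\pi(q_j(t)+1))$. Then the Maslov index of $Y$ and $\hat Y$ on $[a,b]$ satisfies $$\operatorname{Mas}(Y,\hat Y,[a,b])=\sum_{j=1}^n\big(q_j(b)-q_j(a)\big).$$ Consequently, for any continuous symplectic matrix $Z(t)$ such that $Y(t)=Z(t)E$ on $[a,b]$ we have $$\operatorname{Mas}(Y,\hat Y,[a,b])=\mathcal N(Z^{-1}\hat Y,[a,b])=\mathcal N(\tilde Y,[a,b]),\qquad \tilde Y:=Z_Y^{-1}\hat Y=\begin{pmatrix}-K_Y\,W(Y,\hat Y)\\ K_Y\,Y^T\hat Y\end{pmatrix}.$$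
   Context: Notation. $n\in\mathbb N$, $[a,b]\subseteq\mathbb R$, $\mathcal J=\begin{pmatrix}0&I\\ -I&0\end{pmatrix}\in\mathbb R^{2n\times2n}$, $E=\begin{pmatrix}0\\ I\end{pmatrix}\in\mathbb R^{2n\times n}$. A real $2n\times 2n$ matrix $S$ is symplectic if $S^T\mathcal JS=\mathcal J$. A Lagrangian plane is a constant $Y\in\mathbb R^{2n\times n}$ with $Y^T\mathcal JY=0$ and $\operatorname{rank}Y=n$. A continuous Lagrangian path on $[a,b]$ is a continuous $Y:[a,b]\to\mathbb R^{2n\times n}$ such that every $Y(t)$ is a Lagrangian plane. We write $Y=\begin{pmatrix}X\\ U\end{pmatrix}$ with $n\times n$ blocks (similarly $\hat Y$ with $\hat X,\hat U$). The Wronskian is $W(Y,\hat Y)=Y^T\mathcal J\hat Y$. Comparative index. For Lagrangian planes $Y,\hat Y$ put $\mathcal M=(I-X^\dagger X)W(Y,\hat Y)$, $V=I-\mathcal M^\dagger\mathcal M$, $\mathcal P=V[W(Y,\hat Y)]^TX^\dagger\hat XV$ (a symmetric matrix), where $\dagger$ is the Moore–Penrose pseudoinverse. The comparative index is $\mu(Y,\hat Y)=\operatorname{rank}\mathcal M+\operatorname{ind}\mathcal P$, with $\operatorname{ind}$ the number of negative eigenvalues. Oscillation number. For a continuous Lagrangian path $Y$ on $[a,b]$ take a partition $a=t_0<t_1<\dots<t_p=b$ and real symplectic matrix functions $R_k(t)$, $k=0,\dots,p-1$, with $R_k$ continuous on $[t_k,t_{k+1}]$ and such that, for each $k$, both $\operatorname{rank}W(R_k(t)E,Y(t))$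 and $\operatorname{rank}\big((I\ \,0)R_k(t)E\big)$ are constant for $t\in[t_k,t_{k+1}]$. Then $$\mathcal N(Y,[a,b]):=\sum_{k=0}^{p-1}\big[\mu(Y(t_{k+1}),R_k(t_{k+1})E)-\mu(Y(t_k),R_k(t_k)E)\big].$$ Such partitions and systems exist and the value does not depend on their choice. Symplectic orthogonal matrix of a path. $Z_Y(t)=\begin{pmatrix}\mathcal JY(t)K_Y(t)&Y(t)K_Y(t)\end{pmatrix}$, $K_Y(t)=[Y^T(t)Y(t)]^{-1/2}>0$; $Z_Y(t)$ is symplectic and orthogonal. Lidskii angles. For a real symplectic $S=\begin{pmatrix}S_{11}&S_{12}\\ S_{21}&S_{22}\end{pmatrix}$ the matrix $W_S=(S_{11}-iS_{12})^{-1}(S_{11}+iS_{12})$ is well defined, symmetric and unitary; writing its eigenvalues as $\exp(i\varphi_j)$, the real numbers $\varphi_1,\dots,\varphi_n$ (each determined up to $2\pi\mathbb Z$) are the Lidskii angles of $S$. For continuous $S(t)$ they can be, and are, chosen as continuous functions of $t\in[a,b]$. Maslov index. For continuous Lagrangian paths $Y,\hat Y$ put $$\Gamma(t)=-[X(t)+iU(t)][X(t)-iU(t)]^{-1}[\hat X(t)-i\hat U(t)][\hat X(t)+i\hat U(t)]^{-1},$$ a continuous unitary matrix on $[a,b]$. There exist a partition $a=t_0<t_1<\dots<t_p=b$ and numbers $\varepsilon_k\in(0,\pi)$, $k=1,\dots,p$, such that $\Gamma(t)-\exp\{i(\pi\pm\varepsilon_k)\}I$ is invertible for all $t\in[t_{k-1},t_k]$.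 For $t\in[t_{k-1},t_k]$ let $\ell(t,\varepsilon_k)=\sum_{\theta\in[0,\varepsilon_k)}\dim\ker\big(\Gamma(t)-\exp\{i(\pi+\theta)\}I\big)$, i.e. the number of eigenvalues (with multiplicity) of $\Gamma(t)$ on the arc $\{e^{i\theta}:\theta\in[\pi,\pi+\varepsilon_k)\}$. The Maslov index is $$\operatorname{Mas}(Y,\hat Y,[a,b]):=\sum_{k=1}^p\big(\ell(t_k,\varepsilon_k)-\ell(t_{k-1},\varepsilon_k)\big),$$ which is independent of the choice of the partition and the $\varepsilon_k$. *)

(* Defs.v *)
From HB Require Import structures.
From mathcomp Require Import all_boot all_order all_algebra.
From mathcomp Require Import complex.
From mathcomp Require Import all_classical all_reals all_analysis.

Set Implicit Arguments.
Unset Strict Implicit.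
Unset Printing Implicit Defensive.

Import Order.TTheory GRing.Theory Num.Theory.
Import numFieldNormedType.Exports.

Local Open Scope classical_set_scope.
Local Open Scope ring_scope.

Section LinearAlgebra.
Variable R : realType.

(* The four Penrose equations, with B the candidate for the pseudoinverse. *)
Definition is_mpinv m n (A : 'M[R]_(m, n)) (B : 'M[R]_(n, m)) : Prop :=
  [/\ A *m B *m A = A, B *m A *m B = B,
      (A *m B)^T = A *m B & (B *m A)^T = B *m A].

Lemma is_mpinv_uniq m n (A : 'M[R]_(m, n)) B C :
  is_mpinv A B -> is_mpinv A C -> B = C.
Proof.
move=> [B1 B2 B3 B4] [C1 C2 C3 C4].
have eAB : A *m B = A *m C.
  by rewrite -{1}C1 -!mulmxA (mulmxA A C) -C3 -B3 -trmx_mul mulmxA B1 C3.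
have eBA : B *m A = C *m A.
  by rewrite -{1}C1 -mulmxA (mulmxA B) -B4 -C4 -trmx_mul -(mulmxA C) (mulmxA A) B1 C4.
by rewrite -B2 -mulmxA eAB mulmxA eBA -[LHS]mulmxA mulmxA.
Qed.

Lemma gram_unitmx m n (C : 'M[R]_(m, n)) :
  \rank C = n -> C^T *m C \in unitmx.
Proof.
move=> rC; rewrite -row_free_unit -kermx_eq0; apply/eqP/row_matrixP => i.
rewrite row0; set u := row i _.
have uCC : u *m (C^T *m C) = 0.
  by apply: sub_kermxP; exact: row_sub.
have uC0 : u *m C^T = 0.
  set w := u *m C^T; have ww0 : w *m w^T = 0.
    by rewrite /w trmx_mul trmxK mulmxA -(mulmxA u) uCC mul0mx.
  apply/rowP => j; rewrite [RHS]mxE.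
  have : (w *m w^T) 0 0 = 0 by rewrite ww0 mxE.
  rewrite mxE => /eqP; rewrite psumr_eq0; last first.
    by move=> k _; rewrite [w^T _ _]mxE -expr2 sqr_ge0.
  move=> /allP /(_ j (mem_index_enum _)).
  by rewrite [w^T _ _]mxE mulf_eq0 orbb => /eqP.
have fCT : row_free C^T by rewrite /row_free mxrank_tr rC.
have inj := @row_free_inj _ 1%N _ _ _ fCT.
by apply: inj; rewrite uC0 mul0mx.
Qed.

Lemma is_mpinv_mul m r n (C : 'M[R]_(m, r)) (F : 'M[R]_(r, n)) :
  \rank C = r -> \rank F = r -> exists B, is_mpinv (C *m F) B.
Proof.
move=> rC rF; have uC := gram_unitmx rC.
have uF : F *m F^T \in unitmx.
  by rewrite -{1}[F]trmxK; apply: gram_unitmx; rewrite mxrank_tr.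
pose G := invmx (C^T *m C) *m C^T; pose H := F^T *m invmx (F *m F^T).
have GC : G *m C = 1%:M by rewrite /G -mulmxA mulVmx.
have FH : F *m H = 1%:M by rewrite /H mulmxA mulmxV.
have AB : C *m F *m (H *m G) = C *m G.
  by rewrite mulmxA -(mulmxA C) FH mulmx1.
have BA : H *m G *m (C *m F) = H *m F.
  by rewrite mulmxA -(mulmxA H) GC mulmx1.
exists (H *m G); split.
- by rewrite AB mulmxA -(mulmxA C) GC mulmx1.
- by rewrite BA mulmxA -(mulmxA H) FH mulmx1.
- by rewrite AB /G !trmx_mul trmx_inv trmx_mul trmxK mulmxA.
- by rewrite BA /H !trmx_mul trmx_inv trmx_mul trmxK mulmxA.
Qed.

Lemma is_mpinv_ex m n (A : 'M[R]_(m, n)) : exists B, is_mpinv A B.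
Proof.
rewrite -{1}(mulmx_base A); apply: is_mpinv_mul; apply/eqP.
  exact: col_base_full.
exact: row_base_free.
Qed.

Definition mpinv m n (A : 'M[R]_(m, n)) : 'M[R]_(n, m) :=
  xget 0 [set B | is_mpinv A B].

Lemma mpinvP m n (A : 'M[R]_(m, n)) : is_mpinv A (mpinv A).
Proof. exact: (xgetPex 0 (is_mpinv_ex A)). Qed.

(* Intended for symmetric A, where the dimension of an eigenspace is the
   multiplicity of the eigenvalue. *)
Definition neg_index n (A : 'M[R]_n) : nat :=
  \sum_(x \in [set x : R | x < 0]) \rank (eigenspace A x).

Definition posdef n (A : 'M[R]_n) : Prop :=
  A^T = A /\ forall v : 'cV[R]_n, v != 0 -> 0 < (v^T *m A *m v) 0 0.

(* A^(-1/2), for A symmetric positive definite. *)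
Definition inv_sqrtmx n (A : 'M[R]_n) : 'M[R]_n :=
  xget 0 [set K | posdef K /\ K *m K = invmx A].

End LinearAlgebra.

Section Symplectic.
Variables (R : realType) (n : nat).
Implicit Types (Y Yh : 'M[R]_(n + n, n)) (S : 'M[R]_(n + n)).

Definition Jmx : 'M[R]_(n + n) := block_mx 0 1%:M (- 1%:M) 0.

Definition Emx : 'M[R]_(n + n, n) := col_mx 0 1%:M.

Definition symplectic S : Prop := S^T *m Jmx *m S = Jmx.

Definition lagrangian_plane Y : Prop := Y^T *m Jmx *m Y = 0 /\ \rank Y = n.

Definition wronskian Y Yh : 'M[R]_n := Y^T *m Jmx *m Yh.

Definition comparative_index Y Yh : nat :=
  let X := usubmx Y in
  let Xh := usubmx Yh in
  let M := (1%:M - mpinv X *m X) *m wronskian Y Yh in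
  let V := 1%:M - mpinv M *m M in
  let P := V *m (wronskian Y Yh)^T *m mpinv X *m Xh *m V in
  (\rank M + neg_index P)%N.

Definition Kmx Y : 'M[R]_n := inv_sqrtmx (Y^T *m Y).

Definition Zmx Y : 'M[R]_(n + n) := row_mx (Jmx *m Y *m Kmx Y) (Y *m Kmx Y).

End Symplectic.

Section ComplexMatrices.
Variables (R : realType) (n : nat).
Local Open Scope complex_scope.

Definition expi (x : R) : R[i] := cos x +i* sin x.

Definition mx_addi (A B : 'M[R]_n) : 'M[R[i]]_n :=
  map_mx (real_complex R) A + 'i *: map_mx (real_complex R) B.

Definition mx_subi (A B : 'M[R]_n) : 'M[R[i]]_n :=
  map_mx (real_complex R) A - 'i *: map_mx (real_complex R) B.

Definition lidskii_mx (S : 'M[R]_(n + n)) : 'M[R[i]]_n :=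
  invmx (mx_subi (ulsubmx S) (ursubmx S)) *m
  mx_addi (ulsubmx S) (ursubmx S).

(* The equality of polynomials says that the n eigenvalues of lidskii_mx S,
   repeated according to their multiplicities, are the numbers expi (phi j). *)
Definition lidskii_angles (S : 'M[R]_(n + n)) (phi : 'I_n -> R) : Prop :=
  char_poly (lidskii_mx S) = \prod_(j < n) ('X - (expi (phi j))%:P).

Definition Gamma (Y Yh : 'M[R]_(n + n, n)) : 'M[R[i]]_n :=
  - (mx_addi (usubmx Y) (dsubmx Y) *m
     invmx (mx_subi (usubmx Y) (dsubmx Y)) *m
     mx_subi (usubmx Yh) (dsubmx Yh) *m
     invmx (mx_addi (usubmx Yh) (dsubmx Yh))).

Definition ell (G : 'M[R[i]]_n) (eps : R) : nat :=
  \sum_(theta \in `[0, eps[) \rank (eigenspace G (expi (pi + theta))).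

End ComplexMatrices.

Section Paths.
Variables (R : realType) (n : nat) (a b : R).

Definition lagrangian_path (Y : R -> 'M[R]_(n + n, n)) : Prop :=
  {within `[a, b], continuous Y} /\
  forall t, t \in `[a, b] -> lagrangian_plane (Y t).

Definition symplectic_path_on (c d : R) (Z : R -> 'M[R]_(n + n)) : Prop :=
  {within `[c, d], continuous Z} /\
  forall t, t \in `[c, d] -> symplectic (Z t).

Definition is_partition (p : nat) (t : nat -> R) : Prop :=
  [/\ t 0%N = a, t p = b & forall k, (k < p)%N -> t k < t k.+1].

Definition oscillation_data (Y : R -> 'M[R]_(n + n, n))
    (p : nat) (t : nat -> R) (Rk : nat -> R -> 'M[R]_(n + n)) : Prop :=
  is_partition p t /\
  forall k, (k < p)%N ->
    [/\ symplectic_path_on (t k) (t k.+1) (Rk k),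
        exists r : nat, forall s, s \in `[t k, t k.+1] ->
          \rank (wronskian (Rk k s *m Emx R n) (Y s)) = r
      & exists r : nat, forall s, s \in `[t k, t k.+1] ->
          \rank (row_mx 1%:M 0 *m Rk k s *m Emx R n) = r].

Definition oscillation_value (Y : R -> 'M[R]_(n + n, n))
    (p : nat) (t : nat -> R) (Rk : nat -> R -> 'M[R]_(n + n)) : int :=
  \sum_(k < p)
    ((comparative_index (Y (t k.+1)) (Rk k (t k.+1) *m Emx R n))%:Z -
     (comparative_index (Y (t k)) (Rk k (t k) *m Emx R n))%:Z).

(* For continuous Lagrangian paths, oscillation_number and maslov_index below
   are independent of the data (which exist); xget only selects that value. *)
Definition oscillation_number (Y : R -> 'M[R]_(n + n, n)) : int :=
  xget 0 [set N : int | exists p t Rk,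
    oscillation_data Y p t Rk /\ N = oscillation_value Y p t Rk].

(* On the k-th subinterval, from t k to t k.+1, the parameter is eps k, so
   that eps is indexed from 0 to p - 1. *)
Definition maslov_data (Y Yh : R -> 'M[R]_(n + n, n))
    (p : nat) (t eps : nat -> R) : Prop :=
  is_partition p t /\
  forall k, (k < p)%N ->
    0 < eps k < pi /\
    forall s, s \in `[t k, t k.+1] ->
      Gamma (Y s) (Yh s) - (expi (pi + eps k))%:M \in unitmx /\
      Gamma (Y s) (Yh s) - (expi (pi - eps k))%:M \in unitmx.

Definition maslov_value (Y Yh : R -> 'M[R]_(n + n, n))
    (p : nat) (t eps : nat -> R) : int :=
  \sum_(k < p)
    ((ell (Gamma (Y (t k.+1)) (Yh (t k.+1))) (eps k))%:Z -
     (ell (Gamma (Y (t k)) (Yh (t k))) (eps k))%:Z).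

Definition maslov_index (Y Yh : R -> 'M[R]_(n + n, n)) : int :=
  xget 0 [set N : int | exists p t eps,
    maslov_data Y Yh p t eps /\ N = maslov_value Y Yh p t eps].

End Paths.

(* Main.v *)
(* Write W = Y^T J Yh, G = Y^T Yh and S = Y^T Y.  The eigenspace of Gamma at
   exp(i(pi + th)) has the dimension of the kernel of
   cos(th/2) W + sin(th/2) G.  Hence, for a generic small q > 0, the matrix
   H = - W (G + q W)^-1, which is similar to a symmetric one, carries the spectrum
   of Gamma: the arc [pi, pi + eps) corresponds to an interval [0, h), and the
   eigenvalue count on the arc is ind (H S - h S) - ind (H S).  If exp(i(pi + eps))
   is not an eigenvalue the first term is locally constant, so the count varies
   locally like - ind (H S).

   Completing squares with the pseudoinverse gives
     mu(Y, Yh) = ind B - ind A + ind (A - B)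
   when Y and Yh are the graphs of symmetric matrices A and B over a Lagrangian
   plane L (in the chart where the vertical plane is the graph of 0).  Since these
   indices are symplectically invariant, in the differences defining N(Z^-1 Yh)
   two of the three terms have constant rank, hence are locally constant, and the
   remaining one is the same ind (H S) as above when L = (J + q) Y.  Thus both
   indices are the increment over [a, b] of any integer function Phi whose local
   variation is that of the eigenvalue count.  Such a Phi is obtained by gluing,
   and the sum of the q_j is one, because the Lidskii matrix is similar to
   - Gamma. *)

Require Import Defs.
From HB Require Import structures.
From mathcomp Require Import all_boot all_order all_algebra.
From mathcomp Require Import complex.
From mathcomp Require Import all_classical all_reals all_analysis.
From mathcomp Require Import spectral ring lra zify.

Import Order.TTheory GRing.Theory Num.Theory.
Import numFieldNormedType.Exports.

Local Open Scope classical_set_scope.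
Local Open Scope ring_scope.
Set Implicit Arguments.
Unset Strict Implicit.
Unset Printing Implicit Defensive.

(** * Inertia of real symmetric matrices *)

Section RealSpectral.
Variable R : realType.

Lemma symmetric_real_eigenvalue n (A : 'M[R]_n.+1) :
  A^T = A -> exists a, eigenvalue A a.
Proof.
move=> symA; pose AC := map_mx (real_complex R) A.
have AreA : AC \is a mxOver Num.real.
  by apply/mxOverP => i j; rewrite mxE complex_real.
have hA : AC \is hermsymmx.
  apply: realsym_hermsym AreA; apply/is_hermitianmxP.
  rewrite expr0 scale1r; apply/matrixP => i j; rewrite !mxE.
  by rewrite -[in LHS]symA mxE.
have /orthomx_spectralP := hermitian_normalmx hA.
set P := spectralmx _; set d := spectral_diag _ => /= eA.
have uP : P \in unitmx := spectral_unit _.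
have rd : d 0 0 \is Num.real.
  by have /mxOverP := hermitian_spectral_diag_real hA; apply.
have PA : P *m AC = diag_mx d *m P by rewrite eA !mulmxA mulmxV // mul1mx.
have ev : eigenvalue AC (d 0 0).
  apply/eigenvalueP; exists (row 0 P).
    by rewrite -row_mul PA; apply/rowP => j; rewrite mul_diag_mx !mxE.
  apply/eqP => r0; have : row 0 (P *m invmx P) = 0 by rewrite row_mul r0 mul0mx.
  by rewrite mulmxV // => /rowP /(_ 0) /eqP; rewrite !mxE eqxx oner_eq0.
exists (complex.Re (d 0 0)).
by rewrite -(eigenvalue_map (real_complex R)) [X in eigenvalue _ X]RRe_real.
Qed.

Lemma mulmx_tr_ge0 n (v : 'rV[R]_n) : 0 <= (v *m v^T) 0 0.
Proof. by rewrite mxE sumr_ge0 // => i _; rewrite mxE -expr2 sqr_ge0. Qed.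

Lemma mulmx_tr_eq0 n (v : 'rV[R]_n) : ((v *m v^T) 0 0 == 0) = (v == 0).
Proof.
apply/eqP/eqP => [|->]; last by rewrite mul0mx mxE.
rewrite mxE => /eqP; rewrite psumr_eq0; last first.
  by move=> k _; rewrite mxE -expr2 sqr_ge0.
move=> /allP h; apply/rowP => j; have := h j (mem_index_enum _).
by rewrite !mxE mulf_eq0 orbb => /eqP.
Qed.

Lemma mulmx_tr_gt0 n (v : 'rV[R]_n) : v != 0 -> 0 < (v *m v^T) 0 0.
Proof. by move=> v0; rewrite lt_def mulmx_tr_eq0 v0 mulmx_tr_ge0. Qed.

Lemma householder n (u v : 'rV[R]_n) :
  u *m u^T = 1%:M -> v *m v^T = 1%:M ->
  exists H : 'M[R]_n, [/\ H^T = H, H *m H = 1%:M & u *m H = v].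
Proof.
move=> u1 v1; have [->|nuv] := eqVneq v u.
  by exists 1%:M; rewrite trmx1 !mulmx1.
pose w := v - u; have w0 : w != 0 by rewrite subr_eq0.
pose k := (w *m w^T) 0 0; have k0 : k != 0 by rewrite mulmx_tr_eq0.
have ww : w *m w^T = k%:M by rewrite [LHS]mx11_scalar.
pose c := (u *m v^T) 0 0.
have uv : u *m v^T = c%:M by rewrite [LHS]mx11_scalar.
have vu : v *m u^T = c%:M by rewrite -[v]trmxK -trmx_mul uv tr_scalar_mx.
have kE : k = 2 - 2 * c.
  have : w *m w^T = (2 - 2 * c)%:M.
    rewrite /w linearB /= mulmxBr !mulmxBl u1 v1 uv vu.
    by apply/matrixP => i j; rewrite !mxE !ord1 /=; ring.
  by rewrite ww => /matrixP /(_ 0 0); rewrite !mxE eqxx !mulr1n.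
have uw : u *m w^T = (c - 1)%:M by rewrite /w linearB /= mulmxBr uv u1 -raddfB.
have : u + w = v by rewrite /w addrC subrK.
move: w w0 k k0 ww kE uw => w w0 k k0 ww kE uw wE.
have [N [NT NN uN]] : exists N : 'M[R]_n,
    [/\ N^T = N, N *m N = k *: N & u *m N = (c - 1) *: w].
  exists (w^T *m w); split; first by rewrite trmx_mul trmxK.
    by rewrite mulmxA -(mulmxA w^T) ww mul_mx_scalar -scalemxAl.
  by rewrite mulmxA uw mul_scalar_mx.
exists (1%:M - (2 / k) *: N); split.
- by rewrite linearB /= trmx1 linearZ /= NT.
- rewrite mulmxBl mul1mx mulmxBr mulmx1 -scalemxAl -scalemxAr NN !scalerA.
  rewrite opprB addrA (_ : 2 / k * (2 / k) * k = 2 / k + 2 / k); last by field.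
  by rewrite scalerDl addrA subrK addrK.
- rewrite mulmxBr mulmx1 -scalemxAr uN scalerA.
  have -> : 2 / k * (c - 1) = -1.
    by rewrite (_ : c - 1 = - k / 2) ?kE; field; rewrite -?kE.
  by rewrite scaleN1r opprK wE.
Qed.

Lemma real_spectral n (A : 'M[R]_n) : A^T = A ->
  exists (Q : 'M[R]_n) (d : 'rV[R]_n),
    Q *m Q^T = 1%:M /\ A = Q^T *m diag_mx d *m Q.
Proof.
elim: n A => [|n IH] A symA.
  by exists 1%:M, 0; split; apply/matrixP => -[].
have [a /eigenvalueP[v0 v0A v0n]] := symmetric_real_eigenvalue symA.
pose s := Num.sqrt ((v0 *m v0^T) 0 0).
have s0 : s != 0 by rewrite gt_eqF // sqrtr_gt0 mulmx_tr_gt0.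
pose v := s^-1 *: v0.
have vA : v *m A = a *: v by rewrite -scalemxAl v0A !scalerA mulrC.
have v1 : v *m v^T = 1%:M.
  rewrite /v linearZ /= -scalemxAl -scalemxAr scalerA [v0 *m _]mx11_scalar.
  rewrite scale_scalar_mx; congr _%:M.
  rewrite -[X in _ * X = _]sqr_sqrtr ?mulmx_tr_ge0 // -/s.
  by field.
pose e : 'rV[R]_(1 + n) := row_mx 1%:M 0.
have e1 : e *m e^T = 1%:M.
  by rewrite /e tr_row_mx mul_row_col trmx1 mulmx1 trmx0 mulmx0 addr0.
have [H [symH HH eH]] := @householder (1 + n) _ _ e1 v1.
pose B : 'M[R]_(1 + n) := H *m A *m H.
have symB : B^T = B by rewrite /B !trmx_mul symH symA mulmxA.
have vH : v *m H = e by rewrite -eH -mulmxA HH mulmx1.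
have eB : e *m B = a *: e by rewrite /B !mulmxA eH vA -scalemxAl vH.
have : e *m B = row_mx (ulsubmx B) (ursubmx B).
  by rewrite -{1}[B]submxK /e mul_row_block !mul1mx !mul0mx !addr0.
rewrite eB /e scale_row_mx scaler0 => /eq_row_mx [/esym Bul /esym Bur].
have Bdl : dlsubmx B = 0.
  by rewrite -[in LHS]symB -trmx_ursub Bur trmx0.
have [|Q [d [QQ dB]]] := IH (drsubmx B).
  by rewrite trmx_drsub symB.
have BE : B = block_mx a%:M 0 0 (drsubmx B).
  by rewrite -{1}[B]submxK Bul Bur Bdl scalemx1.
pose T : 'M[R]_(1 + n) := block_mx 1%:M 0 0 Q.
pose D : 'rV[R]_(1 + n) := row_mx a%:M d.
have TT : T *m T^T = 1%:M.
  rewrite /T tr_block_mx mulmx_block !trmx0 trmx1.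
  by rewrite !mulmx0 !mul0mx mulmx1 QQ !addr0 !add0r -scalar_mx_block.
have TDT : T^T *m diag_mx D *m T = B.
  rewrite BE dB /T /D diag_mx_row tr_block_mx !trmx0 trmx1.
  rewrite !mulmx_block !mulmx0 !mul0mx !mulmx1 !mul1mx !addr0 !add0r.
  congr block_mx; rewrite ?mul0mx //.
  by apply/matrixP => i j; rewrite !mxE !ord1.
exists (T *m H), D; split.
  by rewrite trmx_mul symH mulmxA -(mulmxA _ H H) HH mulmx1.
have -> : A = H *m B *m H by rewrite /B !mulmxA HH mul1mx -mulmxA HH mulmx1.
by rewrite trmx_mul symH -TDT !mulmxA.
Qed.

End RealSpectral.

Section EigenspaceCount.
Variable F : fieldType.

Lemma mxrank_diag n (d : 'rV[F]_n) :
  \rank (diag_mx d) = (\sum_(i < n) (d 0%R i != 0%R))%N.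
Proof.
elim: n d => [|n IH] d; first by rewrite big_ord0; apply/eqP; rewrite -leqn0 rank_leq_row.
suff h (l : 'rV[F]_1) (r : 'rV[F]_n) : \rank (diag_mx (row_mx l r)) =
    (\sum_(i < 1 + n) (row_mx l r 0%R i != 0%R))%N.
  by rewrite -[d](@hsubmxK _ 1 1 n); exact: h.
rewrite diag_mx_row rank_diag_block_mx IH big_split_ord big_ord1; congr (_ + _)%N.
  rewrite [diag_mx l]mx11_scalar mxE eqxx mulr1n row_mxEl.
  have [->|l0] := eqVneq (l 0 0) 0; first by rewrite raddf0 mxrank0.
  by rewrite mxrank_unit // -scalemx1 unitmxZ ?unitfE // unitmx1.
by apply: eq_bigr => i _; rewrite row_mxEr.
Qed.

Lemma mxrank_similar n (P A : 'M[F]_n) : P \in unitmx ->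
  \rank (invmx P *m A *m P) = \rank A.
Proof.
move=> uP; rewrite mxrankMfree ?row_free_unit // -mxrank_tr trmx_mul.
by rewrite mxrankMfree ?mxrank_tr // row_free_unit unitmx_tr unitmx_inv.
Qed.

Lemma rank_eigenspace n (A : 'M[F]_n) a :
  \rank (eigenspace A a) = (n - \rank (A - a%:M)%R)%N.
Proof. exact: mxrank_ker. Qed.

Lemma rank_eigenspace_diag n (A P : 'M[F]_n) (d : 'rV_n) a :
  P \in unitmx -> A = invmx P *m diag_mx d *m P ->
  \rank (eigenspace A a) = (\sum_(i < n) (d 0%R i == a))%N.
Proof.
move=> uP ->; rewrite rank_eigenspace.
have -> : invmx P *m diag_mx d *m P - a%:M =
    invmx P *m diag_mx (d - const_mx a) *m P.
  rewrite raddfB /= mulmxBr mulmxBl diag_const_mx; congr (_ - _).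
  by rewrite mul_mx_scalar -scalemxAl mulVmx // scalemx1.
rewrite mxrank_similar // mxrank_diag.
apply: (canLR (addnK _)); rewrite -big_split /= -[LHS]card_ord -sum1_card.
by apply: eq_bigr => i _; rewrite !mxE subr_eq0; case: eqP.
Qed.

Lemma sum_rank_eigenspace n (A P : 'M[F]_n) (d : 'rV_n) (T : choiceType)
    (S : set T) (f : T -> F) :
  P \in unitmx -> A = invmx P *m diag_mx d *m P -> set_inj S f ->
  (\sum_(x \in S) \rank (eigenspace A (f x)))%N =
  (\sum_(i < n) `[< (f @` S) (d 0%R i) >])%N.
Proof.
move=> uP eA injf.
transitivity (\sum_(a \in f @` S) \rank (eigenspace A a))%N.
  by rewrite fsbig_image.
have eigE a : \rank (eigenspace A a) = (\sum_(i < n) (d 0%R i == a))%N.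
  exact: rank_eigenspace_diag uP eA.
pose r := undup [seq d 0 i | i <- enum 'I_n].
pose r' := [seq a <- r | a \in f @` S].
rewrite (fsbigE r') ?filter_uniq ?undup_uniq //; first last.
- move=> a Sa; rewrite mem_filter mem_set // mem_undup /= => ar.
  rewrite eigE big1 // => i _; apply/eqP; rewrite eqb0; apply: contra ar => /eqP <-.
  by apply/mapP; exists i; rewrite ?mem_enum.
- by move=> a /=; rewrite mem_filter => /andP[/set_mem].
under eq_bigr do rewrite eigE.
rewrite exchange_big /=; apply: eq_bigr => i _; rewrite big_filter_cond.
case: asboolP => dS; last first.
  rewrite big1 // => a /andP[/set_mem Sa _]; apply/eqP; rewrite eqb0.
  by apply: contra_notN dS => /eqP ->.
rewrite big_mkcond (bigD1_seq (d 0 i)) ?undup_uniq //=; last first.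
  by rewrite mem_undup; apply/mapP; exists i; rewrite ?mem_enum.
rewrite mem_set // eqxx big1 // => a; rewrite eq_sym => /negbTE ->.
by rewrite if_same.
Qed.

End EigenspaceCount.

Section Inertia.
Variable R : realType.

Definition negdef k (B : 'M[R]_k) : Prop :=
  forall u : 'rV_k, u != 0 -> (u *m B *m u^T) 0 0 < 0.

Lemma negdefN1 k : negdef (- 1%:M : 'M[R]_k).
Proof. by move=> u u0; rewrite mulmxN mulmx1 mulNmx mxE oppr_lt0 mulmx_tr_gt0. Qed.

Lemma sum_rank_eigenspace_sym n (A Q : 'M[R]_n) (d : 'rV_n) (S : set R) :
  Q *m Q^T = 1%:M -> A = Q^T *m diag_mx d *m Q ->
  (\sum_(x \in S) \rank (eigenspace A x))%N = (\sum_(i < n) `[< S (d 0%R i) >])%N.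
Proof.
move=> QQ eA; have [uQ _] := mulmx1_unit QQ.
have iQ : invmx Q = Q^T by rewrite -[RHS]mul1mx -(mulVmx uQ) -mulmxA QQ mulmx1.
rewrite (@sum_rank_eigenspace _ _ A Q d _ S id) ?iQ ?image_id //.
Qed.

Lemma neg_index_spectral n (A Q : 'M[R]_n) (d : 'rV_n) :
  Q *m Q^T = 1%:M -> A = Q^T *m diag_mx d *m Q ->
  neg_index A = (\sum_(i < n) (d 0%R i < 0)%R)%N.
Proof.
move=> QQ eA; rewrite /neg_index (sum_rank_eigenspace_sym _ QQ eA).
by apply: eq_bigr => i _; rewrite asboolb.
Qed.

Lemma neg_index_add_rank n (A : 'M[R]_n) : A^T = A ->
  (neg_index A + neg_index (- A)%R)%N = \rank A.
Proof.
move=> symA; have [Q [d [QQ eA]]] := real_spectral symA.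
rewrite (neg_index_spectral QQ eA) (@neg_index_spectral _ _ Q (- d)) //; last first.
  by rewrite eA raddfN /= mulmxN mulNmx.
have [uQ uQT] := mulmx1_unit QQ.
have -> : \rank A = \rank (diag_mx d).
  rewrite eA mxrankMfree ?row_free_unit // -mxrank_tr trmx_mul trmxK.
  by rewrite mxrankMfree ?row_free_unit // mxrank_tr.
rewrite mxrank_diag -big_split; apply: eq_bigr => i _ /=.
by rewrite mxE oppr_lt0; case: ltgtP.
Qed.

Lemma neg_index_witness n (A : 'M[R]_n) : A^T = A ->
  exists (k : nat) (V X : 'M[R]_(k, n)),
    [/\ k = neg_index A, V *m A *m V^T = - 1%:M & V = X *m A].
Proof.
move=> symA; have [Q [d [QQ eA]]] := real_spectral symA.
pose J := [set i | d 0 i < 0]%SET.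
pose M : 'M[R]_(#|J|, n) :=
  \matrix_(i, j) ((enum_val i == j)%:R * (Num.sqrt (- d 0 j))^-1).
pose M' : 'M[R]_(#|J|, n) := \matrix_(i, j) (M i j / d 0 j).
have dJ (i : 'I_#|J|) : d 0 (enum_val i) < 0 by have := enum_valP i; rewrite inE.
have M'D : M' *m diag_mx d = M.
  apply/matrixP => i j; rewrite mul_mx_diag !mxE.
  have [<-|_] := eqVneq (enum_val i) j; last by rewrite !mul0r.
  by rewrite mulfVK // lt_eqF.
have MDM : M *m diag_mx d *m M^T = - 1%:M.
  apply/matrixP => i j; rewrite mul_mx_diag mxE (bigD1 (enum_val i)) //= big1.
    rewrite !mxE eqxx addr0 mul1r eq_sym (inj_eq enum_val_inj).
    have [_|_] := eqVneq i j; last by rewrite !mul0r mulr0 oppr0.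
    set x := d 0 _; have x0 : x < 0 by exact: dJ.
    have s0 : Num.sqrt (- x) != 0 by rewrite gt_eqF // sqrtr_gt0 oppr_gt0.
    have : x = - (Num.sqrt (- x) ^+ 2) by rewrite sqr_sqrtr ?opprK // oppr_ge0 ltW.
    by move: (Num.sqrt _) s0 => s s0 ->; rewrite mulr1n mul1r; field.
  by move=> k; rewrite eq_sym !mxE => /negbTE ->; rewrite !mul0r.
exists #|J|, (M *m Q), (M' *m Q); split.
- rewrite (neg_index_spectral QQ eA) -sum1_card big_mkcond /=.
  by apply: eq_bigr => i _; rewrite inE; case: ltP.
- rewrite eA trmx_mul !mulmxA -(mulmxA _ Q Q^T) QQ mulmx1.
  by rewrite -(mulmxA _ Q Q^T) QQ mulmx1.
- by rewrite eA !mulmxA -(mulmxA _ Q Q^T) QQ mulmx1 M'D.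
Qed.

(* If k exceeded the number of negative eigenvalues, some nonzero combination of
   the rows of V would have no component along the negative eigenvectors. *)
Lemma neg_index_ge n k (A : 'M[R]_n) (V : 'M[R]_(k, n)) : A^T = A ->
  negdef (V *m A *m V^T) -> (k <= neg_index A)%N.
Proof.
move=> symA nd; have [Q [d [QQ eA]]] := real_spectral symA.
rewrite (neg_index_spectral QQ eA) leqNgt; apply/negP => ltk.
pose c : 'rV[R]_n := \row_i (d 0 i < 0)%R%:R.
pose B := V *m Q^T *m diag_mx c.
have : kermx B != 0.
  rewrite -mxrank_eq0 mxrank_ker subn_eq0 -ltnNge.
  apply: (@leq_ltn_trans (\rank (diag_mx c))); first exact: mxrankM_maxr.
  rewrite mxrank_diag; apply: leq_ltn_trans ltk; apply: leq_sum => i _.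
  by rewrite mxE; case: (d 0 i < 0); rewrite ?eqxx ?leq_b1.
case/rowV0Pn => u /sub_kermxP uB u0.
have := nd u u0; rewrite ltNge => /negP; apply.
pose w := u *m V *m Q^T.
have w0 i : d 0 i < 0 -> w 0 i = 0.
  move=> di; have : (w *m diag_mx c) 0 i = 0 by rewrite -!mulmxA (mulmxA V) uB mxE.
  by rewrite mul_mx_diag !mxE di mulr1.
have -> : u *m (V *m A *m V^T) *m u^T = w *m diag_mx d *m w^T.
  by rewrite eA /w !trmx_mul trmxK !mulmxA.
clearbody w; rewrite mul_mx_diag mxE sumr_ge0 // => i _; rewrite !mxE.
have [/w0 ->|d0] := ltP (d 0 i) 0; first by rewrite !mul0r.
by rewrite mulrAC mulr_ge0 // -expr2 sqr_ge0.
Qed.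

Lemma neg_index_congr_le m n (A : 'M[R]_n) (T : 'M[R]_(m, n)) : A^T = A ->
  (neg_index (T *m A *m T^T) <= neg_index A)%N.
Proof.
move=> symA; have [|k [V [_ [<- VV _]]]] := @neg_index_witness _ (T *m A *m T^T).
  by rewrite !trmx_mul trmxK symA mulmxA.
apply: (@neg_index_ge _ _ _ (V *m T)) => //.
by rewrite trmx_mul !mulmxA in VV *; rewrite VV; exact: negdefN1.
Qed.

Lemma neg_index_congr n (A T : 'M[R]_n) : A^T = A -> T \in unitmx ->
  neg_index (T *m A *m T^T) = neg_index A.
Proof.
move=> symA uT; apply/eqP; rewrite eqn_leq neg_index_congr_le //=.
have {1}-> : A = invmx T *m (T *m A *m T^T) *m (invmx T)^T.
  by rewrite !mulmxA mulVmx // mul1mx -mulmxA -trmx_mul mulVmx // trmx1 mulmx1.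
by rewrite neg_index_congr_le // !trmx_mul trmxK symA mulmxA.
Qed.

Lemma neg_index_congrT n (A T : 'M[R]_n) : A^T = A -> T \in unitmx ->
  neg_index (T^T *m A *m T) = neg_index A.
Proof.
by move=> symA uT; rewrite -{2}[T]trmxK neg_index_congr // unitmx_tr.
Qed.

Lemma neg_index_orthogonal n (A B : 'M[R]_n) : A^T = A -> B^T = B ->
  A *m B = 0 -> neg_index (A + B) = (neg_index A + neg_index B)%N.
Proof.
have ge (A' B' : 'M[R]_n) : A'^T = A' -> B'^T = B' -> A' *m B' = 0 ->
    (neg_index A' + neg_index B' <= neg_index (A' + B')%R)%N.
  move=> sA sB AB; have BA : B' *m A' = 0.
    by rewrite -sA -sB -trmx_mul AB trmx0.
  have [k1 [V1 [X1 [<- VV1 VX1]]]] := neg_index_witness sA.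
  have [k2 [V2 [X2 [<- VV2 VX2]]]] := neg_index_witness sB.
  apply: (@neg_index_ge _ _ _ (col_mx V1 V2)).
    by rewrite linearD /= sA sB.
  rewrite (_ : _ *m _ = - 1%:M); first exact: negdefN1.
  have V1B : V1 *m B' = 0 by rewrite VX1 -mulmxA AB mulmx0.
  have V2A : V2 *m A' = 0 by rewrite VX2 -mulmxA BA mulmx0.
  have AV2 : A' *m V2^T = 0 by rewrite VX2 trmx_mul sB mulmxA AB mul0mx.
  have BV1 : B' *m V1^T = 0 by rewrite VX1 trmx_mul sA mulmxA BA mul0mx.
  rewrite mul_col_mx tr_col_mx mul_col_row !mulmxDr V1B V2A addr0 add0r.
  rewrite VV1 VV2 -!mulmxA AV2 BV1 !mulmx0.
  by rewrite scalar_mx_block opp_block_mx !oppr0.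
move=> sA sB AB; apply/eqP; rewrite eqn_leq ge // andbT.
have sAB : (A + B)^T = A + B by rewrite linearD /= sA sB.
rewrite -(leq_add2r (neg_index (- (A + B)))) neg_index_add_rank //.
apply: leq_trans (mxrank_add _ _) _.
rewrite -(neg_index_add_rank sA) -(neg_index_add_rank sB) addnACA leq_add2l.
rewrite opprD ge //; first by rewrite linearN /= sA.
  by rewrite linearN /= sB.
by rewrite mulNmx mulmxN AB !oppr0.
Qed.

Lemma neg_index_block_ul m n (A : 'M[R]_m) : A^T = A ->
  neg_index (block_mx A 0 0 0 : 'M[R]_(m + n)) = neg_index A.
Proof.
move=> sA; apply/eqP; rewrite eqn_leq; apply/andP; split.
  rewrite (_ : block_mx _ _ _ _ =
      col_mx 1%:M 0 *m A *m (col_mx 1%:M (0 : 'M[R]_(n, m)))^T).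
    exact: neg_index_congr_le.
  by rewrite tr_col_mx trmx1 trmx0 mul_col_mx mul_col_row !mul1mx !mulmx1
             !mul0mx !mulmx0.
have {1}-> : A = row_mx 1%:M 0 *m block_mx A 0 0 (0 : 'M[R]_n) *m (row_mx 1%:M 0)^T.
  by rewrite tr_row_mx trmx1 trmx0 mul_row_block mul_row_col !mul1mx !mulmx1
             !mul0mx !addr0 mulmx0 addr0.
by apply: neg_index_congr_le; rewrite tr_block_mx sA !trmx0.
Qed.

Lemma neg_index_block_dr m n (B : 'M[R]_n) : B^T = B ->
  neg_index (block_mx 0 0 0 B : 'M[R]_(m + n)) = neg_index B.
Proof.
move=> sB; apply/eqP; rewrite eqn_leq; apply/andP; split.
  rewrite (_ : block_mx _ _ _ _ =
      col_mx 0 1%:M *m B *m (col_mx (0 : 'M[R]_(m, n)) 1%:M)^T).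
    exact: neg_index_congr_le.
  by rewrite tr_col_mx trmx1 trmx0 mul_col_mx mul_col_row !mul1mx !mulmx1
             !mul0mx !mulmx0.
have {1}-> : B = row_mx 0 1%:M *m block_mx (0 : 'M[R]_m) 0 0 B *m (row_mx 0 1%:M)^T.
  by rewrite tr_row_mx trmx1 trmx0 mul_row_block mul_row_col !mul1mx !mulmx1
             !mul0mx !add0r mulmx0 add0r.
by apply: neg_index_congr_le; rewrite tr_block_mx sB !trmx0.
Qed.

Lemma neg_index_block_diag m n (A : 'M[R]_m) (B : 'M[R]_n) :
  A^T = A -> B^T = B ->
  neg_index (block_mx A 0 0 B) = (neg_index A + neg_index B)%N.
Proof.
move=> sA sB; rewrite -(neg_index_block_ul n sA) -(neg_index_block_dr m sB).
rewrite -neg_index_orthogonal ?tr_block_mx ?sA ?sB ?trmx0 //.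
  by rewrite add_block_mx !addr0 !add0r.
by rewrite mulmx_block !mulmx0 !mul0mx !addr0 block_mx0.
Qed.

Lemma neg_index_hyperbolic m n (M : 'M[R]_(m, n)) :
  neg_index (block_mx 0 M M^T 0) = \rank M.
Proof.
set B := block_mx _ _ _ _; have sB : B^T = B by rewrite tr_block_mx !trmx0 trmxK.
have nB : neg_index (- B) = neg_index B.
  pose T : 'M[R]_(m + n) := block_mx 1%:M 0 0 (- 1%:M).
  have TT : T *m T^T = 1%:M.
    rewrite /T tr_block_mx mulmx_block !trmx0 linearN /= !trmx1.
    rewrite !mulmx0 !mul0mx !mulmx1 mulNmx mulmxN mulmx1 opprK !addr0 !add0r.
    by rewrite -scalar_mx_block.
  rewrite -(neg_index_congr sB (mulmx1_unit TT).1); congr neg_index.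
  rewrite /T /B tr_block_mx !mulmx_block !trmx0 linearN /= !trmx1.
  rewrite !mulmx0 !mul0mx !mulNmx !mulmxN !mulmx1 !mul1mx !addr0 !add0r.
  by rewrite opp_block_mx !oppr0.
apply/eqP; rewrite -(inj_eq double_inj) -addnn -{2}nB neg_index_add_rank //.
pose P : 'M[R]_(m + n, n + m) := block_mx 0 1%:M 1%:M 0.
have PP : P *m block_mx 0 1%:M 1%:M 0 = 1%:M.
  rewrite /P mulmx_block !mulmx0 !mul0mx !mulmx1 !addr0 !add0r.
  by rewrite -scalar_mx_block.
have fP : row_free P by apply/row_freeP; exists (block_mx 0 1%:M 1%:M 0).
rewrite -(mxrankMfree _ fP) /B /P mulmx_block !mulmx0 !mul0mx !mulmx1.
by rewrite !addr0 !add0r rank_diag_block_mx mxrank_tr addnn.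
Qed.

End Inertia.

(** * The comparative index in a Lagrangian chart *)

Section ComparativeIndex.
Variable R : realType.

Lemma mpinv_sym n (A : 'M[R]_n) : A^T = A ->
  (mpinv A)^T = mpinv A /\ mpinv A *m A = A *m mpinv A.
Proof.
move=> sA; have uD B : is_mpinv A B -> B = mpinv A.
  by move=> h; exact: is_mpinv_uniq h (mpinvP A).
have := mpinvP A; move: (mpinv A) uD => D uD [e1 e2 e3 e4].
have sD : D^T = D.
  apply: uD; split.
  - by apply: trmx_inj; rewrite !trmx_mul trmxK sA mulmxA e1.
  - by apply: trmx_inj; rewrite !trmx_mul !trmxK sA mulmxA e2.
  - by rewrite trmx_mul trmxK sA -e4 trmx_mul sA.
  - by rewrite trmx_mul trmxK sA -e3 trmx_mul sA.
by split=> //; rewrite -[LHS]e4 trmx_mul sA sD.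
Qed.

Lemma neg_index_block_decomp n (A M F : 'M[R]_n) :
  A^T = A -> F^T = F -> A *m M = 0 -> F *m M^T = 0 ->
  neg_index (block_mx A M M^T F) = (neg_index A + neg_index F + \rank M)%N.
Proof.
move=> sA sF AM FM.
(* These two summands annihilate each other, so their negative indices add. *)
have -> : block_mx A M M^T F = block_mx A 0 0 F + block_mx 0 M M^T 0.
  by rewrite add_block_mx !addr0 !add0r.
rewrite neg_index_orthogonal ?neg_index_block_diag ?neg_index_hyperbolic //.
- by rewrite tr_block_mx sA sF !trmx0.
- by rewrite tr_block_mx trmxK !trmx0.
- by rewrite mulmx_block AM FM !mulmx0 !mul0mx !addr0 block_mx0.
Qed.

(* Block elimination: u is replaced by u + G v in the quadratic form. *)
Lemma neg_index_shear n (A B D G : 'M[R]_n) : A^T = A -> D^T = D ->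
  neg_index (block_mx A B B^T D) =
  neg_index (block_mx A (A *m G + B) (A *m G + B)^T
    (D + G^T *m B + B^T *m G + G^T *m A *m G)).
Proof.
move=> sA sD; pose T : 'M[R]_(n + n) := block_mx 1%:M G 0 1%:M.
have uT : T \in unitmx.
  by rewrite unitmxE /T det_ublock !det1 mulr1 unitr1.
rewrite -(neg_index_congrT _ uT); last by rewrite tr_block_mx sA sD trmxK.
congr neg_index; rewrite /T tr_block_mx !trmx1 !trmx0 !mulmx_block.
rewrite !mul1mx !mulmx1 !mul0mx !mulmx0 !addr0.
congr block_mx; first by rewrite linearD /= trmx_mul sA.
by rewrite mulmxDl addrC (addrC _ D) (addrC _ (B^T *m G)) !addrA.
Qed.

Lemma neg_index_comparative n (X U Xh Uh : 'M[R]_n) :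
  U \in unitmx -> Uh \in unitmx ->
  X^T *m U = U^T *m X -> Xh^T *m Uh = Uh^T *m Xh ->
  let W := X^T *m Uh - U^T *m Xh in
  let M := (1%:M - mpinv X *m X) *m W in
  let V := 1%:M - mpinv M *m M in
  let P := V *m W^T *m mpinv X *m Xh *m V in
  (\rank M + neg_index P + neg_index (U^T *m X))%N =
  (neg_index (Uh^T *m Xh) + neg_index (W^T *m invmx U *m Uh))%N.
Proof.
move=> uU uUh sX sXh W M V P.
have WE : W = X^T *m Uh - U^T *m Xh by [].
have [m1 m2 m3 m4] := mpinvP M.
have [x1 x2 x3 x4] := mpinvP X.
have ME : M = (1%:M - mpinv X *m X) *m W by [].
have VE : V = 1%:M - mpinv M *m M by [].
have EP : P = V *m W^T *m mpinv X *m Xh *m V by [].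
clearbody P V; move: (mpinv M) m1 m2 m3 m4 VE => Mi m1 m2 m3 m4 VE.
clearbody M; move: (mpinv X) x1 x2 x3 x4 ME EP => D0 x1 x2 x3 x4 ME EP.
clearbody W.
have [A AE] : exists A, A = U^T *m X by exists (U^T *m X).
have sA : A^T = A by rewrite AE trmx_mul trmxK.
have [sD DA] := mpinv_sym sA; have [a1 a2 a3 a4] := mpinvP A.
move: (mpinv A) sD DA a1 a2 a3 a4 => D sD DA a1 a2 a3 a4.
have [C CW] : exists C, C = W^T *m invmx U *m Uh by exists (W^T *m invmx U *m Uh).
rewrite -AE -CW.
have XE : X = (invmx U)^T *m A.
  by rewrite AE mulmxA -trmx_mul mulmxV // trmx1 mul1mx.
have XDA : X *m (D *m A) = X by rewrite {1}XE -mulmxA (mulmxA A) a1 -XE.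
have AP : A *m (D0 *m X) = A by rewrite AE -!mulmxA (mulmxA X) x1.
have PE : D0 *m X = D *m A.
  have e : D *m A *m (D0 *m X) = D *m A by rewrite -mulmxA AP.
  by rewrite -e -[LHS]x4 -{1}XDA mulmxA trmx_mul x4 a4.
have VXU : X *m invmx U = (invmx U)^T *m X^T.
  by rewrite -[RHS]mulmx1 -(mulmxV uU) mulmxA -(mulmxA _ X^T) sX mulmxA
             -trmx_mul mulmxV // trmx1 mul1mx.
have CE : C = Uh^T *m (X *m invmx U) *m Uh - Uh^T *m Xh.
  rewrite CW WE linearB /= !trmx_mul !trmxK !mulmxBl -!mulmxA.
  by rewrite (mulmxA U) mulmxV // mul1mx sXh.
have sC : C^T = C.
  have sS : (X *m invmx U)^T = X *m invmx U by rewrite trmx_mul VXU.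
  rewrite CE; move: (X *m invmx U) sS => S sS.
  by rewrite linearB /= !trmx_mul !trmxK sS sXh mulmxA.
have sW : C *m (invmx Uh *m U) = W^T.
  by rewrite CW -!mulmxA (mulmxA Uh) mulmxV // mul1mx mulVmx // mulmx1.
have [Q QE] : exists Q, Q = Mi *m M by exists (Mi *m M).
rewrite -QE in VE m4.
have sV : V^T = V by rewrite VE linearB /= trmx1 m4.
have AM : A *m M = 0.
  by rewrite ME PE mulmxA mulmxBr mulmx1 mulmxA a1 subrr mul0mx.
have MV : M *m V = 0 by rewrite VE mulmxBr mulmx1 QE mulmxA m1 subrr.
have WV : W *m V = D *m A *m W *m V.
  apply/eqP; rewrite -subr_eq0 -mulmxBl -{1}[W]mul1mx -mulmxBl -PE.
  by rewrite -ME MV.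
have VW : V *m W^T = V *m W^T *m (D *m A).
  by rewrite -{1}sV -trmx_mul WV !trmx_mul sV sA sD -DA !mulmxA.
have [E EE] : exists E, E = C - W^T *m D *m W by exists (C - W^T *m D *m W).
have sE : E^T = E by rewrite EE linearB /= sC !trmx_mul trmxK sD mulmxA.
have XhE : Xh = X *m invmx U *m Uh - (invmx U)^T *m W.
  rewrite WE mulmxBr VXU !mulmxA -(trmx_mul U) mulmxV // trmx1 mul1mx.
  by rewrite opprB addrC subrK.
have PV : P = V *m E *m V.
  have : D0 *m Xh *m V = D *m A *m invmx U *m Uh *m V - D *m W *m V.
    rewrite XhE mulmxBr mulmxBl !mulmxA PE; congr (_ - _).
    rewrite -(mulmxA (D0 *m _) W V) WV DA !mulmxA -(mulmxA D0) -XE PE.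
    by rewrite a2.
  rewrite EP -!mulmxA => ->; rewrite mulmxA mulmxBr !mulmxA.
  rewrite mulmxA in VW; rewrite -VW.
  by rewrite EE mulmxBr mulmxBl CW !mulmxA.
rewrite PV.
transitivity (neg_index (block_mx A M M^T (V *m E *m V))).
  rewrite neg_index_block_decomp //; first by rewrite addnC (addnC (\rank M)) addnA.
    by rewrite !trmx_mul sV sE mulmxA.
  have VM : V *m M^T = 0 by rewrite -{1}sV -trmx_mul MV trmx0.
  by rewrite -(mulmxA _ V M^T) VM mulmx0.
have [N NE] : exists N, N = - (Mi^T *m (E - 2^-1 *: (E *m Q))) by eexists.
have AN : A *m N = 0.
  have e : Mi^T = M *m Mi *m Mi^T.
    by rewrite -{1}m2 -mulmxA trmx_mul m3.
  by rewrite NE mulmxN e !mulmxA AM !mul0mx oppr0.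
have MN : M^T *m N = - (Q *m E) + 2^-1 *: (Q *m E *m Q).
  rewrite NE mulmxN mulmxA -trmx_mul -QE m4 mulmxBr opprB -scalemxAr mulmxA.
  by rewrite addrC.
transitivity (neg_index (block_mx A M M^T E)).
  rewrite (neg_index_shear M N sA sE) -(mulmxA _ A N) AN !mulmx0 add0r addr0.
  congr (neg_index (block_mx _ _ _ _)).
  have -> : N^T *m M = - (E *m Q) + 2^-1 *: (Q *m E *m Q).
    rewrite -[LHS]trmxK trmx_mul trmxK MN linearD linearN linearZ /=.
    by rewrite !trmx_mul sE m4 mulmxA.
  rewrite MN VE -(addrA E) addrACA -scalerDl.
  rewrite (_ : 2^-1 + 2^-1 = 1 :> R) ?scale1r; last by field.
  rewrite mulmxBl mul1mx mulmxBr mulmx1 mulmxBl opprB -[LHS]addrA; congr (_ + _).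
  by rewrite addrC [RHS]addrC addrA.
transitivity (neg_index (block_mx A W W^T C)).
  rewrite (neg_index_shear W (- (D *m W)) sA sC).
  have -> : (- (D *m W))^T = - (W^T *m D) by rewrite linearN /= trmx_mul sD.
  rewrite !mulmxN !mulNmx opprK.
  have -> : - (A *m (D *m W)) + W = M.
    by rewrite ME PE DA mulmxBl mul1mx mulmxA addrC.
  congr (neg_index (block_mx _ _ _ _)).
  by rewrite !mulmxA -(mulmxA _ D A) -(mulmxA _ _ D) a2 -addrA addNr addr0.
pose T : 'M[R]_(n + n) := block_mx (invmx Uh *m U) 0 (invmx Uh *m U) 1%:M.
have uT : T \in unitmx.
  rewrite unitmxE /T det_lblock det1 mulr1 -unitmxE unitmx_mul unitmx_inv.
  by rewrite uU uUh.
have sB : (Uh^T *m Xh)^T = Uh^T *m Xh by rewrite trmx_mul trmxK.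
rewrite -(neg_index_block_diag sB sC) -[RHS](neg_index_congrT _ uT); last first.
  by rewrite tr_block_mx sB sC !trmx0.
congr neg_index; rewrite /T tr_block_mx trmx1 trmx0 !mulmx_block.
rewrite !mul1mx !mulmx1 !mul0mx !mulmx0 !add0r !addr0.
have eW : (invmx Uh *m U)^T *m C = W by rewrite -{1}sC -trmx_mul sW trmxK.
rewrite eW.
congr block_mx; last by rewrite mul0mx add0r sW.
rewrite -eW -mulmxDl -mulmxDr CE addrC subrK.
have GU : Uh *m (invmx Uh *m U) = U by rewrite mulmxA mulmxV // mul1mx.
move: (invmx Uh *m U) GU => G GU.
rewrite -!mulmxA GU mulmxA -trmx_mul GU mulVmx // mulmx1.
by rewrite AE.
Qed.

End ComparativeIndex.

Section Wronskian.
Variables (R : realType) (n : nat).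
Implicit Types (A B L Y Yh : 'M[R]_(n + n, n)) (Z : 'M[R]_(n + n)) (C : 'M[R]_n).

Lemma tr_Jmx : (Jmx R n)^T = - Jmx R n.
Proof.
by rewrite /Jmx tr_block_mx opp_block_mx !trmx0 linearN /= !trmx1 !oppr0 opprK.
Qed.

Lemma JmxJ : Jmx R n *m Jmx R n = - 1%:M.
Proof.
rewrite /Jmx mulmx_block !mulmx0 !mul0mx mulmx1 mul1mx !addr0 !add0r.
by rewrite scalar_mx_block opp_block_mx !oppr0.
Qed.

Lemma wronskianE A B :
  wronskian A B = (usubmx A)^T *m dsubmx B - (dsubmx A)^T *m usubmx B.
Proof.
rewrite /wronskian -{1}[A]vsubmxK -{1}[B]vsubmxK tr_col_mx /Jmx.
rewrite mul_row_block !mulmx0 !mulmx1 add0r addr0 mulmxN mulmx1 mul_row_col.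
by rewrite mulNmx addrC.
Qed.

Lemma wronskian_tr A B : (wronskian A B)^T = - wronskian B A.
Proof.
by rewrite /wronskian !trmx_mul trmxK tr_Jmx mulNmx mulmxN mulmxA.
Qed.

Lemma wronskian_sp Z A B : symplectic Z ->
  wronskian (Z *m A) (Z *m B) = wronskian A B.
Proof. by move=> sZ; rewrite /wronskian trmx_mul -{2}sZ !mulmxA. Qed.

Lemma wronskianMr A B C : wronskian A (B *m C) = wronskian A B *m C.
Proof. by rewrite /wronskian mulmxA. Qed.

Lemma wronskianMl A B C : wronskian (A *m C) B = C^T *m wronskian A B.
Proof. by rewrite /wronskian trmx_mul !mulmxA. Qed.

Lemma wronskianDr A B1 B2 :
  wronskian A (B1 + B2) = wronskian A B1 + wronskian A B2.
Proof. by rewrite /wronskian mulmxDr. Qed.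

Lemma wronskianDl A1 A2 B :
  wronskian (A1 + A2) B = wronskian A1 B + wronskian A2 B.
Proof. by rewrite /wronskian linearD /= !mulmxDl. Qed.

Lemma wronskianF A B : A^T *m Jmx R n *m B = wronskian A B.
Proof. by []. Qed.

Lemma usub_Emx : usubmx (Emx R n) = 0.
Proof. by rewrite /Emx col_mxKu. Qed.

Lemma dsub_Emx : dsubmx (Emx R n) = 1%:M.
Proof. by rewrite /Emx col_mxKd. Qed.

Lemma wronskian_E A : wronskian A (Emx R n) = (usubmx A)^T.
Proof. by rewrite wronskianE usub_Emx dsub_Emx mulmx1 mulmx0 subr0. Qed.

Lemma symplectic_inv Z : symplectic Z ->
  Z \in unitmx /\ invmx Z = - (Jmx R n *m Z^T *m Jmx R n).
Proof.
move=> sZ; have e : - (Jmx R n *m Z^T *m Jmx R n) *m Z = 1%:M.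
  by rewrite mulNmx -!mulmxA (mulmxA Z^T) sZ JmxJ opprK.
have [_ uZ] := mulmx1_unit e; split=> //.
by rewrite -[RHS]mulmx1 -(mulmxV uZ) mulmxA e mul1mx.
Qed.

Lemma symplectic_inv_sp Z : symplectic Z -> symplectic (invmx Z).
Proof.
move=> sZ; have [uZ _] := symplectic_inv sZ; rewrite /symplectic -{1}sZ.
by rewrite !mulmxA -trmx_mul mulmxV // trmx1 mul1mx -mulmxA mulmxV // mulmx1.
Qed.

(* In the chart of planes transversal to L, the planes A and B are graphs of
   symmetric matrices; this matrix is congruent to their difference. *)
Definition rel_index L A B : nat :=
  neg_index ((wronskian A B)^T *m invmx (wronskian L A) *m wronskian L B).

Lemma rel_index_sp Z L A B : symplectic Z ->
  rel_index (Z *m L) (Z *m A) (Z *m B) = rel_index L A B.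
Proof. by move=> sZ; rewrite /rel_index !wronskian_sp. Qed.

Lemma invmxM (F : comUnitRingType) m (C1 C2 : 'M[F]_m) : C1 \in unitmx -> C2 \in unitmx ->
  invmx (C1 *m C2) = invmx C2 *m invmx C1.
Proof.
move=> u1 u2; have e : invmx C2 *m invmx C1 *m (C1 *m C2) = 1%:M.
  by rewrite mulmxA -(mulmxA _ _ C1) mulVmx // mulmx1 mulVmx.
by rewrite -[RHS]mulmx1 -(@mulmxV _ _ (C1 *m C2)) ?unitmx_mul ?u1 // mulmxA e mul1mx.
Qed.

Lemma rel_index_sym L A B :
  wronskian A A = 0 -> wronskian B B = 0 -> wronskian L L = 0 ->
  wronskian L A \in unitmx ->
  ((wronskian A B)^T *m invmx (wronskian L A) *m wronskian L B)^T =
  (wronskian A B)^T *m invmx (wronskian L A) *m wronskian L B.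
Proof.
move=> AA BB LL uLA.
have AL : wronskian A L = - (wronskian L A)^T by rewrite wronskian_tr opprK.
pose T : 'M[R]_(n + n) := row_mx L A.
pose G : 'M[R]_(n + n) := block_mx 0 (wronskian L A) (- (wronskian L A)^T) 0.
have TJT : T^T *m Jmx R n *m T = G.
  rewrite /T tr_row_mx mul_col_mx mul_col_row.
  by rewrite !wronskianF LL AA AL.
have uG : G \in unitmx.
  pose G' : 'M[R]_(n + n) :=
    block_mx 0 (- (invmx (wronskian L A))^T) (invmx (wronskian L A)) 0.
  have GG' : G *m G' = 1%:M.
    rewrite /G /G' mulmx_block !mulmx0 !mul0mx !addr0 !add0r mulmxV //.
    rewrite mulNmx mulmxN opprK -trmx_mul mulVmx // trmx1.
    by rewrite -scalar_mx_block.
  exact: (mulmx1_unit GG').1.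
have uT : T \in unitmx.
  by move: uG; rewrite -TJT !unitmx_mul => /andP[_ ->].
have [P [Q BE]] : exists P Q, B = L *m P + A *m Q.
  pose V := invmx T *m B; exists (usubmx V), (dsubmx V).
  by rewrite -mul_row_col vsubmxK /V mulmxA mulmxV // mul1mx.
have LB : wronskian L B = wronskian L A *m Q.
  by rewrite BE wronskianDr !wronskianMr LL mul0mx add0r.
have AB : wronskian A B = - (wronskian L A)^T *m P.
  by rewrite BE wronskianDr !wronskianMr AA mul0mx addr0 AL.
have F : (wronskian A B)^T *m invmx (wronskian L A) *m wronskian L B =
    - (P^T *m wronskian L A *m Q).
  rewrite AB LB; move: (wronskian L A) uLA => w uw.
  rewrite trmx_mul linearN /= trmxK mulmxN !mulNmx -!mulmxA.
  by rewrite (mulmxA (invmx _)) mulVmx // mul1mx.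
have : wronskian B B =
    P^T *m wronskian L A *m Q - Q^T *m (wronskian L A)^T *m P.
  rewrite {1}BE wronskianDl !wronskianMl LB AB.
  by move: (wronskian L A) => w; rewrite mulNmx mulmxN !mulmxA.
rewrite F BB; move: (wronskian L A) => w /eqP.
rewrite eq_sym subr_eq0 => /eqP e.
by rewrite linearN /= !trmx_mul trmxK mulmxA -e.
Qed.

Lemma rel_indexMr L A B C : wronskian A A = 0 -> wronskian B B = 0 ->
  wronskian L L = 0 -> wronskian L A \in unitmx -> C \in unitmx ->
  rel_index L A (B *m C) = rel_index L A B.
Proof.
move=> AA BB LL uLA uC; rewrite /rel_index !wronskianMr.
rewrite -[RHS](neg_index_congrT _ uC); last exact: rel_index_sym.
by rewrite trmx_mul !mulmxA.
Qed.

(* The comparative index singles out the vertical plane; the relative indices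
   are symplectically invariant. *)
Lemma comparative_indexE L Y Yh :
  wronskian L L = 0 -> wronskian Y Y = 0 -> wronskian Yh Yh = 0 ->
  wronskian L (Emx R n) \in unitmx ->
  wronskian L Y \in unitmx -> wronskian L Yh \in unitmx ->
  (comparative_index Y Yh + rel_index L Y (Emx R n))%N =
  (rel_index L Yh (Emx R n) + rel_index L Y Yh)%N.
Proof.
move=> LL YY YhYh; rewrite wronskian_E unitmx_tr => uL uY uYh.
pose L1 := usubmx L; pose L2 := dsubmx L; rewrite -/L1 in uL.
have uLT : L1^T \in unitmx by rewrite unitmx_tr.
pose Q := L2 *m invmx L1.
have sQ : Q^T = Q.
  move: LL; rewrite wronskianE -/L1 -/L2 => /eqP; rewrite subr_eq0 => /eqP e.
  rewrite /Q trmx_mul -[LHS]mulmx1 -(mulmxV uL) mulmxA -(mulmxA _ _ L1) -e.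
  by rewrite mulmxA -trmx_mul mulmxV // trmx1 mul1mx.
pose sh (A : 'M[R]_(n + n, n)) := dsubmx A - Q *m usubmx A.
have shE A : wronskian L A = L1^T *m sh A.
  rewrite wronskianE /sh mulmxBr -/L1 -/L2 mulmxA; congr (_ - _ *m _).
  by rewrite -sQ -trmx_mul /Q -mulmxA mulVmx // mulmx1.
have Wsh A B : wronskian A B = (usubmx A)^T *m sh B - (sh A)^T *m usubmx B.
  have -> : (sh A)^T = (dsubmx A)^T - (usubmx A)^T *m Q.
    by rewrite /sh linearB /= trmx_mul sQ.
  rewrite /sh mulmxBr mulmxBl opprB !mulmxA.
  by rewrite addrA subrK wronskianE.
have usL A : wronskian L A \in unitmx -> sh A \in unitmx.
  by rewrite shE unitmx_mul => /andP[].
have ush := usL _ uY; have ushh := usL _ uYh.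
have symsh A : wronskian A A = 0 -> (usubmx A)^T *m sh A = (sh A)^T *m usubmx A.
  by rewrite Wsh => /eqP; rewrite subr_eq0 => /eqP.
have iE A B : sh A \in unitmx ->
    invmx (wronskian L A) *m wronskian L B = invmx (sh A) *m sh B.
  move=> uA; rewrite !shE invmxM // -!mulmxA (mulmxA _ L1^T) mulVmx //.
  by rewrite mul1mx.
have iEE A : wronskian A A = 0 -> sh A \in unitmx ->
    rel_index L A (Emx R n) = neg_index ((sh A)^T *m usubmx A).
  move=> AA uA; rewrite /rel_index -mulmxA iE // wronskian_E trmxK.
  rewrite /sh dsub_Emx usub_Emx mulmx0 subr0 mulmx1 -/(sh A).
  rewrite -(neg_index_congrT _ uA).
    by rewrite -!mulmxA mulVmx // mulmx1.
  rewrite trmx_mul trmx_inv.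
  have uAT : (sh A)^T \in unitmx by rewrite unitmx_tr.
  apply: (canLR (mulKmx uAT)); rewrite mulmxA -symsh // -mulmxA mulmxV //.
  by rewrite mulmx1.
rewrite !iEE // /rel_index -mulmxA iE // mulmxA.
have /= := neg_index_comparative ush ushh (symsh _ YY) (symsh _ YhYh).
by rewrite -Wsh.
Qed.

End Wronskian.

(** * Continuity of indices and of square roots *)

Section EntrywiseConvergence.
Variables (R : realType) (T : Type) (F : set_system T).
Context {FF : Filter F}.

Definition mxcvg m n (A : T -> 'M[R]_(m, n)) (A0 : 'M[R]_(m, n)) : Prop :=
  forall i j, A t i j @[t --> F] --> A0 i j.

Lemma cvg_bigsum (I : Type) (r : seq I) (f : I -> T -> R) (l : I -> R) :
  (forall i, f i t @[t --> F] --> l i) ->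
  \sum_(i <- r) f i t @[t --> F] --> \sum_(i <- r) l i.
Proof.
move=> fl; elim: r => [|x r IH].
  by rewrite big_nil; under eq_fun do rewrite big_nil; exact: cvg_cst.
by rewrite big_cons; under eq_fun do rewrite big_cons; exact: cvgD.
Qed.

Lemma cvg_bigprod (I : Type) (r : seq I) (f : I -> T -> R) (l : I -> R) :
  (forall i, f i t @[t --> F] --> l i) ->
  \prod_(i <- r) f i t @[t --> F] --> \prod_(i <- r) l i.
Proof.
move=> fl; elim: r => [|x r IH].
  by rewrite big_nil; under eq_fun do rewrite big_nil; exact: cvg_cst.
by rewrite big_cons; under eq_fun do rewrite big_cons; exact: cvgM.
Qed.

Lemma mxcvg_cst m n (A0 : 'M[R]_(m, n)) : mxcvg (fun=> A0) A0.
Proof. by move=> i j; exact: cvg_cst. Qed.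

Lemma mxcvgD m n (A B : T -> 'M[R]_(m, n)) A0 B0 :
  mxcvg A A0 -> mxcvg B B0 -> mxcvg (fun t => A t + B t) (A0 + B0).
Proof.
move=> hA hB i j; rewrite mxE; under eq_fun do rewrite mxE.
exact: cvgD.
Qed.

Lemma mxcvgN m n (A : T -> 'M[R]_(m, n)) A0 :
  mxcvg A A0 -> mxcvg (fun t => - A t) (- A0).
Proof. by move=> hA i j; rewrite mxE; under eq_fun do rewrite mxE; exact: cvgN. Qed.

Lemma mxcvgB m n (A B : T -> 'M[R]_(m, n)) A0 B0 :
  mxcvg A A0 -> mxcvg B B0 -> mxcvg (fun t => A t - B t) (A0 - B0).
Proof. by move=> hA hB; apply: mxcvgD => //; exact: mxcvgN. Qed.

Lemma mxcvgM m n p (A : T -> 'M[R]_(m, n)) (B : T -> 'M[R]_(n, p)) A0 B0 :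
  mxcvg A A0 -> mxcvg B B0 -> mxcvg (fun t => A t *m B t) (A0 *m B0).
Proof.
move=> hA hB i j; rewrite mxE; under eq_fun do rewrite mxE.
by apply: cvg_bigsum => k; exact: cvgM.
Qed.

Lemma mxcvgZ m n (a : T -> R) (A : T -> 'M[R]_(m, n)) (a0 : R) A0 :
  a t @[t --> F] --> a0 -> mxcvg A A0 -> mxcvg (fun t => a t *: A t) (a0 *: A0).
Proof. by move=> ha hA i j; rewrite mxE; under eq_fun do rewrite mxE; exact: cvgM. Qed.

Lemma mxcvg_tr m n (A : T -> 'M[R]_(m, n)) A0 :
  mxcvg A A0 -> mxcvg (fun t => (A t)^T) A0^T.
Proof. by move=> hA i j; rewrite mxE; under eq_fun do rewrite mxE; exact: hA. Qed.

Lemma cvg_det n (A : T -> 'M[R]_n) A0 :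
  mxcvg A A0 -> \det (A t) @[t --> F] --> \det A0.
Proof.
move=> hA; apply: cvg_bigsum => s; apply: cvgM; first exact: cvg_cst.
by apply: cvg_bigprod => i; exact: hA.
Qed.

Lemma mxcvg_adj n (A : T -> 'M[R]_n) A0 :
  mxcvg A A0 -> mxcvg (fun t => \adj (A t)) (\adj A0).
Proof.
move=> hA i j; rewrite mxE; under eq_fun do rewrite mxE.
apply: cvgM; first exact: cvg_cst.
apply: cvg_det => k l; rewrite !mxE; under eq_fun do rewrite !mxE.
exact: hA.
Qed.

Lemma mxcvg_near_unit n (A : T -> 'M[R]_n) A0 :
  mxcvg A A0 -> A0 \in unitmx -> \forall t \near F, A t \in unitmx.
Proof.
move=> hA; rewrite unitmxE unitfE => /(cvgr_neq0 _ (cvg_det hA)).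
by apply: filterS => t; rewrite unitmxE unitfE.
Qed.

Lemma near_mxcvg m n (A B : T -> 'M[R]_(m, n)) A0 :
  (\forall t \near F, A t = B t) -> mxcvg A A0 -> mxcvg B A0.
Proof.
move=> AB hA i j; apply: cvg_trans (hA i j); apply: near_eq_cvg.
by apply: filterS AB => t ->.
Qed.

Lemma mxcvg_inv n (A : T -> 'M[R]_n) A0 :
  mxcvg A A0 -> A0 \in unitmx -> mxcvg (fun t => invmx (A t)) (invmx A0).
Proof.
move=> hA uA; have nuA := mxcvg_near_unit hA uA.
apply: (@near_mxcvg _ _ (fun t => (\det (A t))^-1 *: \adj (A t))).
  by apply: filterS nuA => t ut; rewrite /invmx ut.
rewrite /invmx uA; apply: mxcvgZ; last exact: mxcvg_adj.
by apply: cvgV; [rewrite -unitfE -unitmxE | exact: cvg_det].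
Qed.

Lemma mxcvg_near m n (A : T -> 'M[R]_(m, n)) A0 (e : R) : 0 < e ->
  mxcvg A A0 -> \forall t \near F, forall i j, `|A t i j - A0 i j| < e.
Proof.
move=> e0 hA; apply: filter_forall => i; apply: filter_forall => j.
have /(cvgr_dist_lt _ _)/(_ e e0) := hA i j.
by apply: filterS => t; rewrite distrC.
Qed.

Lemma negdef_near_N1 k (B : 'M[R]_k) :
  (forall i j, `|B i j - (- 1%:M : 'M[R]_k) i j| < k.+1%:R^-1) -> negdef B.
Proof.
move=> hB u u0; pose E := B + 1%:M.
have hE i j : `|E i j| <= k.+1%:R^-1.
  by have := ltW (hB i j); rewrite !mxE opprK.
have -> : B = E - 1%:M by rewrite addrK.
rewrite mulmxBr mulmxBl mulmx1 [_ 0 0]mxE [X in _ + X]mxE subr_lt0.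
set N := (u *m u^T) 0 0; have N0 : 0 < N by exact: mulmx_tr_gt0.
have NE : N = \sum_i u 0 i ^+ 2.
  by rewrite /N mxE; apply: eq_bigr => i _; rewrite mxE.
have bound i j : u 0 i * E i j * u 0 j <= k.+1%:R^-1 * ((u 0 i ^+ 2 + u 0 j ^+ 2) / 2).
  apply: le_trans (ler_norm _) _; rewrite normrM normrM mulrAC mulrC.
  apply: ler_pM; rewrite ?mulr_ge0 ?hE //.
  rewrite -(real_normK (num_real (u 0 i))) -(real_normK (num_real (u 0 j))).
  by have := sqr_ge0 (`|u 0 i| - `|u 0 j|); lra.
apply: (@le_lt_trans _ _ (k.+1%:R^-1 * (k%:R * N))); last first.
  by rewrite mulrA gtr_pMl // mulrC ltr_pdivrMr ?ltr0n // mul1r ltr_nat.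
rewrite mxE; under eq_bigr do rewrite mxE mulr_suml mxE.
apply: (@le_trans _ _ (\sum_(j < k) \sum_(i < k)
    k.+1%:R^-1 * ((u 0 i ^+ 2 + u 0 j ^+ 2) / 2))).
  by apply: ler_sum => j _; apply: ler_sum => i _; exact: bound.
under eq_bigr do rewrite -mulr_sumr -mulr_suml big_split /= -NE sumr_const card_ord.
rewrite -mulr_sumr -mulr_suml big_split /= sumr_const card_ord sumrMnl -NE.
rewrite ler_wpM2l ?invr_ge0 // mulr_natl.
by rewrite [X in X / 2](_ : _ = N *+ k * 2) ?mulfK ?pnatr_eq0 //; ring.
Qed.

Lemma mxcvg_neg_index_ge n (A : T -> 'M[R]_n) A0 :
  mxcvg A A0 -> A0^T = A0 -> (\forall t \near F, (A t)^T = A t) ->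
  \forall t \near F, (neg_index A0 <= neg_index (A t))%N.
Proof.
move=> hA sA0 sA; have [k [V [_ [<- VV _]]]] := neg_index_witness sA0.
have hV : mxcvg (fun t => V *m A t *m V^T) (- 1%:M).
  by rewrite -VV; do 2![apply: mxcvgM => //; try exact: mxcvg_cst].
have e0 : 0 < k.+1%:R^-1 :> R by rewrite invr_gt0.
apply: filterS2 sA (mxcvg_near e0 hV) => t sAt /negdef_near_N1.
exact: neg_index_ge.
Qed.

Lemma mxcvg_neg_index n (A : T -> 'M[R]_n) A0 :
  mxcvg A A0 -> A0^T = A0 -> (\forall t \near F, (A t)^T = A t) ->
  (\forall t \near F, \rank (A t) = \rank A0) ->
  \forall t \near F, neg_index (A t) = neg_index A0.
Proof.
move=> hA sA0 sA rA; have h1 := mxcvg_neg_index_ge hA sA0 sA.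
have h2 : \forall t \near F, (neg_index (- A0) <= neg_index (- A t))%N.
  apply: mxcvg_neg_index_ge; first exact: mxcvgN.
    by rewrite linearN /= sA0.
  by apply: filterS sA => t st; rewrite linearN /= st.
apply: filterS3 rA h1 (filterI sA h2) => t rAt le1 [sAt le2].
apply/eqP; rewrite eqn_leq le1 andbT -(leq_add2r (neg_index (- A0))).
rewrite (neg_index_add_rank sA0) -rAt -(neg_index_add_rank sAt).
by rewrite leq_add2l.
Qed.

End EntrywiseConvergence.

Section Segment.
Variable R : realType.

Lemma segment_induction (P : R -> R -> Prop) (a b : R) : a <= b ->
  (forall x, x \in `[a, b] -> exists2 e, 0 < e & forall c d,
     a <= c -> c <= x -> x <= d -> d <= b -> x - e < c -> d < x + e -> P c d) ->
  (forall c d e, a <= c -> c <= d -> d <= e -> e <= b -> P c d -> P d e -> P c e) ->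
  P a b.
Proof.
move=> ab hloc htr; pose S := [set x | a <= x <= b /\ P a x].
have Pa : S a.
  split; first by rewrite lexx.
  have [|e e0 h] := hloc a; first by rewrite in_itv /= lexx.
  by apply: h => //; rewrite ?ltrBlDr ?ltrDl.
have Sb : has_sup S.
  by split; [exists a | exists b => x [/andP[]]].
have as_ : a <= sup S by apply: ub_le_sup => //; case: Sb.
have sb : sup S <= b by apply: ge_sup; [exists a|move=> x [/andP[]]].
have [|e e0 h] := hloc (sup S); first by rewrite in_itv /= as_.
have [x [/andP[ax xb] Px] sx] := sup_adherent e0 Sb.
have xs : x <= sup S by apply: ub_le_sup; [case: Sb | split=> //; rewrite ax].
pose d := Num.min b (sup S + e / 2).
have sd : sup S <= d by rewrite le_min sb lerDl ltW // divr_gt0.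
have db : d <= b by rewrite ge_min lexx.
have Pd : P a d.
  apply: (htr a x d) => //; first exact: le_trans sd.
  apply: h => //; apply: (@le_lt_trans _ _ (sup S + e / 2)).
    by rewrite ge_min lexx orbT.
  by rewrite ltrD2l ltr_pdivrMr // ltr_pMr // ltr1n.
suff -> : b = d by [].
apply/eqP; rewrite eq_le db andbT leNgt; apply/negP => ltdb.
have : d <= sup S.
  by apply: ub_le_sup; [case: Sb | split=> //; rewrite db (le_trans as_)].
rewrite leNgt => /negP; apply.
have -> : d = sup S + e / 2 by apply: min_idPr; rewrite leNgt; apply/negP => h';
  move: ltdb; rewrite /d (min_idPl (ltW h')) ltxx.
by rewrite ltrDl divr_gt0.
Qed.

Lemma near_withinP (A : set R) (x : R) (Q : R -> Prop) :
  (\forall t \near within A (nbhs x), Q t) ->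
  exists2 e, 0 < e & forall t, A t -> x - e < t -> t < x + e -> Q t.
Proof.
move=> /nbhs_ballP [e /= e0 h]; exists e => // t At xt tx.
by apply: h => //=; rewrite /ball /= ltr_distlC xt tx.
Qed.

Lemma locally_constant_segment (V : Type) (f : R -> V) (a b : R) : a <= b ->
  (forall x, x \in `[a, b] -> \forall t \near within `[a, b] (nbhs x), f t = f x) ->
  f a = f b.
Proof.
move=> ab hf; apply: (segment_induction (P := fun c d => f c = f d)) => //.
  move=> x xab; have [e e0 h] := near_withinP (hf x xab).
  exists e => // c d ac cx xd db xc dx; transitivity (f x).
    apply: h => //=; last by rewrite (le_lt_trans cx) // ltrDl.
    by rewrite in_itv /= ac (le_trans cx) // (le_trans xd).
  apply/esym/h => //=; last by rewrite ltrBlDr (le_lt_trans xd) // ltrDl.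
  by rewrite in_itv /= db andbT (le_trans _ xd) // (le_trans ac).
by move=> c d e _ _ _ _ -> ->.
Qed.

End Segment.

Section SquareRoot.
Variable R : realType.

Lemma posdef_spectral n (A : 'M[R]_n) : posdef A ->
  exists (Q : 'M[R]_n) (d : 'rV[R]_n),
    [/\ Q *m Q^T = 1%:M, A = Q^T *m diag_mx d *m Q & forall i, 0 < d 0 i].
Proof.
move=> [sA pA]; have [Q [d [QQ eA]]] := real_spectral sA.
exists Q, d; split=> // i; pose v : 'cV[R]_n := Q^T *m delta_mx i 0.
have Qv : Q *m v = delta_mx i 0 by rewrite /v mulmxA QQ mul1mx.
have v0 : v != 0.
  apply/eqP => v0; move: Qv; rewrite v0 mulmx0 => /matrixP /(_ i 0) /eqP.
  by rewrite !mxE !eqxx eq_sym oner_eq0.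
have := pA v v0; rewrite eA; clearbody v.
have -> : v^T *m (Q^T *m diag_mx d *m Q) *m v =
    (Q *m v)^T *m diag_mx d *m (Q *m v) by rewrite trmx_mul !mulmxA.
rewrite Qv trmx_delta mul_mx_diag mxE (bigD1 i) //= big1; last first.
  by move=> k /negbTE ki; rewrite !mxE ki andbF !mul0r.
by rewrite !mxE !eqxx addr0 mul1r mulr1.
Qed.

Lemma posdef_diag n (Q : 'M[R]_n) (d : 'rV[R]_n) :
  Q *m Q^T = 1%:M -> (forall i, 0 < d 0 i) -> posdef (Q^T *m diag_mx d *m Q).
Proof.
move=> QQ d0; have [_ uQT] := mulmx1_unit QQ.
have uQ : Q \in unitmx by rewrite -unitmx_tr.
split; first by rewrite !trmx_mul trmxK tr_diag_mx mulmxA.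
move=> v v0; pose w := Q *m v.
have w0 : w != 0.
  by apply: contraNneq v0 => w0; rewrite -(mulKmx uQ v) -/w w0 mulmx0.
have -> : v^T *m (Q^T *m diag_mx d *m Q) *m v = w^T *m diag_mx d *m w.
  by rewrite /w trmx_mul !mulmxA.
clearbody w.
have t i : 0 <= w^T 0 i * d 0 i * w i 0.
  by rewrite mxE mulrAC -expr2 mulr_ge0 ?sqr_ge0 // ltW.
rewrite mul_mx_diag mxE; under eq_bigr do rewrite mxE.
rewrite lt_def sumr_ge0 // andbT psumr_eq0 //.
apply: contraNN w0 => /allP h; apply/eqP/colP => i.
have := h i (mem_index_enum _); rewrite /= !mxE !mulf_eq0 (gt_eqF (d0 i)) orbF orbb.
by move=> /eqP.
Qed.

Lemma invmx_spectral n (Q : 'M[R]_n) (d : 'rV[R]_n) :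
  Q *m Q^T = 1%:M -> (forall i, 0 < d 0 i) ->
  invmx (Q^T *m diag_mx d *m Q) = Q^T *m diag_mx (\row_i (d 0 i)^-1) *m Q.
Proof.
move=> QQ d0; set A := Q^T *m _ *m Q; set B := Q^T *m _ *m Q.
have QTQ : Q^T *m Q = 1%:M by exact: mulmx1C.
have AB : A *m B = 1%:M.
  rewrite /A /B !mulmxA -(mulmxA _ Q Q^T) QQ mulmx1 -(mulmxA Q^T) mulmx_diag.
  rewrite (_ : \row_i _ = const_mx 1) ?diag_const_mx ?mulmx1 //.
  by apply/rowP => i; rewrite !mxE mulfV // gt_eqF.
have [uA _] := mulmx1_unit AB.
by rewrite -[LHS]mulmx1 -AB mulKmx.
Qed.

Lemma inv_sqrtmxP n (A : 'M[R]_n) : posdef A ->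
  posdef (inv_sqrtmx A) /\ inv_sqrtmx A *m inv_sqrtmx A = invmx A.
Proof.
move=> /posdef_spectral [Q [d [QQ -> d0]]].
apply: (@xgetPex _ 0 [set K | posdef K /\ K *m K = invmx (Q^T *m diag_mx d *m Q)]).
pose s : 'rV[R]_n := \row_i (Num.sqrt (d 0 i))^-1.
have s0 i : 0 < s 0 i by rewrite mxE invr_gt0 sqrtr_gt0.
exists (Q^T *m diag_mx s *m Q); split; first exact: posdef_diag.
rewrite invmx_spectral // !mulmxA -(mulmxA _ Q Q^T) QQ mulmx1 -(mulmxA Q^T) mulmx_diag.
congr (_ *m diag_mx _ *m _); apply/rowP => i; rewrite !mxE -invfM -expr2 sqr_sqrtr //.
exact: ltW.
Qed.

Lemma gram_posdef m n (Y : 'M[R]_(m, n)) : \rank Y = n -> posdef (Y^T *m Y).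
Proof.
move=> rY; split; first by rewrite trmx_mul trmxK.
move=> v v0; have -> : v^T *m (Y^T *m Y) *m v = (v^T *m Y^T) *m (v^T *m Y^T)^T.
  by rewrite trmx_mul !trmxK !mulmxA.
apply: mulmx_tr_gt0; apply: contraNneq v0 => e.
have fY : row_free Y^T by rewrite /row_free mxrank_tr rY.
have inj := @row_free_inj _ 1%N _ _ _ fY.
by rewrite -trmx_eq0; apply/eqP/inj; rewrite e mul0mx.
Qed.

Lemma posdef_coercive n (A : 'M[R]_n) : posdef A ->
  exists2 m, 0 < m & forall u : 'rV[R]_n, m * (u *m u^T) 0 0 <= (u *m A *m u^T) 0 0.
Proof.
move=> /posdef_spectral [Q [d [QQ -> d0]]].
pose m := (1 + \sum_i (d 0 i)^-1)^-1.
have s0 : 0 <= \sum_i (d 0 i)^-1 by apply: sumr_ge0 => i _; rewrite invr_ge0 ltW.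
have m0 : 0 < m by rewrite invr_gt0 ltr_pwDl.
have md i : m <= d 0 i.
  rewrite -[leRHS]invrK lef_pV2 ?posrE ?invr_gt0 ?ltr_pwDl // (bigD1 i) //=.
  rewrite addrCA lerDl addr_ge0 // sumr_ge0 // => j _; by rewrite invr_ge0 ltW.
exists m => // u; pose w := u *m Q^T.
have QTQ : Q^T *m Q = 1%:M by exact: mulmx1C.
have -> : u *m u^T = w *m w^T.
  by rewrite /w trmx_mul trmxK mulmxA -(mulmxA u) QTQ mulmx1.
have -> : u *m (Q^T *m diag_mx d *m Q) *m u^T = w *m diag_mx d *m w^T.
  by rewrite /w trmx_mul trmxK !mulmxA.
clearbody w; rewrite mul_mx_diag !mxE mulr_sumr; apply: ler_sum => i _.
by rewrite !mxE mulrAC -expr2 mulrC ler_wpM2l // sqr_ge0.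
Qed.

Lemma mxtrace_quad n (D A : 'M[R]_n) :
  \tr (D *m A *m D^T) = \sum_i (row i D *m A *m (row i D)^T) 0 0.
Proof.
by apply: eq_bigr => i _; rewrite -row_mul [LHS]mxE [RHS]mxE; apply: eq_bigr => j _; rewrite !mxE.
Qed.

(* Pairing K^2 - K0^2 = K (K - K0) + (K - K0) K0 with K - K0 bounds the
   latter by the coercivity of K0 alone. *)
Lemma mxcvg_sqrt (T : Type) (F : set_system T) {FF : Filter F} n
    (K P : T -> 'M[R]_n) (K0 : 'M[R]_n) :
  posdef K0 -> (\forall t \near F, posdef (K t) /\ K t *m K t = P t) ->
  mxcvg F P (K0 *m K0) -> mxcvg F K K0.
Proof.
move=> pK0 hK hP; have [m m0 cK0] := posdef_coercive pK0.
pose E t := P t - K0 *m K0.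
have hE : \sum_i \sum_j E t i j ^+ 2 @[t --> F] --> (0 : R).
  have z : \sum_(i < n) \sum_(j < n) 0 ^+ 2 = 0 :> R.
    by rewrite expr0n /= big1 // => i _; rewrite big1.
  rewrite -[X in _ --> X]z.
  apply: cvg_bigsum => i; apply: cvg_bigsum => j.
  have h : E t i j @[t --> F] --> (0 : R).
    have h : mxcvg F E (K0 *m K0 - K0 *m K0).
      by apply: mxcvgB hP _; exact: mxcvg_cst.
    by have := h i j; rewrite subrr [X in _ --> X]mxE.
  by rewrite expr2; exact: cvgM.
move=> i j; apply/cvgrPdist_lt => e e0.
have me : 0 < (m * e) ^+ 2 by rewrite exprn_gt0 // mulr_gt0.
have hE' := cvgr_dist_lt _ _ hE _ me.
apply: filterS2 hK (hE' _) => t [pK KP]; rewrite sub0r normrN => hlt.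
pose D := K t - K0.
have sD : D^T = D by rewrite /D linearB /= pK.1 pK0.1.
have ED : E t = K t *m D + D *m K0.
  by rewrite /E /D -KP mulmxBr mulmxBl addrA subrK.
have KD : K0 i j - K t i j = - D i j by rewrite !mxE opprB.
have pKt := pK.2; clearbody D.
have DE : \tr (D *m E t) = \tr (D *m K t *m D^T) + \tr (D *m K0 *m D^T).
  rewrite ED sD mulmxDr mxtraceD !mulmxA; congr (_ + _).
  by rewrite -[in LHS]mulmxA mxtrace_mulC.
have lb : m * \sum_i \sum_j D i j ^+ 2 <= \tr (D *m E t).
  rewrite DE !mxtrace_quad -[leLHS]add0r; apply: lerD.
    apply: sumr_ge0 => k _; have [/eqP ->|n0] := boolP (row k D == 0).
      by rewrite !mul0mx mxE.
    have := pKt (row k D)^T; rewrite trmxK trmx_eq0 => /(_ n0) /ltW; exact.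
  rewrite mulr_sumr; apply: ler_sum => k _; apply: le_trans (cK0 (row k D)).
  rewrite mxE (ler_wpM2l (ltW m0)) //; apply: ler_sum => l _.
  by rewrite !mxE expr2.
have ub : \tr (D *m E t) <= \sum_i \sum_j (m / 2 * D i j ^+ 2) +
     \sum_i \sum_j ((2 * m)^-1 * E t i j ^+ 2).
  have -> : \tr (D *m E t) = \sum_i \sum_j D i j * E t i j.
    rewrite mxtrace_mulC -sD; apply: eq_bigr => k _; rewrite mxE.
    by apply: eq_bigr => l _; rewrite [D^T _ _]mxE mulrC sD.
  rewrite -big_split /=; apply: ler_sum => k _; rewrite -big_split /=.
  apply: ler_sum => l _; rewrite -subr_ge0.
  have -> : m / 2 * D k l ^+ 2 + (2 * m)^-1 * E t k l ^+ 2 - D k l * E t k l =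
      (2 * m)^-1 * (m * D k l - E t k l) ^+ 2 by field; rewrite gt_eqF.
  by rewrite mulr_ge0 ?sqr_ge0 // invr_ge0 mulr_ge0 // ltW.
have {lb ub} le2 : m ^+ 2 * \sum_i \sum_j D i j ^+ 2 <= \sum_i \sum_j E t i j ^+ 2.
  move: (le_trans lb ub).
  under [X in _ <= X + _ -> _]eq_bigr do rewrite -mulr_sumr.
  under [X in _ <= _ + X -> _]eq_bigr do rewrite -mulr_sumr.
  rewrite -!mulr_sumr; set x := \sum_i _; set y := \sum_i _ => h.
  rewrite -(@ler_pM2l _ (2 * m)^-1) ?invr_gt0 ?mulr_gt0 //.
  have -> : (2 * m)^-1 * (m ^+ 2 * x) = m * x - m / 2 * x by field; rewrite gt_eqF.
  by rewrite lerBlDl.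
have Dij : D i j ^+ 2 <= \sum_i \sum_j D i j ^+ 2.
  rewrite (bigD1 i) //= (bigD1 j) //= -addrA lerDl addr_ge0 //.
    by apply: sumr_ge0 => l _; exact: sqr_ge0.
  by apply: sumr_ge0 => k _; apply: sumr_ge0 => l _; exact: sqr_ge0.
rewrite KD normrN -(@ltr_pXn2r _ 2) ?nnegrE ?normr_ge0 ?ltW // real_normK ?num_real //.
rewrite -(@ltr_pM2l _ (m ^+ 2)) ?exprn_gt0 // -[ltRHS]exprMn.
apply: le_lt_trans (le_lt_trans le2 (le_lt_trans (ler_norm _) hlt)).
by rewrite ler_wpM2l // exprn_ge0 // ltW.
Qed.

End SquareRoot.

(** * Eigenvalues of Gamma and of the Lidskii matrix *)

Section Pencil.
Variables (F : fieldType) (n : nat).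
Implicit Types (A B C D P Q : 'M[F]_n).

Lemma half_angle_factor A B (i c s : F) : i ^+ 2 = -1 -> c ^+ 2 + s ^+ 2 = 1 ->
  (B - i *: A) - (c * c - s * s + i * (s * c + c * s)) *: (B + i *: A) =
  (- 2 * i * (c + i * s)) *: (c *: A + s *: B).
Proof.
move=> i2 cs; apply/matrixP => j k; rewrite !mxE; move: (A j k) (B j k) => w g.
transitivity (- 2 * i * (c + i * s) * (c * w + s * g) +
    ((g - i * w) * (1 - (c ^+ 2 + s ^+ 2)) + 2 * s ^+ 2 * g * (1 + i ^+ 2))).
  by ring.
by rewrite cs i2 !subrr !mulr0 !addr0.
Qed.

Lemma scalar_sandwich C D (e : F) : C \in unitmx -> D \in unitmx ->
  e%:M = (invmx C)^T *m (e *: (C^T *m D)) *m invmx D.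
Proof.
move=> uC uD; rewrite -scalemxAr -scalemxAl !mulmxA -trmx_mul mulmxV // trmx1.
by rewrite mul1mx mulmxV // scalemx1.
Qed.

Lemma mul_conj (i : F) A B C D : i ^+ 2 = -1 ->
  (A - i *: B) *m (C + i *: D) = A *m C + B *m D + i *: (A *m D - B *m C).
Proof.
move=> i2; rewrite mulmxBl !mulmxDr -!scalemxAl -!scalemxAr scalerA -expr2 i2.
rewrite scaleN1r scalerBr opprD opprK -!addrA; congr (_ + _).
by rewrite addrC -addrA addrC -addrA; congr (_ + _); rewrite addrC.
Qed.

Lemma mxrank_unit2 P A Q :
  P \in unitmx -> Q \in unitmx -> \rank (P *m A *m Q) = \rank A.
Proof.
move=> uP uQ; rewrite mxrankMfree ?row_free_unit // -mxrank_tr trmx_mul.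
by rewrite mxrankMfree ?mxrank_tr // row_free_unit unitmx_tr.
Qed.

Lemma mulmx_inv_swap C D : C \in unitmx -> D \in unitmx ->
  C^T *m D = D^T *m C -> D *m invmx C = (invmx C)^T *m D^T.
Proof.
move=> uC uD e; have uCT : C^T \in unitmx by rewrite unitmx_tr.
rewrite trmx_inv -[LHS](mulKmx uCT) (mulmxA C^T) e -!mulmxA.
by rewrite mulmxV // mulmx1.
Qed.

Lemma rank_scalar_sandwich A C D (e : F) : C \in unitmx -> D \in unitmx ->
  \rank (- ((invmx C)^T *m A *m invmx D) - (- e)%:M) =
  \rank (A - e *: (C^T *m D)).
Proof.
move=> uC uD; rewrite raddfN /= -opprD mxrank_opp (scalar_sandwich e uC uD).
by rewrite -mulmxBl -mulmxBr mxrank_unit2 ?unitmx_tr ?unitmx_inv.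
Qed.

Lemma rank_similar_sandwich A B D (e : F) : D \in unitmx -> B \in unitmx ->
  \rank (invmx D *m (invmx B *m A) *m D - e%:M) = \rank (A - e *: B).
Proof.
move=> uD uB; have -> : e%:M = invmx D *m (invmx B *m (e *: B)) *m D.
  by rewrite -!scalemxAr mulVmx // mulmx1 -scalemxAl mulVmx // scalemx1.
rewrite -mulmxBl -!mulmxBr mxrank_unit2 ?unitmx_inv //.
by rewrite -[_ *m _]mulmx1 mxrank_unit2 ?unitmx_inv ?unitmx1.
Qed.

Lemma invmx_sandwich P A B Q : P \in unitmx -> B \in unitmx -> Q \in unitmx ->
  invmx (P *m B *m Q) *m (P *m A *m Q) = invmx Q *m (invmx B *m A) *m Q.
Proof.
move=> uP uB uQ; rewrite !invmxM // ?unitmx_mul ?uP //.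
by rewrite -!mulmxA (mulmxA (invmx P)) mulVmx // mul1mx.
Qed.

Lemma trmx_subZ (i : F) A B : (A - i *: B)^T = A^T - i *: B^T.
Proof. by rewrite linearB /= linearZ. Qed.

End Pencil.

Section ComplexPencil.
Variables (R : realType) (n : nat).
Implicit Types (Y Yh : 'M[R]_(n + n, n)) (A B : 'M[R]_n).

Local Notation toC := (map_mx (real_complex R)).

Lemma expiE (x : R) :
  expi x = real_complex R (cos x) + 'i * real_complex R (sin x) :> R[i].
Proof. by rewrite /expi (complexE (Complex _ _)) complexiE. Qed.

Lemma expi_neq0 (x : R) : expi x != 0.
Proof.
rewrite /expi eq_complex /=; apply/negP => /andP[/eqP c0 /eqP s0].
by have := cos2Dsin2 x; rewrite c0 s0 !expr0n /= addr0 => /esym/eqP; rewrite oner_eq0.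
Qed.

Lemma expi_piD (x : R) : expi (pi + x) = - expi x.
Proof.
rewrite /expi (addrC pi) cosDpi sinDpi; apply/eqP.
by rewrite eq_complex /= !eqxx.
Qed.

(* After division by expi x, the left-hand side is the difference of
   exp(- i x) (B - i A) and its complex conjugate. *)
Lemma pencil_half_angle A B (x : R) :
  mx_subi B A - expi (x + x) *: mx_addi B A =
  (- 2 * 'i * expi x) *: toC (cos x *: A + sin x *: B).
Proof.
rewrite !expiE cosD sinD map_mxD !map_mxZ rmorphB rmorphD !rmorphM.
by apply: half_angle_factor; rewrite ?sqrCi // -!rmorphXn -rmorphD cos2Dsin2 rmorph1.
Qed.

Lemma gramE Y Yh :
  Y^T *m Yh = (usubmx Y)^T *m usubmx Yh + (dsubmx Y)^T *m dsubmx Yh.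
Proof. by rewrite -{1}[Y]vsubmxK -{1}[Yh]vsubmxK tr_col_mx mul_row_col. Qed.

Lemma pencil_addi Y Yh :
  (mx_subi (usubmx Y) (dsubmx Y))^T *m mx_addi (usubmx Yh) (dsubmx Yh) =
  mx_addi (Y^T *m Yh) (wronskian Y Yh).
Proof.
rewrite wronskianE gramE /mx_subi /mx_addi !map_mxD map_mxN !map_mxM -!map_trmx.
rewrite trmx_subZ.
apply: mul_conj.
exact: sqrCi.
Qed.

Lemma pencil_subi Y Yh :
  (mx_addi (usubmx Y) (dsubmx Y))^T *m mx_subi (usubmx Yh) (dsubmx Yh) =
  mx_subi (Y^T *m Yh) (wronskian Y Yh).
Proof.
have conjE A B : mx_addi A B = mx_subi A (- B).
  by rewrite /mx_addi /mx_subi map_mxN scalerN opprK.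
have conjE' A B : mx_subi A B = mx_addi A (- B).
  by rewrite /mx_addi /mx_subi map_mxN scalerN.
have trN A : (- A)^T = - A^T by exact: linearN.
have := pencil_addi (col_mx (usubmx Y) (- dsubmx Y)) (col_mx (usubmx Yh) (- dsubmx Yh)).
rewrite !col_mxKu !col_mxKd -conjE' -conjE => ->.
rewrite conjE' !wronskianE !gramE !col_mxKu !col_mxKd; congr mx_addi.
  by rewrite trN mulNmx mulmxN opprK.
by rewrite trN mulNmx mulmxN opprK opprB addrC.
Qed.

Lemma mx_addi0 A : mx_addi A 0 = toC A.
Proof. by rewrite /mx_addi map_mx0 scaler0 addr0. Qed.

Lemma mx_subi0 A : mx_subi A 0 = toC A.
Proof. by rewrite /mx_subi map_mx0 scaler0 subr0. Qed.

Lemma toC_unitmx A : (toC A \in unitmx) = (A \in unitmx).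
Proof. exact: map_unitmx. Qed.

Lemma lagrangian_unitmx Y : lagrangian_plane Y ->
  mx_addi (usubmx Y) (dsubmx Y) \in unitmx /\
  mx_subi (usubmx Y) (dsubmx Y) \in unitmx.
Proof.
move=> [WY rY]; have := pencil_addi Y Y; rewrite [wronskian Y Y]WY mx_addi0 => e.
have : toC (Y^T *m Y) \in unitmx by rewrite toC_unitmx gram_unitmx.
by rewrite -e unitmx_mul unitmx_tr => /andP[-> ->].
Qed.

Lemma Gamma_factor Y Yh : lagrangian_plane Y -> lagrangian_plane Yh ->
  Gamma Y Yh = - ((invmx (mx_subi (usubmx Y) (dsubmx Y)))^T *m
    mx_subi (Y^T *m Yh) (wronskian Y Yh) *m
    invmx (mx_addi (usubmx Yh) (dsubmx Yh))).
Proof.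
move=> LY LYh; have [uC uCb] := lagrangian_unitmx LY.
have e := pencil_addi Y Y; have e' := pencil_subi Y Y.
have YY : wronskian Y Y = 0 by exact: LY.1.
rewrite YY mx_addi0 in e.
rewrite YY mx_subi0 -e in e'.
rewrite /Gamma -pencil_subi.
move: (mx_addi (usubmx Y) (dsubmx Y)) (mx_subi (usubmx Y) (dsubmx Y)) uC uCb e' {e}.
move=> C Cb uC uCb e'.
by rewrite (mulmx_inv_swap uCb uC (esym e')) !mulmxA.
Qed.

Lemma rank_pencil A B (x : R) :
  \rank (mx_subi B A - expi (x + x) *: mx_addi B A) =
  \rank (cos x *: A + sin x *: B)%R.
Proof.
rewrite pencil_half_angle mxrank_scale_nz; first by rewrite mxrank_map.
by rewrite !mulf_neq0 ?oppr_eq0 ?pnatr_eq0 ?neq0Ci ?expi_neq0.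
Qed.

Lemma rank_Gamma Y Yh (x : R) : lagrangian_plane Y -> lagrangian_plane Yh ->
  \rank (Gamma Y Yh - (expi (pi + (x + x)))%:M) =
  \rank (cos x *: wronskian Y Yh + sin x *: (Y^T *m Yh))%R.
Proof.
move=> LY LYh; have [uC uCb] := lagrangian_unitmx LY.
have [uCh uCbh] := lagrangian_unitmx LYh.
rewrite -rank_pencil -pencil_addi.
rewrite Gamma_factor //.
rewrite expi_piD.
have h := rank_scalar_sandwich (mx_subi (Y^T *m Yh) (wronskian Y Yh)) (expi (x + x)) uCb uCh.
exact: h.
Qed.

Lemma Kmx_spec Y : lagrangian_plane Y ->
  [/\ posdef (Kmx Y), (Kmx Y)^T = Kmx Y, Kmx Y \in unitmx &
      Kmx Y *m (Y^T *m Y) *m Kmx Y = 1%:M].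
Proof.
move=> [_ rY]; have [pK KK] := inv_sqrtmxP (gram_posdef rY).
have uS := gram_unitmx rY.
have uK : Kmx Y \in unitmx.
  have : Kmx Y *m Kmx Y \in unitmx by rewrite [_ *m _]KK unitmx_inv.
  by rewrite unitmx_mul => /andP[].
split=> //; first exact: pK.1.
rewrite -[Y^T *m Y]invmxK -[invmx (Y^T *m Y)]KK invmxM //.
by rewrite !mulmxA mulmxV // mul1mx mulVmx.
Qed.

Lemma Jmx_symplectic : symplectic (Jmx R n).
Proof. by rewrite /symplectic -mulmxA JmxJ mulmxN mulmx1 tr_Jmx opprK. Qed.

Lemma wronskian_Jl (A' : 'M[R]_(n + n, n)) Yh : wronskian (Jmx R n *m A') Yh = A'^T *m Yh.
Proof.
rewrite /wronskian trmx_mul tr_Jmx mulmxN !mulNmx -(mulmxA A'^T) JmxJ.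
by rewrite mulmxN mulmx1 mulNmx opprK.
Qed.

Lemma wronskian_Jr Y (A' : 'M[R]_(n + n, n)) : wronskian Y (Jmx R n *m A') = - (Y^T *m A').
Proof. by rewrite /wronskian mulmxA -(mulmxA Y^T) JmxJ mulmxN mulmx1 mulNmx. Qed.

Lemma symplectic_row_mx (P Q : 'M[R]_(n + n, n)) :
  wronskian P P = 0 -> wronskian Q Q = 0 -> wronskian P Q = 1%:M ->
  symplectic (row_mx P Q).
Proof.
move=> PP QQ PQ; rewrite /symplectic tr_row_mx mul_col_mx mul_col_row.
rewrite -[P^T *m _ *m P]/(wronskian P P) -[Q^T *m _ *m Q]/(wronskian Q Q).
rewrite -[P^T *m _ *m Q]/(wronskian P Q) -[Q^T *m _ *m P]/(wronskian Q P).
by rewrite PP QQ PQ -[wronskian Q P]opprK -wronskian_tr PQ trmx1.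
Qed.

Lemma invmx_row_mx m (P Q : 'M[R]_(n + n, n)) (B : 'M[R]_(n + n, m)) :
  symplectic (row_mx P Q) ->
  invmx (row_mx P Q) *m B =
  col_mx (- (Q^T *m Jmx R n *m B)) (P^T *m Jmx R n *m B).
Proof.
move=> /symplectic_inv[_ ->]; rewrite tr_row_mx -!mulmxA mulNmx -!mulmxA.
rewrite (mul_col_mx P^T Q^T) {1}/Jmx mul_block_col !mul0mx !mulNmx !mul1mx add0r addr0.
by rewrite opp_col_mx opprK.
Qed.

Lemma Zmx_symplectic Y : lagrangian_plane Y -> symplectic (Zmx Y).
Proof.
move=> LY; have [_ sK _ KSK] := Kmx_spec LY.
have YY : wronskian Y Y = 0 := LY.1.
apply: symplectic_row_mx; rewrite wronskianMl wronskianMr.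
- by rewrite wronskian_sp ?YY ?mul0mx ?mulmx0 //; exact: Jmx_symplectic.
- by rewrite YY mul0mx mulmx0.
- by rewrite wronskian_Jl sK mulmxA.
Qed.

Lemma Zmx_usub Y Yh : lagrangian_plane Y ->
  usubmx (invmx (Zmx Y) *m Zmx Yh) =
  row_mx (Kmx Y *m (Y^T *m Yh) *m Kmx Yh) (- (Kmx Y *m wronskian Y Yh *m Kmx Yh)).
Proof.
move=> LY; have [_ sK uK _] := Kmx_spec LY.
rewrite invmx_row_mx; last exact: Zmx_symplectic.
rewrite col_mxKu mul_mx_row opp_row_mx !wronskianF !wronskianMl !wronskianMr sK.
by rewrite wronskian_Jr mulNmx mulmxN opprK !mulmxA.
Qed.

Lemma lidskii_factor Y Yh : lagrangian_plane Y -> lagrangian_plane Yh ->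
  lidskii_mx (invmx (Zmx Y) *m Zmx Yh) =
  invmx (toC (Kmx Yh)) *m
  (invmx (mx_addi (Y^T *m Yh) (wronskian Y Yh)) *m
   mx_subi (Y^T *m Yh) (wronskian Y Yh)) *m toC (Kmx Yh).
Proof.
move=> LY LYh; have [uC uCb] := lagrangian_unitmx LY.
have [uCh uCbh] := lagrangian_unitmx LYh.
have [_ _ uK _] := Kmx_spec LY; have [_ _ uKh _] := Kmx_spec LYh.
have u1 : mx_addi (Y^T *m Yh) (wronskian Y Yh) \in unitmx.
  by rewrite -pencil_addi unitmx_mul unitmx_tr uCb.
rewrite /lidskii_mx /ulsubmx /ursubmx Zmx_usub // row_mxKl row_mxKr.
set K := Kmx Y; set Kh := Kmx Yh; set G := Y^T *m Yh; set W := wronskian Y Yh.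
have -> : mx_subi (K *m G *m Kh) (- (K *m W *m Kh)) =
    toC K *m mx_addi G W *m toC Kh.
  rewrite /mx_subi /mx_addi map_mxN scalerN opprK mulmxDr mulmxDl.
  by rewrite -scalemxAr -scalemxAl !map_mxM.
have -> : mx_addi (K *m G *m Kh) (- (K *m W *m Kh)) =
    toC K *m mx_subi G W *m toC Kh.
  rewrite /mx_subi /mx_addi map_mxN scalerN mulmxBr mulmxBl.
  by rewrite -scalemxAr -scalemxAl !map_mxM.
have uKc : toC K \in unitmx by rewrite toC_unitmx.
have uKhc : toC Kh \in unitmx by rewrite toC_unitmx.
have h := invmx_sandwich (mx_subi G W) uKc u1 uKhc.
exact: h.
Qed.

Lemma rank_lidskii Y Yh (x : R) : lagrangian_plane Y -> lagrangian_plane Yh ->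
  \rank (lidskii_mx (invmx (Zmx Y) *m Zmx Yh) - (expi (x + x))%:M) =
  \rank (cos x *: wronskian Y Yh + sin x *: (Y^T *m Yh))%R.
Proof.
move=> LY LYh; have [uC uCb] := lagrangian_unitmx LY.
have [uCh uCbh] := lagrangian_unitmx LYh; have [_ _ uKh _] := Kmx_spec LYh.
have uKhc : toC (Kmx Yh) \in unitmx by rewrite toC_unitmx.
have u1 : mx_addi (Y^T *m Yh) (wronskian Y Yh) \in unitmx.
  by rewrite -pencil_addi unitmx_mul unitmx_tr uCb.
have h := rank_similar_sandwich (mx_subi (Y^T *m Yh) (wronskian Y Yh)) (expi (x + x)) uKhc u1.
by rewrite -rank_pencil lidskii_factor //; exact: h.
Qed.

End ComplexPencil.

Section Chart.
Variables (R : realType) (n : nat).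
Implicit Types (Y Yh : 'M[R]_(n + n, n)).

(* Lagrangian and transversal to Y for every q; a generic q makes it transversal
   to finitely many further planes. *)
Definition chart_plane (q : R) Y : 'M[R]_(n + n, n) := Jmx R n *m Y + q *: Y.

Lemma wronskian_chart q Y B :
  wronskian (chart_plane q Y) B = Y^T *m B + q *: wronskian Y B.
Proof.
rewrite /chart_plane wronskianDl wronskian_Jl; congr (_ + _).
by rewrite /wronskian linearZ /= -!scalemxAl.
Qed.

Lemma wronskian_chart_self q Y : lagrangian_plane Y ->
  wronskian (chart_plane q Y) Y = Y^T *m Y.
Proof. by move=> [YY _]; rewrite wronskian_chart [wronskian Y Y]YY scaler0 addr0. Qed.

Lemma chart_plane_lagrangian q Y : lagrangian_plane Y ->
  wronskian (chart_plane q Y) (chart_plane q Y) = 0.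
Proof.
move=> LY; rewrite wronskian_chart.
have -> : wronskian Y (chart_plane q Y) = - (Y^T *m Y).
  rewrite -[LHS]opprK -wronskian_tr wronskian_chart_self //.
  by rewrite trmx_mul trmxK.
rewrite /chart_plane mulmxDr mulmxA [Y^T *m _ *m Y]LY.1 add0r -scalemxAr.
by rewrite scalerN subrr.
Qed.

Definition chart_mx q Y Yh : 'M[R]_n :=
  - (wronskian Y Yh *m invmx (Y^T *m Yh + q *: wronskian Y Yh)).

Lemma chart_mxE q Y Yh : lagrangian_plane Y ->
  chart_mx q Y Yh *m (Y^T *m Y) =
  (wronskian Yh Y)^T *m invmx (wronskian (chart_plane q Y) Yh) *m
  wronskian (chart_plane q Y) Y.
Proof.
by move=> LY; rewrite wronskian_chart_self // wronskian_chart wronskian_tr !mulNmx.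
Qed.

Lemma chart_mx_sym q Y Yh : lagrangian_plane Y -> lagrangian_plane Yh ->
  Y^T *m Yh + q *: wronskian Y Yh \in unitmx ->
  (chart_mx q Y Yh *m (Y^T *m Y))^T = chart_mx q Y Yh *m (Y^T *m Y).
Proof.
move=> LY LYh uD; rewrite chart_mxE // rel_index_sym //.
- exact: LYh.1.
- exact: LY.1.
- exact: chart_plane_lagrangian.
- by rewrite wronskian_chart.
Qed.

Lemma chart_mx_diag q Y Yh : lagrangian_plane Y -> lagrangian_plane Yh ->
  Y^T *m Yh + q *: wronskian Y Yh \in unitmx ->
  exists (P : 'M[R]_n) (d : 'rV_n),
    [/\ P \in unitmx, chart_mx q Y Yh = invmx P *m diag_mx d *m P &
        forall h, neg_index (chart_mx q Y Yh *m (Y^T *m Y) - h *: (Y^T *m Y)) =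
                  (\sum_(i < n) (d 0%R i < h)%R)%N].
Proof.
move=> LY LYh uD; have [_ sK uK KSK] := Kmx_spec LY.
have sHS := chart_mx_sym LY LYh uD.
have sS : (Y^T *m Y)^T = Y^T *m Y by rewrite trmx_mul trmxK.
move: (chart_mx _ _ _) (Kmx Y) (Y^T *m Y) sHS sS sK uK KSK => H K S sHS sS sK uK KSK.
pose A := K *m (H *m S) *m K.
have sA : A^T = A by rewrite /A !trmx_mul -trmx_mul sHS sK !mulmxA.
have [Q [d [QQ eA]]] := real_spectral sA.
have [uQ _] := mulmx1_unit QQ.
have iQ : invmx Q = Q^T by rewrite -[RHS]mul1mx -(mulVmx uQ) -mulmxA QQ mulmx1.
have iK : invmx K = S *m K by rewrite -[RHS](mulKmx uK) (mulmxA K) KSK mulmx1.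
exists (Q *m K), d; split; first by rewrite unitmx_mul uQ.
  have -> : invmx (Q *m K) *m diag_mx d *m (Q *m K) =
      invmx K *m (Q^T *m diag_mx d *m Q) *m K by rewrite invmxM // iQ !mulmxA.
  have SKK : S *m (K *m K) = 1%:M by rewrite mulmxA -iK mulVmx.
  by rewrite -eA /A -!mulmxA mulKmx // SKK mulmx1.
move=> h; have sF : (H *m S - h *: S)^T = H *m S - h *: S.
  by rewrite linearB /= linearZ /= sHS sS.
rewrite -(neg_index_congr sF uK) sK.
rewrite (@neg_index_spectral _ _ _ Q (d - const_mx h)) //.
  by apply: eq_bigr => i _; rewrite !mxE subr_lt0.
rewrite mulmxBr mulmxBl -scalemxAr -scalemxAl KSK -/A eA.
rewrite raddfB /= mulmxBr mulmxBl; congr (_ - _).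
by rewrite diag_const_mx mul_mx_scalar -scalemxAl (mulmx1C QQ).
Qed.

Lemma chart_pencil q Y Yh (c s : R) :
  Y^T *m Yh + q *: wronskian Y Yh \in unitmx -> c - q * s != 0 ->
  c *: wronskian Y Yh + s *: (Y^T *m Yh) =
  (- (c - q * s)) *: ((chart_mx q Y Yh - (s / (c - q * s))%:M) *m
     (Y^T *m Yh + q *: wronskian Y Yh)).
Proof.
move=> uD k0; rewrite /chart_mx mulmxBl mulNmx -mulmxA mulVmx // mulmx1.
rewrite mul_scalar_mx; apply/matrixP => i j; rewrite !mxE.
move: ((wronskian Y Yh) i j) (\sum_(_ < _) _) => w g.
by field.
Qed.

Lemma rank_chart_pencil q Y Yh (c s : R) :
  Y^T *m Yh + q *: wronskian Y Yh \in unitmx -> c - q * s != 0 ->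
  \rank (c *: wronskian Y Yh + s *: (Y^T *m Yh))%R =
  \rank (chart_mx q Y Yh - (s / (c - q * s))%:M).
Proof.
move=> uD k0; rewrite (chart_pencil uD k0) mxrank_scale_nz ?oppr_eq0 //.
by rewrite mxrankMfree // row_free_unit.
Qed.

End Chart.

Section EllChart.
Variables (R : realType) (n : nat).
Implicit Types (Y Yh : 'M[R]_(n + n, n)).

Section Angles.
Variables (q eps : R).
Hypotheses (q0 : 0 < q) (eps0 : 0 < eps) (epspi : eps < pi).
Hypothesis qeps : q * sin (eps / 2) < cos (eps / 2).

(* The eigenvalue expi (pi + th) of Gamma corresponds to the eigenvalue g th of
   the chart matrix. *)
Let g (th : R) := sin (th / 2) / (cos (th / 2) - q * sin (th / 2)).

Let half_itv th : 0 <= th -> th <= eps -> 0 <= th / 2 < pi / 2.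
Proof. by move=> t0 te; rewrite divr_ge0 //= ltr_pM2r ?invr_gt0 // (le_lt_trans te). Qed.

Let sin_half th : 0 <= th -> th <= eps -> 0 <= sin (th / 2).
Proof.
move=> t0 te; have /andP[h0 h1] := half_itv t0 te.
apply: sin_ge0_pi; rewrite h0 /=; apply: ltW; apply: lt_trans h1 _.
by rewrite ltr_pdivrMr // ltr_pMr ?pi_gt0 // ltr1n.
Qed.

Let cos_half th : 0 <= th -> th <= eps -> 0 < cos (th / 2).
Proof.
move=> t0 te; have /andP[h0 h1] := half_itv t0 te.
apply: cos_gt0_pihalf; rewrite h1 andbT; apply: lt_le_trans h0.
by rewrite oppr_lt0 divr_gt0 ?pi_gt0.
Qed.

Let sin_diff_half th th' : 0 <= th -> th < th' -> th' <= eps ->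
  sin (th / 2) * cos (th' / 2) < sin (th' / 2) * cos (th / 2).
Proof.
move=> t0 tt' te; rewrite -subr_gt0.
have -> : sin (th' / 2) * cos (th / 2) - sin (th / 2) * cos (th' / 2) =
    sin (th' / 2 - th / 2) by rewrite sinB; ring.
apply: sin_gt0_pi; rewrite -mulrBl divr_gt0 ?subr_gt0 //=.
rewrite ltr_pdivrMr //; apply: lt_trans (_ : pi < _); last first.
  by rewrite ltr_pMr ?pi_gt0 // ltr1n.
by apply: le_lt_trans epspi; apply: le_trans te; rewrite gerBl.
Qed.

Lemma chart_denom_gt0 th : 0 <= th -> th <= eps ->
  0 < cos (th / 2) - q * sin (th / 2).
Proof.
move=> t0; rewrite le_eqVlt => /predU1P[->|te]; first by rewrite subr_gt0.
have h := sin_diff_half t0 te (lexx _).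
have se : 0 <= sin (eps / 2) by apply: sin_half; rewrite // ltW.
have s0 := sin_half t0 (ltW te).
have se0 : 0 < sin (eps / 2).
  rewrite lt_neqAle se andbT; apply/eqP => e0; move: h; rewrite -e0 mul0r ltNge.
  by rewrite mulr_ge0 // ltW // cos_half // ltW.
rewrite subr_gt0 -(ltr_pM2l se0); apply: le_lt_trans h.
rewrite mulrA (mulrC _ q) (mulrC _ (sin (th / 2))) ler_wpM2l //.
exact: ltW.
Qed.

Let gE th : 0 <= th -> th <= eps -> forall y,
  y * cos (th / 2) = (1 + q * y) * sin (th / 2) -> g th = y.
Proof.
move=> t0 te y e; have d0 := chart_denom_gt0 t0 te.
by apply: (canLR (mulfK _)); rewrite ?gt_eqF // mulrBr e; ring.
Qed.

Let g_mono th th' : 0 <= th -> th < th' -> th' <= eps -> g th < g th'.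
Proof.
move=> t0 tt' te; have t'0 : 0 <= th' by rewrite ltW // (le_lt_trans t0).
have te' : th <= eps by rewrite ltW // (lt_le_trans tt').
rewrite /g ltr_pdivrMr ?chart_denom_gt0 // mulrAC ltr_pdivlMr ?chart_denom_gt0 //.
by have := sin_diff_half t0 tt' te; lra.
Qed.

Lemma chart_param_image (y : R) :
  (g @` [set` `[0, eps[]) y <-> 0 <= y < g eps.
Proof.
split.
  move=> [th /=]; rewrite in_itv /= => /andP[t0 te] <-.
  have d0 := ltW (chart_denom_gt0 t0 (ltW te)).
  by rewrite g_mono // andbT divr_ge0 // sin_half // ltW.
move=> /andP[y0 yg].
have qy : 0 < 1 + q * y by rewrite ltr_pwDl // mulr_ge0 // ltW.
pose x := atan (y / (1 + q * y)).
have x0 : 0 <= x by rewrite -atan0 /x le_atan // divr_ge0 // ltW.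
have cx : 0 < cos x.
  by apply: cos_gt0_pihalf; rewrite atan_gtNpi2 atan_ltpi2.
have tx : tan x = y / (1 + q * y) by rewrite atanK.
have xe : x < eps / 2.
  have /andP[e0 e1] : 0 <= eps / 2 < pi / 2 by apply: half_itv => //; rewrite ltW.
  have ce : 0 < cos (eps / 2) by apply: cos_half => //; rewrite ltW.
  have -> : eps / 2 = atan (tan (eps / 2)).
    rewrite tanK // in_itv /= e1 andbT (lt_le_trans _ e0) //.
    by rewrite oppr_lt0 divr_gt0 ?pi_gt0.
  rewrite /x lt_atan // /tan ltr_pdivrMr // mulrAC ltr_pdivlMr //.
  have de := chart_denom_gt0 (ltW eps0) (lexx eps).
  move: yg; rewrite /g ltr_pdivlMr //.
  by lra.
exists (x + x) => /=.
  by rewrite in_itv /= addr_ge0 //= [ltRHS]splitr ltrD.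
have hx : (x + x) / 2 = x by field.
have [a0 a1] : 0 <= x + x /\ x + x <= eps.
  by split; rewrite ?addr_ge0 // [leRHS]splitr lerD // ltW.
apply: gE; rewrite // hx.
move: tx; rewrite /tan => /eqP; rewrite eqr_div ?lt0r_neq0 // => /eqP e.
by rewrite -e mulrC.
Qed.

Lemma chart_param_inj : set_inj [set` `[0, eps[] g.
Proof.
move=> x y; rewrite !inE /= !in_itv /= => /andP[x0 xe] /andP[y0 ye] gxy.
have [xy|yx|//] := ltgtP x y.
  by have := g_mono x0 xy (ltW ye); rewrite gxy ltxx.
by have := g_mono y0 yx (ltW xe); rewrite gxy ltxx.
Qed.

Lemma ell_chart Y Yh : lagrangian_plane Y -> lagrangian_plane Yh ->
  Y^T *m Yh + q *: wronskian Y Yh \in unitmx ->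
  (ell (Gamma Y Yh) eps + neg_index (chart_mx q Y Yh *m (Y^T *m Y)))%N =
  neg_index (chart_mx q Y Yh *m (Y^T *m Y) - g eps *: (Y^T *m Y)).
Proof.
move=> LY LYh uD; have [P [d [uP HE nE]]] := chart_mx_diag LY LYh uD.
rewrite nE -[X in neg_index X]subr0 -[X in _ - X](scale0r (Y^T *m Y)) nE /ell.
transitivity ((\sum_(th \in [set` `[0%R, eps[]) \rank (eigenspace (chart_mx q Y Yh) (g th)))%N
    + \sum_(i < n) (d 0%R i < 0)%R)%N.
  congr addn.
  apply: eq_fsbigr => th; rewrite inE /= in_itv /= => /andP[t0 te].
  rewrite !rank_eigenspace {1}[th]splitr rank_Gamma // (rank_chart_pencil uD) //.
  by rewrite gt_eqF // chart_denom_gt0 // ltW.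
rewrite (sum_rank_eigenspace uP HE chart_param_inj) -big_split /=.
apply: eq_bigr => i _; have geps0 : 0 < g eps.
  by have := g_mono (lexx 0) eps0 (lexx _); rewrite {1}/g mul0r sin0 mul0r.
case: asboolP => [/chart_param_image/andP[d0 ->]|nd].
  by rewrite ltNge d0.
have [d0|d0] := ltP (d 0 i) 0; first by rewrite (lt_trans d0).
rewrite ltNge; case: leP => // dg; exfalso; apply: nd.
by apply/chart_param_image; rewrite d0.
Qed.

Lemma ell_chart_unit Y Yh : lagrangian_plane Y -> lagrangian_plane Yh ->
  Y^T *m Yh + q *: wronskian Y Yh \in unitmx ->
  Gamma Y Yh - (expi (pi + eps))%:M \in unitmx ->
  chart_mx q Y Yh *m (Y^T *m Y) - g eps *: (Y^T *m Y) \in unitmx.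
Proof.
move=> LY LYh uD; rewrite -!row_free_unit /row_free {1}[eps]splitr rank_Gamma //.
rewrite (rank_chart_pencil uD); last by rewrite gt_eqF // chart_denom_gt0 // ltW.
rewrite -mul_scalar_mx -mulmxBl mxrankMfree // row_free_unit.
exact: gram_unitmx LY.2.
Qed.

End Angles.

End EllChart.

(** * Local comparison of the two indices *)

Section GenericChart.
Variables (R : realType) (n : nat).
Implicit Types (Y B : 'M[R]_(n + n, n)).

Lemma map_pencil (S : comNzRingType) (f : {rmorphism {poly R} -> S})
    (G W : 'M[R]_n) :
  f (\det (map_mx polyC G + 'X *: map_mx polyC W)) =
  \det (map_mx (fun x => f x%:P) G + f 'X *: map_mx (fun x => f x%:P) W).
Proof.
rewrite -det_map_mx; congr (\det _).
by apply/matrixP => i j; rewrite !mxE rmorphD rmorphM.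
Qed.

Lemma lagrangian_pencil_unit Y B : lagrangian_plane Y -> lagrangian_plane B ->
  exists2 p : {poly R}, p != 0 &
    forall q, p.[q] != 0 -> Y^T *m B + q *: wronskian Y B \in unitmx.
Proof.
move=> LY LB; pose M := map_mx polyC (Y^T *m B) + 'X *: map_mx polyC (wronskian Y B).
exists (\det M); last first.
  move=> q; have -> : (\det M).[q] = \det (Y^T *m B + q *: wronskian Y B).
    rewrite -[LHS]/(horner_eval q (\det M)) map_pencil; congr (\det _).
    move: (Y^T *m B) (wronskian Y B) => G W.
    by apply/matrixP => i j; rewrite !mxE /= /horner_eval !hornerC hornerX.
  by rewrite unitmxE unitfE.
have [uC uCb] := lagrangian_unitmx LY; have [uD uDb] := lagrangian_unitmx LB.
have : mx_addi (Y^T *m B) (wronskian Y B) \in unitmx.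
  by rewrite -pencil_addi unitmx_mul unitmx_tr uCb.
apply: contraTneq => M0.
pose ev : {rmorphism {poly R} -> R[i]} := horner_eval ('i : R[i]) \o map_poly (real_complex R).
suff : ev (\det M) = \det (mx_addi (Y^T *m B) (wronskian Y B)).
  by rewrite M0 rmorph0 unitmxE unitfE => <-; rewrite eqxx.
rewrite map_pencil /mx_addi.
have evC (x : R) : ev x%:P = real_complex R x by rewrite /= map_polyC /horner_eval hornerC.
have -> : ev 'X = 'i by rewrite /= map_polyX /horner_eval hornerX.
by congr (\det (_ + _ *: _)); apply/matrixP => i j; rewrite !mxE evC.
Qed.

Lemma poly_nonroot_itv (p : {poly R}) (c : R) : p != 0 -> 0 < c ->
  exists q, [/\ 0 < q, q < c & p.[q] != 0].
Proof.
move=> p0 c0; pose f (k : nat) := c / k.+2%:R.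
have finj : injective f.
  move=> k l /(mulfI (lt0r_neq0 c0)) /invr_inj /eqP.
  by rewrite eqr_nat => /eqP [].
have [/allP h|] := boolP (all (root p) [seq f k | k <- iota 0 (size p)]).
  have := max_poly_roots p0 (introT allP h).
  by rewrite map_inj_uniq ?iota_uniq // size_map size_iota ltnn => /(_ isT).
move=> /allPn [x /mapP[k _ ->] nr]; exists (f k); split=> //.
  by rewrite divr_gt0.
by rewrite /f ltr_pdivrMr // ltr_pMr // ltr1n.
Qed.

Lemma chart_exists Y B1 B2 (c : R) : lagrangian_plane Y ->
  lagrangian_plane B1 -> lagrangian_plane B2 -> 0 < c ->
  exists q, [/\ 0 < q, q < c, Y^T *m B1 + q *: wronskian Y B1 \in unitmx &
    Y^T *m B2 + q *: wronskian Y B2 \in unitmx].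
Proof.
move=> LY L1 L2 c0; have [p1 p10 h1] := lagrangian_pencil_unit LY L1.
have [p2 p20 h2] := lagrangian_pencil_unit LY L2.
have [q [q0 qc]] := poly_nonroot_itv (mulf_neq0 p10 p20) c0.
rewrite hornerM mulf_eq0 negb_or => /andP[r1 r2].
by exists q; split; [| | exact: h1 | exact: h2].
Qed.

Lemma comparative_index_chart (Z P : 'M[R]_(n + n)) (Y Yh L : 'M[R]_(n + n, n))
    (C : 'M[R]_n) :
  symplectic Z -> symplectic P -> C \in unitmx -> Z *m Emx R n = Y *m C ->
  lagrangian_plane Y -> lagrangian_plane Yh -> wronskian L L = 0 ->
  wronskian L Y \in unitmx -> wronskian L Yh \in unitmx ->
  wronskian L (Z *m (P *m Emx R n)) \in unitmx ->
  (comparative_index (invmx Z *m Yh) (P *m Emx R n) + rel_index L Yh Y)%N =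
  (rel_index L (Z *m (P *m Emx R n)) Y + rel_index L Yh (Z *m (P *m Emx R n)))%N.
Proof.
move=> sZ sP uC ZE LY LYh LL uY uYh uP; set B := P *m Emx R n in uP *.
have siZ := symplectic_inv_sp sZ; have [uZ _] := symplectic_inv sZ.
have EE : wronskian (Emx R n) (Emx R n) = 0.
  by rewrite wronskian_E usub_Emx trmx0.
have BB : wronskian B B = 0 by rewrite wronskian_sp.
have YY : wronskian Y Y = 0 := LY.1.
have YhYh : wronskian Yh Yh = 0 := LYh.1.
have iE : Emx R n = invmx Z *m (Y *m C) by rewrite -ZE mulKmx.
have iB : B = invmx Z *m (Z *m B) by rewrite mulKmx.
have h := @comparative_indexE R n (invmx Z *m L) (invmx Z *m Yh) B.
have uE : wronskian (invmx Z *m L) (Emx R n) \in unitmx.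
  by rewrite {1}iE wronskian_sp // wronskianMr unitmx_mul uY.
have eE (A : 'M[R]_(n + n, n)) : wronskian A A = 0 -> wronskian L A \in unitmx ->
    rel_index (invmx Z *m L) (invmx Z *m A) (Emx R n) = rel_index L A Y.
  by move=> AA uA; rewrite [in LHS]iE rel_index_sp // rel_indexMr.
have LZB : wronskian (invmx Z *m L) B = wronskian L (Z *m B).
  by rewrite [in LHS]iB wronskian_sp.
have ZBB : wronskian (Z *m B) (Z *m B) = 0 by rewrite wronskian_sp.
have e1 : rel_index (invmx Z *m L) B (Emx R n) = rel_index L (Z *m B) Y.
  by rewrite [in LHS]iB eE.
have e2 : rel_index (invmx Z *m L) (invmx Z *m Yh) B = rel_index L Yh (Z *m B).
  by rewrite [in LHS]iB rel_index_sp.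
rewrite -(eE Yh) // -e1 -e2.
by apply: h; rewrite ?LZB ?wronskian_sp.
Qed.

End GenericChart.

Section LocalIndices.
Variables (R : realType) (n : nat) (D : set R) (t0 : R).
Hypothesis Dt0 : D t0.
Local Notation F := (within D (nbhs t0)).
Implicit Types (Y Yh L A B V : R -> 'M[R]_(n + n, n)) (Z P : R -> 'M[R]_(n + n)).

Let FF : Filter F. Proof. exact: within_filter. Qed.
Local Notation near_unit := (@mxcvg_near_unit R R F FF _ _ _).

Lemma near_domain : \forall t \near F, D t.
Proof. exact: withinT. Qed.

Lemma mxcvg_wronskian A B : mxcvg F A (A t0) -> mxcvg F B (B t0) ->
  mxcvg F (fun t => wronskian (A t) (B t)) (wronskian (A t0) (B t0)).
Proof.
move=> hA hB; apply: mxcvgM => //; apply: mxcvgM; first exact: mxcvg_tr.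
exact: mxcvg_cst.
Qed.

Lemma rel_index_near L A B :
  mxcvg F L (L t0) -> mxcvg F A (A t0) -> mxcvg F B (B t0) ->
  (forall t, D t -> [/\ wronskian (L t) (L t) = 0, wronskian (A t) (A t) = 0 &
     wronskian (B t) (B t) = 0]) ->
  wronskian (L t0) (A t0) \in unitmx -> wronskian (L t0) (B t0) \in unitmx ->
  (forall t, D t -> \rank (wronskian (A t) (B t)) = \rank (wronskian (A t0) (B t0))) ->
  \forall t \near F, rel_index (L t) (A t) (B t) = rel_index (L t0) (A t0) (B t0).
Proof.
move=> cL cA cB h0 uA uB rAB.
have cLA := mxcvg_wronskian cL cA; have cLB := mxcvg_wronskian cL cB.
have cAB := mxcvg_wronskian cA cB.
have nuA := near_unit cLA uA; have nuB := near_unit cLB uB.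
have rk t : wronskian (L t) (A t) \in unitmx -> wronskian (L t) (B t) \in unitmx ->
    \rank ((wronskian (A t) (B t))^T *m invmx (wronskian (L t) (A t)) *m
            wronskian (L t) (B t)) = \rank (wronskian (A t) (B t)).
  move=> ut1 ut2; rewrite -mulmxA mxrankMfree ?mxrank_tr //.
  by rewrite row_free_unit unitmx_mul unitmx_inv ut1.
have cM : mxcvg F (fun t => (wronskian (A t) (B t))^T *m invmx (wronskian (L t) (A t)) *m
      wronskian (L t) (B t)) ((wronskian (A t0) (B t0))^T *m
      invmx (wronskian (L t0) (A t0)) *m wronskian (L t0) (B t0)).
  apply: mxcvgM => //; apply: mxcvgM; first exact: mxcvg_tr.
  exact: mxcvg_inv.
apply: (mxcvg_neg_index cM).
- by have [? ? ?] := h0 _ Dt0; exact: rel_index_sym.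
- apply: filterS2 near_domain nuA => t Dt ut.
  by have [? ? ?] := h0 _ Dt; exact: rel_index_sym.
- apply: filterS3 near_domain nuA nuB => t Dt ut1 ut2.
  by rewrite !rk // rAB.
Qed.

Definition chart_index q Y Yh t := rel_index (chart_plane q (Y t)) (Yh t) (Y t).

Lemma mxcvg_chart_plane q Y : mxcvg F Y (Y t0) ->
  mxcvg F (fun t => chart_plane q (Y t)) (chart_plane q (Y t0)).
Proof.
move=> cY; apply: mxcvgD; first by apply: mxcvgM => //; exact: mxcvg_cst.
by apply: mxcvgZ => //; exact: cvg_cst.
Qed.

Lemma ell_near q eps Y Yh :
  mxcvg F Y (Y t0) -> mxcvg F Yh (Yh t0) ->
  (forall t, D t -> lagrangian_plane (Y t)) ->
  (forall t, D t -> lagrangian_plane (Yh t)) ->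
  0 < q -> 0 < eps -> eps < pi -> q * sin (eps / 2) < cos (eps / 2) ->
  (Y t0)^T *m Yh t0 + q *: wronskian (Y t0) (Yh t0) \in unitmx ->
  Gamma (Y t0) (Yh t0) - (expi (pi + eps))%:M \in unitmx ->
  \forall t \near F,
    (ell (Gamma (Y t) (Yh t)) eps + chart_index q Y Yh t)%N =
    (ell (Gamma (Y t0) (Yh t0)) eps + chart_index q Y Yh t0)%N.
Proof.
move=> cY cYh LY LYh q0 e0 epi qe uD uG.
have LY0 := LY _ Dt0; have LYh0 := LYh _ Dt0.
pose h := sin (eps / 2) / (cos (eps / 2) - q * sin (eps / 2)).
pose M t := chart_mx q (Y t) (Yh t) *m ((Y t)^T *m Y t) - h *: ((Y t)^T *m Y t).
have cD : mxcvg F (fun t => (Y t)^T *m Yh t + q *: wronskian (Y t) (Yh t))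
    ((Y t0)^T *m Yh t0 + q *: wronskian (Y t0) (Yh t0)).
  apply: mxcvgD; first by apply: mxcvgM => //; exact: mxcvg_tr.
  by apply: mxcvgZ; [exact: cvg_cst | exact: mxcvg_wronskian].
have nuD := near_unit cD uD.
have cS : mxcvg F (fun t => (Y t)^T *m Y t) ((Y t0)^T *m Y t0).
  by apply: mxcvgM => //; exact: mxcvg_tr.
have cM : mxcvg F M (M t0).
  apply: mxcvgB; last by apply: mxcvgZ => //; exact: cvg_cst.
  apply: mxcvgM => //; apply: mxcvgN; apply: mxcvgM; first exact: mxcvg_wronskian.
  exact: mxcvg_inv.
have uM : M t0 \in unitmx by exact: ell_chart_unit.
have nuM := near_unit cM uM.
have eE t : D t -> (Y t)^T *m Yh t + q *: wronskian (Y t) (Yh t) \in unitmx ->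
    (ell (Gamma (Y t) (Yh t)) eps + chart_index q Y Yh t)%N = neg_index (M t).
  move=> Dt ut; rewrite /chart_index /rel_index -chart_mxE; last exact: LY.
  by apply: ell_chart => //; [exact: LY | exact: LYh].
have sM t : D t -> (Y t)^T *m Yh t + q *: wronskian (Y t) (Yh t) \in unitmx ->
    (M t)^T = M t.
  move=> Dt ut; rewrite /M linearB /= linearZ /= chart_mx_sym //.
  - by rewrite trmx_mul trmxK.
  - exact: LY.
  - exact: LYh.
have nM : \forall t \near F, neg_index (M t) = neg_index (M t0).
  apply: mxcvg_neg_index => //; first exact: sM.
    by apply: filterS2 near_domain nuD => t; exact: sM.
  by apply: filterS nuM => t ut; rewrite !mxrank_unit.
apply: filterS3 near_domain nuD nM => t Dt ut nMt.
exact: etrans (eE t Dt ut) (etrans nMt (esym (eE t0 Dt0 uD))).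
Qed.

Lemma comparative_index_near q Y Yh Z P (C : R -> 'M[R]_n) :
  mxcvg F Y (Y t0) -> mxcvg F Yh (Yh t0) ->
  mxcvg F Z (Z t0) -> mxcvg F P (P t0) ->
  (forall t, D t -> lagrangian_plane (Y t)) ->
  (forall t, D t -> lagrangian_plane (Yh t)) ->
  (forall t, D t -> [/\ symplectic (Z t), symplectic (P t), C t \in unitmx &
     Z t *m Emx R n = Y t *m C t]) ->
  (forall t, D t -> \rank (wronskian (P t *m Emx R n) (invmx (Z t) *m Yh t)) =
     \rank (wronskian (P t0 *m Emx R n) (invmx (Z t0) *m Yh t0))) ->
  (forall t, D t -> \rank (row_mx 1%:M 0 *m P t *m Emx R n) =
     \rank (row_mx 1%:M 0 *m P t0 *m Emx R n)) ->
  (Y t0)^T *m Yh t0 + q *: wronskian (Y t0) (Yh t0) \in unitmx ->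
  (Y t0)^T *m (Z t0 *m (P t0 *m Emx R n)) +
    q *: wronskian (Y t0) (Z t0 *m (P t0 *m Emx R n)) \in unitmx ->
  \forall t \near F,
    (comparative_index (invmx (Z t) *m Yh t) (P t *m Emx R n) + chart_index q Y Yh t)%N =
    (comparative_index (invmx (Z t0) *m Yh t0) (P t0 *m Emx R n) + chart_index q Y Yh t0)%N.
Proof.
move=> cY cYh cZ cP LY LYh hZ rW rX uYh uV.
pose V t := Z t *m (P t *m Emx R n); pose L t := chart_plane q (Y t).
have cV : mxcvg F V (V t0).
  by apply: mxcvgM => //; apply: mxcvgM => //; exact: mxcvg_cst.
have cL : mxcvg F L (L t0) by exact: mxcvg_chart_plane.
have VV t : D t -> wronskian (V t) (V t) = 0.
  move=> /hZ[sZ sP _ _]; rewrite /V !wronskian_sp // wronskian_E usub_Emx.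
  by rewrite trmx0.
have LL t : D t -> wronskian (L t) (L t) = 0.
  by move=> /LY ?; exact: chart_plane_lagrangian.
have uLY t : D t -> wronskian (L t) (Y t) \in unitmx.
  by move=> /LY h; rewrite wronskian_chart_self // gram_unitmx // h.2.
have uLYh : wronskian (L t0) (Yh t0) \in unitmx by rewrite wronskian_chart.
have uLV : wronskian (L t0) (V t0) \in unitmx by rewrite wronskian_chart.
have nYh := near_unit (mxcvg_wronskian cL cYh) uLYh.
have nV := near_unit (mxcvg_wronskian cL cV) uLV.
have rN (A B : 'M[R]_(n + n, n)) : \rank (wronskian A B) = \rank (wronskian B A).
  by rewrite -mxrank_tr wronskian_tr mxrank_opp.
have rV t : D t -> \rank (wronskian (Yh t) (V t)) =
    \rank (wronskian (P t *m Emx R n) (invmx (Z t) *m Yh t)).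
  move=> /hZ[sZ _ _ _]; have [uZ _] := symplectic_inv sZ.
  by rewrite rN -[in RHS](wronskian_sp _ _ sZ) mulKVmx.
have rVY t : D t -> \rank (wronskian (V t) (Y t)) =
    \rank (row_mx 1%:M 0 *m P t *m Emx R n).
  move=> /hZ[sZ _ uC ZE]; have -> : Y t = Z t *m Emx R n *m invmx (C t).
    by rewrite ZE mulmxK.
  rewrite wronskianMr mxrankMfree ?row_free_unit ?unitmx_inv //.
  rewrite wronskian_sp // wronskian_E mxrank_tr -mulmxA.
  rewrite -[X in _ = \rank (_ *m X)]vsubmxK mul_row_col mul1mx mul0mx addr0.
  by [].
have n1 : \forall t \near F, rel_index (L t) (V t) (Y t) = rel_index (L t0) (V t0) (Y t0).
  apply: rel_index_near => //; last 2 first.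
  - exact: uLY.
  - by move=> t Dt; rewrite !rVY // rX.
  by move=> t Dt; split; [exact: LL | exact: VV | exact: (LY _ Dt).1].
have n2 : \forall t \near F, rel_index (L t) (Yh t) (V t) = rel_index (L t0) (Yh t0) (V t0).
  apply: rel_index_near => //; last first.
  - by move=> t Dt; rewrite !rV // rW.
  by move=> t Dt; split; [exact: LL | exact: (LYh _ Dt).1 | exact: VV].
have E t : D t -> wronskian (L t) (Yh t) \in unitmx ->
    wronskian (L t) (V t) \in unitmx ->
    (comparative_index (invmx (Z t) *m Yh t) (P t *m Emx R n) + chart_index q Y Yh t)%N =
    (rel_index (L t) (V t) (Y t) + rel_index (L t) (Yh t) (V t))%N.
  move=> Dt u1 u2; have [sZ sP uC ZE] := hZ _ Dt.
  apply: comparative_index_chart ZE _ _ _ _ _ _ => //.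
  - exact: LY.
  - exact: LYh.
  - exact: LL.
  - exact: uLY.
apply: filterS3 near_domain (filterI nYh nV) (filterI n1 n2) => t Dt [u1 u2] [e1 e2].
apply: etrans (E t Dt u1 u2) (etrans _ (esym (E t0 Dt0 uLYh uLV))).
by rewrite e1 e2.
Qed.

End LocalIndices.

(** * From local to global *)

Section Partitions.
Variable R : realType.

Lemma tagged_partition_exists (X : Type) (Q : X -> R -> R -> Prop) (a b : R) :
  a <= b ->
  (forall x, x \in `[a, b] -> exists2 e, 0 < e & exists xi, forall c d,
     a <= c -> c <= x -> x <= d -> d <= b -> x - e < c -> d < x + e -> Q xi c d) ->
  exists p t xi, is_partition a b p t /\
    forall k, (k < p)%N -> Q (xi k) (t k) (t k.+1).
Proof.
move=> ab hloc.
have [xi0 _] : exists xi0 : X, True.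
  have [|e _ [xi _]] := hloc a; first by rewrite in_itv /= lexx.
  by exists xi.
apply: (segment_induction (P := fun c d => exists p t xi, is_partition c d p t /\
    forall k, (k < p)%N -> Q (xi k) (t k) (t k.+1))) => //.
  move=> x /hloc[e e0 [xi h]]; exists e => // c d ac cx xd db xc dx.
  have [cd|cd] := eqVneq c d.
    exists 0%N, (fun=> c), (fun=> xi); split=> [|k]; last by rewrite ltn0.
    by split=> // k; rewrite ltn0.
  exists 1%N, (fun k => if k == 0%N then c else d), (fun=> xi); split; last first.
    by case=> // _ /=; exact: h.
  by split=> // -[] //= _; rewrite lt_neqAle cd (le_trans cx).
move=> c d e ac cd de eb [p [t [xi [[tc td tlt] h]]]] [p' [t' [xi' [[t'd t'e t'lt] h']]]].
pose t2 k := if (k <= p)%N then t k else t' (k - p)%N.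
have t2E k : (p <= k)%N -> t2 k = t' (k - p)%N.
  rewrite /t2 leq_eqVlt => /predU1P[<-|pk]; last by rewrite leqNgt pk.
  by rewrite leqnn subnn td t'd.
have t2l k : (k <= p)%N -> t2 k = t k by rewrite /t2 => ->.
exists (p + p')%N, t2, (fun k => if (k < p)%N then xi k else xi' (k - p)%N); split.
  split; first by rewrite t2l.
    by rewrite t2E ?leq_addr // addKn.
  move=> k kpp; have [kp|pk] := ltnP k p.
    by rewrite !t2l ?(ltnW kp) //; exact: tlt.
  rewrite !t2E // ?(leq_trans pk) // subSn //; apply: t'lt.
  by rewrite ltn_subLR.
move=> k kpp; have [kp|pk] := ltnP k p.
  by rewrite !t2l ?(ltnW kp) //; exact: h.
rewrite !t2E // ?(leq_trans pk) // subSn //; apply: h'.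
by rewrite ltn_subLR.
Qed.

Lemma partition_sub (a b : R) p t : is_partition a b p t ->
  forall k, (k < p)%N ->
  [/\ a <= t k, t k <= t k.+1 & t k.+1 <= b].
Proof.
move=> [ta tb tlt].
have mono k l : (k <= l)%N -> (l <= p)%N -> t k <= t l.
  elim: l => [|l IH]; first by rewrite leqn0 => /eqP ->.
  rewrite leq_eqVlt => /predU1P[-> //|kl] lp.
  by rewrite (le_trans (IH kl (ltnW lp))) // ltW // tlt.
move=> k kp; split; first by rewrite -ta mono // ltnW.
  by rewrite ltW // tlt.
by rewrite -tb mono.
Qed.

Lemma within_subdomain (A B : set R) (x : R) (Q : R -> Prop) : B `<=` A ->
  (\forall t \near within A (nbhs x), Q t) -> \forall t \near within B (nbhs x), Q t.
Proof.
move=> BA; rewrite !near_withinE; apply: filterS => t h Bt.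
by apply: h; exact: BA.
Qed.

Lemma itv_sub (a b c d : R) : a <= c -> d <= b ->
  [set` `[c, d]] `<=` [set` `[a, b]].
Proof.
move=> ac db s /=; rewrite !in_itv /= => /andP[cs sd].
by rewrite (le_trans ac) //= (le_trans sd).
Qed.

(* On each subinterval f k - Phi is constant, so the sum telescopes. *)
Lemma sum_locally_constant (f : nat -> R -> int) (Phi : R -> int) (a b : R) p t :
  is_partition a b p t ->
  (forall k, (k < p)%N -> forall s, s \in `[t k, t k.+1] ->
     \forall x \near within `[t k, t k.+1] (nbhs s), f k x - f k s = Phi x - Phi s) ->
  \sum_(k < p) (f k (t k.+1) - f k (t k)) = Phi b - Phi a.
Proof.
move=> hp hf; have [ta tb tlt] := hp.
transitivity (\sum_(k < p) (Phi (t k.+1) - Phi (t k))).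
  apply: eq_bigr => k _; have [_ lek _] := partition_sub hp (ltn_ord k).
  have h : f k (t k) - Phi (t k) = f k (t k.+1) - Phi (t k.+1).
    apply: (@locally_constant_segment R int (fun x => f k x - Phi x)) => // s st.
    have := hf k (ltn_ord k) s st; rewrite !near_withinE.
    by apply: filterS => x e /e; lia.
  by lia.
by rewrite -(big_mkord xpredT (fun k => Phi (t k.+1) - Phi (t k))) telescope_sumr // ta tb.
Qed.

Lemma mxcvg_path m n (c d : R) (A : R -> 'M[R]_(m, n)) :
  {within `[c, d], continuous A} -> forall x, x \in `[c, d] ->
  mxcvg (within `[c, d] (nbhs x)) A (A x).
Proof.
move=> /subspace_continuousP cA x xcd i j.
have h := cA x xcd.
exact: (cvg_comp _ _ h (@coord_continuous R m n i j (A x))).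
Qed.

Lemma mxcvg_subdomain m n (D D' : set R) (x : R) (A : R -> 'M[R]_(m, n)) A0 :
  D' `<=` D -> mxcvg (within D (nbhs x)) A A0 -> mxcvg (within D' (nbhs x)) A A0.
Proof.
move=> DD hA i j; apply: cvg_trans (hA i j) => S /= hS.
exact: within_subdomain hS.
Qed.

Lemma xget_value (S : set int) (v : int) :
  S v -> (forall x, S x -> x = v) -> xget 0 S = v.
Proof. by move=> Sv hS; apply: hS; exact: (xgetPex 0 (ex_intro _ v Sv)). Qed.

End Partitions.

Section SeparatingAngle.
Variables (R : realType) (n : nat).
Implicit Types (Y Yh : 'M[R]_(n + n, n)).

Lemma Gamma_unitE Y Yh (x : R) : lagrangian_plane Y -> lagrangian_plane Yh ->
  (Gamma Y Yh - (expi (pi + (x + x)))%:M \in unitmx) =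
  (cos x *: wronskian Y Yh + sin x *: (Y^T *m Yh) \in unitmx).
Proof.
by move=> LY LYh; rewrite -!row_free_unit /row_free rank_Gamma.
Qed.

Lemma separating_angle_exists Y Yh : lagrangian_plane Y -> lagrangian_plane Yh ->
  exists eps : R, [/\ 0 < eps < pi,
    Gamma Y Yh - (expi (pi + eps))%:M \in unitmx &
    Gamma Y Yh - (expi (pi - eps))%:M \in unitmx].
Proof.
move=> LY LYh; have [p p0 hp] := lagrangian_pencil_unit LY LYh.
have p'0 : p \Po (- 'X) != 0.
  by rewrite -size_poly_eq0 size_comp_poly2 ?size_poly_eq0 // size_polyN size_polyX.
have [q [q0 _]] := poly_nonroot_itv (mulf_neq0 p0 p'0) (@ltr01 R).
rewrite hornerM mulf_eq0 negb_or horner_comp !hornerE => /andP[/hp u1 /hp u2].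
pose x := atan q^-1.
have x0 : 0 < x by rewrite -(@atan0 R) lt_atan // invr_gt0.
have xpi : x < pi / 2 by exact: atan_ltpi2.
have cx : 0 < cos x by apply: cos_gt0_pihalf; rewrite atan_gtNpi2.
have qs : cos x = q * sin x.
  have := atanK q^-1; rewrite -/x /tan => /eqP.
  rewrite -[q^-1]mul1r eqr_div ?lt0r_neq0 // => /eqP; rewrite mul1r => <-.
  by rewrite mulrC.
have s0 : sin x != 0 by apply: contraTneq cx => s0; rewrite qs s0 mulr0 ltxx.
exists (x + x); split.
- by rewrite addr_gt0 //= [ltRHS]splitr ltrD.
- rewrite Gamma_unitE // qs mulrC -scalerA -scalerDr addrC.
  by rewrite unitmxZ // unitfE.
- rewrite opprD Gamma_unitE // cosN sinN qs.
  have -> : (q * sin x) *: wronskian Y Yh + - sin x *: (Y^T *m Yh) =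
      (- sin x) *: (Y^T *m Yh + - q *: wronskian Y Yh).
    by rewrite scalerDr scalerA mulrNN addrC (mulrC q).
  by rewrite unitmxZ // unitfE oppr_eq0.
Qed.

End SeparatingAngle.

Lemma germ_diff (x y x' y' r r' : nat) :
  (x + r)%N = (x' + r')%N -> (y + r)%N = (y' + r')%N ->
  y%:Z - y'%:Z = x%:Z - x'%:Z.
Proof. by lia. Qed.

Section PathData.
Local Opaque Gamma ell comparative_index rel_index wronskian.
Variables (R : realType) (n : nat) (a b : R).
Hypothesis hab : a < b.
Variables (Y Yh : R -> 'M[R]_(n + n, n)).
Hypotheses (hY : lagrangian_path a b Y) (hYh : lagrangian_path a b Yh).

Let LY s : s \in `[a, b] -> lagrangian_plane (Y s). Proof. exact: hY.2. Qed.
Let LYh s : s \in `[a, b] -> lagrangian_plane (Yh s). Proof. exact: hYh.2. Qed.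
Let cY s : s \in `[a, b] -> mxcvg (within `[a, b] (nbhs s)) Y (Y s).
Proof. exact: mxcvg_path hY.1 _. Qed.
Let cYh s : s \in `[a, b] -> mxcvg (within `[a, b] (nbhs s)) Yh (Yh s).
Proof. exact: mxcvg_path hYh.1 _. Qed.

Lemma Gamma_unit_near s eps : s \in `[a, b] ->
  Gamma (Y s) (Yh s) - (expi (pi + eps))%:M \in unitmx ->
  \forall x \near within `[a, b] (nbhs s),
    Gamma (Y x) (Yh x) - (expi (pi + eps))%:M \in unitmx.
Proof.
have E x : x \in `[a, b] -> (Gamma (Y x) (Yh x) - (expi (pi + eps))%:M \in unitmx) =
    (cos (eps / 2) *: wronskian (Y x) (Yh x) + sin (eps / 2) *: ((Y x)^T *m Yh x)
      \in unitmx).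
  by move=> xab; rewrite {1}[eps]splitr (Gamma_unitE _ (LY xab) (LYh xab)).
move=> sab u0; have us := etrans (esym (E s sab)) u0.
have FF : Filter (within `[a, b] (nbhs s)) by exact: within_filter.
have c : mxcvg (within `[a, b] (nbhs s))
    (fun x => cos (eps / 2) *: wronskian (Y x) (Yh x) + sin (eps / 2) *: ((Y x)^T *m Yh x))
    (cos (eps / 2) *: wronskian (Y s) (Yh s) + sin (eps / 2) *: ((Y s)^T *m Yh s)).
  apply: mxcvgD; apply: mxcvgZ; try exact: cvg_cst.
    by apply: mxcvg_wronskian; [exact: cY | exact: cYh].
  by apply: mxcvgM; [apply: mxcvg_tr; exact: cY | exact: cYh].
have := @mxcvg_near_unit _ _ _ FF _ _ _ c us.
rewrite !near_withinE; apply: filterS => x h xab.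
exact: etrans (E x xab) (h xab).
Qed.

Lemma maslov_data_exists : exists p t eps, maslov_data a b Y Yh p t eps.
Proof.
have [||p [t [eps [hp h]]]] := @tagged_partition_exists R R (fun eps c d =>
    0 < eps < pi /\ forall s, s \in `[c, d] ->
      Gamma (Y s) (Yh s) - (expi (pi + eps))%:M \in unitmx /\
      Gamma (Y s) (Yh s) - (expi (pi - eps))%:M \in unitmx) a b.
- exact: ltW.
- move=> x xab; have [eps [epi u1 u2]] := separating_angle_exists (LY xab) (LYh xab).
  have [e1 e10 h1] := near_withinP (Gamma_unit_near xab u1).
  have [e2 e20 h2] := near_withinP (Gamma_unit_near xab u2).
  exists (Num.min e1 e2); first by rewrite lt_min e10.
  exists eps => c d ac cx xd db xc dx; split=> [//|s]; rewrite in_itv /= => /andP[cs sd].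
  have sab : `[a, b]%classic s by rewrite /= in_itv /= (le_trans ac) // (le_trans sd).
  have l1 : x - e1 < s.
    by apply: lt_le_trans cs; apply: le_lt_trans xc; rewrite lerB // ge_min lexx.
  have l2 : x - e2 < s.
    by apply: lt_le_trans cs; apply: le_lt_trans xc; rewrite lerB // ge_min lexx orbT.
  have r1 : s < x + e1.
    by apply: le_lt_trans sd (lt_le_trans dx _); rewrite lerD // ge_min lexx.
  have r2 : s < x + e2.
    by apply: le_lt_trans sd (lt_le_trans dx _); rewrite lerD // ge_min lexx orbT.
  by split; [exact: h1 | exact: h2].
- by exists p, t, eps.
Qed.

(* Phi counts the passages of the eigenvalues of Gamma through -1: it varies
   locally like the eigenvalue count on any admissible arc. *)
Definition maslov_primitive (c d : R) (Phi : R -> int) : Prop :=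
  forall s, s \in `[c, d] -> forall eps, 0 < eps -> eps < pi ->
  Gamma (Y s) (Yh s) - (expi (pi + eps))%:M \in unitmx ->
  \forall x \near within `[c, d] (nbhs s),
    (ell (Gamma (Y x) (Yh x)) eps)%:Z - (ell (Gamma (Y s) (Yh s)) eps)%:Z =
    Phi x - Phi s.

Lemma maslov_value_primitive Phi p t eps : maslov_primitive a b Phi ->
  maslov_data a b Y Yh p t eps -> maslov_value Y Yh p t eps = Phi b - Phi a.
Proof.
move=> hPhi [hp hd].
apply: (sum_locally_constant
  (f := fun k x => (ell (Gamma (Y x) (Yh x)) (eps k))%:Z) hp) => k kp s st.
have [ak _ kb] := partition_sub hp kp; have [/andP[e0 epi] u] := hd k kp.
have sub := @itv_sub R a b (t k) (t k.+1) ak kb.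
apply: (within_subdomain sub); apply: hPhi => //; last exact: (u s st).1.
exact: sub.
Qed.

Lemma maslov_index_primitive Phi : maslov_primitive a b Phi ->
  maslov_index a b Y Yh = Phi b - Phi a.
Proof.
move=> hPhi; have [p [t [eps hd]]] := maslov_data_exists.
apply: xget_value.
  by exists p, t, eps; split=> //; rewrite (maslov_value_primitive hPhi hd).
by move=> N [p' [t' [eps' [hd' ->]]]]; exact: maslov_value_primitive hd'.
Qed.

Lemma half_angle_bound (eps : R) : 0 < eps -> eps < pi -> 0 < cos (eps / 2).
Proof.
move=> e0 epi; apply: cos_gt0_pihalf; rewrite ltr_pM2r ?invr_gt0 // epi andbT.
by apply: (@lt_trans _ _ 0); rewrite ?oppr_lt0 divr_gt0 // pi_gt0.
Qed.

Lemma half_angle_sin (eps q : R) : 0 < q -> q < cos (eps / 2) ->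
  q * sin (eps / 2) < cos (eps / 2).
Proof.
move=> q0 qc; apply: le_lt_trans qc.
by rewrite -[leRHS]mulr1 ler_wpM2l ?sin_le1 // ltW.
Qed.

Lemma maslov_primitive_exists : exists Phi, maslov_primitive a b Phi.
Proof.
apply: (segment_induction (P := fun c d => exists Phi, maslov_primitive c d Phi)).
- exact: ltW.
- move=> x xab; have [eps [/andP[e0 epi] u1 _]] := separating_angle_exists (LY xab) (LYh xab).
  have [e ee0 h] := near_withinP (Gamma_unit_near xab u1).
  exists e => // c d ac cx xd db xc dx.
  exists (fun s => (ell (Gamma (Y s) (Yh s)) eps)%:Z) => s scd eps' e'0 e'pi us'.
  have sub := @itv_sub R a b c d ac db.
  have sab : s \in `[a, b] by exact: sub.
  have us : Gamma (Y s) (Yh s) - (expi (pi + eps))%:M \in unitmx.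
    move: (scd); rewrite in_itv /= => /andP[cs sd].
    by apply: h => //; [exact: lt_le_trans cs | exact: le_lt_trans dx].
  have m0 : 0 < Num.min (cos (eps / 2)) (cos (eps' / 2)).
    by rewrite lt_min !half_angle_bound.
  have [q [q0]] := chart_exists (LY sab) (LYh sab) (LYh sab) m0.
  rewrite lt_min => /andP[qc qc'] uD _.
  have cYs := mxcvg_subdomain sub (cY sab); have cYhs := mxcvg_subdomain sub (cYh sab).
  have LYs x' : `[c, d]%classic x' -> lagrangian_plane (Y x').
    by move=> /sub; exact: LY.
  have LYhs x' : `[c, d]%classic x' -> lagrangian_plane (Yh x').
    by move=> /sub; exact: LYh.
  have n1 := @ell_near R n `[c, d]%classic s scd q eps Y Yh cYs cYhs LYs LYhs q0 e0 epi
    (half_angle_sin q0 qc) uD us.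
  have n2 := @ell_near R n `[c, d]%classic s scd q eps' Y Yh cYs cYhs LYs LYhs q0 e'0 e'pi
    (half_angle_sin q0 qc') uD us'.
  move: n1 n2; rewrite !near_withinE; apply: filterS2 => y h1 h2 ycd.
  exact: germ_diff (h1 ycd) (h2 ycd).
- move=> c m d ac cm md db [P1 h1] [P2 h2].
  exists (fun s => if s <= m then P1 s else P2 s - P2 m + P1 m).
  move=> s scd eps e0 epi us.
  have [sm|ms|sm] := ltgtP s m.
  + have scm : s \in `[c, m].
      by move: scd; rewrite !in_itv /= => /andP[-> _]; exact: ltW.
    have := h1 s scm eps e0 epi us; rewrite !near_withinE.
    apply: filterS2 (lt_nbhsl sm) => y ym hy; rewrite /= in_itv /= => /andP[cy yd].
    by rewrite (ltW ym) /=; apply: hy; rewrite /= in_itv /= cy (ltW ym).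
  + have smd : s \in `[m, d].
      by move: scd; rewrite !in_itv /= => /andP[_ ->]; rewrite ltW.
    have := h2 s smd eps e0 epi us; rewrite !near_withinE.
    apply: filterS2 (lt_nbhsr ms) => y ym hy; rewrite /= in_itv /= => /andP[cy yd].
    rewrite leNgt ym /= hy; first by ring.
    by rewrite /= in_itv /= yd (ltW ym).
  + subst s; have mcm : m \in `[c, m] by rewrite in_itv /= cm lexx.
    have mmd : m \in `[m, d] by rewrite in_itv /= md lexx.
    have := h1 m mcm eps e0 epi us; have := h2 m mmd eps e0 epi us.
    rewrite !near_withinE; apply: filterS2 => y hy2 hy1.
    rewrite /= in_itv /= ?lexx => /andP[cy yd].
    have [ym|my] := leP y m; first by apply: hy1; rewrite /= in_itv /= cy.
    by rewrite hy2; [ring | rewrite /= in_itv /= yd ltW].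
Qed.

End PathData.

Section OscillationData.
Variables (R : realType) (n : nat) (a b : R).
Hypothesis hab : a < b.
Variables (Y Yh : R -> 'M[R]_(n + n, n)) (Z : R -> 'M[R]_(n + n)) (C : R -> 'M[R]_n).
Hypotheses (hY : lagrangian_path a b Y) (hYh : lagrangian_path a b Yh).
Hypothesis cZ : forall s, s \in `[a, b] -> mxcvg (within `[a, b] (nbhs s)) Z (Z s).
Hypothesis hZ : forall s, s \in `[a, b] ->
  [/\ symplectic (Z s), C s \in unitmx & Z s *m Emx R n = Y s *m C s].
Local Opaque Gamma ell comparative_index rel_index wronskian.

Let LY s : s \in `[a, b] -> lagrangian_plane (Y s). Proof. exact: hY.2. Qed.
Let LYh s : s \in `[a, b] -> lagrangian_plane (Yh s). Proof. exact: hYh.2. Qed.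
Let cY s : s \in `[a, b] -> mxcvg (within `[a, b] (nbhs s)) Y (Y s).
Proof. exact: mxcvg_path hY.1 _. Qed.
Let cYh s : s \in `[a, b] -> mxcvg (within `[a, b] (nbhs s)) Yh (Yh s).
Proof. exact: mxcvg_path hYh.1 _. Qed.

Local Notation Yt := (fun s => invmx (Z s) *m Yh s).

Lemma Emx_lagrangian : lagrangian_plane (Emx R n).
Proof.
split; first by rewrite wronskianF wronskian_E usub_Emx trmx0.
apply/eqP; rewrite eqn_leq rank_leq_col /=.
have e : row_mx 0 1%:M *m Emx R n = 1%:M.
  by rewrite /Emx mul_row_col mul0mx mul1mx add0r.
have := mxrankM_maxr (row_mx (0 : 'M[R]_n) 1%:M) (Emx R n).
by rewrite e mxrank1.
Qed.

Lemma symplectic_lagrangian (P : 'M[R]_(n + n)) (B : 'M[R]_(n + n, n)) :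
  symplectic P -> lagrangian_plane B -> lagrangian_plane (P *m B).
Proof.
move=> sP [BB rB]; split.
  by rewrite wronskianF wronskian_sp.
have [uP _] := symplectic_inv sP.
rewrite -mxrank_tr trmx_mul mxrankMfree ?mxrank_tr //.
by rewrite row_free_unit unitmx_tr.
Qed.

Lemma oscillation_value_primitive Phi p t Rk :
  maslov_primitive Y Yh a b Phi -> oscillation_data a b Yt p t Rk ->
  oscillation_value Yt p t Rk = Phi b - Phi a.
Proof.
move=> hPhi [hp hd].
apply: (sum_locally_constant
  (f := fun k x => (comparative_index (Yt x) (Rk k x *m Emx R n))%:Z) hp) => k kp s skt.
have [ak _ kb] := partition_sub hp kp.
have [[cR sR] [r1 hr1] [r2 hr2]] := hd k kp.
have sub := @itv_sub R a b (t k) (t k.+1) ak kb.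
have sab : s \in `[a, b] by exact: sub.
have [eps [/andP[e0 epi] uG _]] := separating_angle_exists (LY sab) (LYh sab).
have [sZ uC ZE] := hZ sab; have sRs := sR s skt.
have LV : lagrangian_plane (Z s *m (Rk k s *m Emx R n)).
  by do 2!apply: symplectic_lagrangian => //; exact: Emx_lagrangian.
have [q [q0 qc uD uV]] := chart_exists (LY sab) (LYh sab) LV (half_angle_bound e0 epi).
have cYs := mxcvg_subdomain sub (cY sab); have cYhs := mxcvg_subdomain sub (cYh sab).
have cZs := mxcvg_subdomain sub (cZ sab); have cRs := mxcvg_path cR skt.
have LYs x : [set` `[t k, t k.+1]] x -> lagrangian_plane (Y x) by move=> /sub; exact: LY.
have LYhs x : [set` `[t k, t k.+1]] x -> lagrangian_plane (Yh x) by move=> /sub; exact: LYh.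
have hZs x : [set` `[t k, t k.+1]] x -> [/\ symplectic (Z x), symplectic (Rk k x),
    C x \in unitmx & Z x *m Emx R n = Y x *m C x].
  by move=> xk; have [? ? ?] := hZ (sub x xk); split=> //; exact: sR.
have n1 := @ell_near R n [set` `[t k, t k.+1]] s skt q eps Y Yh cYs cYhs LYs LYhs q0 e0 epi
  (half_angle_sin q0 qc) uD uG.
have rk1 x : [set` `[t k, t k.+1]] x ->
    \rank (wronskian (Rk k x *m Emx R n) (invmx (Z x) *m Yh x)) =
    \rank (wronskian (Rk k s *m Emx R n) (invmx (Z s) *m Yh s)).
  by move=> xk; rewrite (hr1 x xk) (hr1 s skt).
have rk2 x : [set` `[t k, t k.+1]] x ->
    \rank (row_mx 1%:M 0 *m Rk k x *m Emx R n) = \rank (row_mx 1%:M 0 *m Rk k s *m Emx R n).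
  by move=> xk; rewrite (hr2 x xk) (hr2 s skt).
have n2 := @comparative_index_near R n [set` `[t k, t k.+1]] s skt q Y Yh Z (Rk k) C
  cYs cYhs cZs cRs LYs LYhs hZs rk1 rk2 uD uV.
have n3 := within_subdomain sub (hPhi s sab eps e0 epi uG).
move: n1 n2 n3; rewrite !near_withinE; apply: filterS3 => x h1 h2 h3 xk.
exact: etrans (germ_diff (h1 xk) (h2 xk)) (h3 xk).
Qed.

(* Its image of the vertical plane is the graph of r, which is transversal to the
   vertical plane, and to any given Lagrangian plane for generic r. *)
Let shear_frame (r : R) : 'M[R]_(n + n) := row_mx (col_mx 0 (- 1%:M)) (col_mx 1%:M r%:M).

Let shear_frame_sp r : symplectic (shear_frame r).
Proof.
apply: symplectic_row_mx; rewrite wronskianE !col_mxKu !col_mxKd.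
- by rewrite trmx0 mul0mx mulmx0 subrr.
- by rewrite trmx1 mul1mx mulmx1 tr_scalar_mx subrr.
- by rewrite trmx0 mul0mx mulmx1 linearN /= trmx1 opprK add0r.
Qed.

Let shear_frame_E r : shear_frame r *m Emx R n = col_mx 1%:M r%:M.
Proof. by rewrite /shear_frame /Emx mul_row_col mulmx0 add0r mulmx1. Qed.

Lemma oscillation_data_exists : exists p t Rk, oscillation_data a b Yt p t Rk.
Proof.
have [||p [t [Rk [hp h]]]] := @tagged_partition_exists R (R -> 'M[R]_(n + n))
  (fun Rk c d => [/\ symplectic_path_on c d Rk,
     exists r : nat, forall s, s \in `[c, d] ->
       \rank (wronskian (Rk s *m Emx R n) (Yt s)) = r
   & exists r : nat, forall s, s \in `[c, d] ->
       \rank (row_mx 1%:M 0 *m Rk s *m Emx R n) = r]) a b.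
- exact: ltW.
- move=> x xab; have [sZ uC ZE] := hZ xab.
  have LYt : lagrangian_plane (Yt x).
    by apply: symplectic_lagrangian; [exact: symplectic_inv_sp | exact: LYh].
  have [r [_ _ ur _]] := chart_exists Emx_lagrangian LYt LYt (@ltr01 R).
  have WE (B : 'M[R]_(n + n, n)) : wronskian (shear_frame r *m Emx R n) B =
      (Emx R n)^T *m B + r *: wronskian (Emx R n) B.
    rewrite shear_frame_E gramE !wronskianE !col_mxKu !col_mxKd.
    rewrite trmx0 trmx1 tr_scalar_mx !mul0mx !mul1mx mul_scalar_mx add0r sub0r.
    by rewrite scalerN.
  have FF : Filter (within `[a, b] (nbhs x)) by exact: within_filter.
  have [uZ _] := symplectic_inv sZ.
  have cW : mxcvg (within `[a, b] (nbhs x))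
      (fun s => wronskian (shear_frame r *m Emx R n) (Yt s))
      (wronskian (shear_frame r *m Emx R n) (Yt x)).
    apply: mxcvgM; first exact: mxcvg_cst.
    by apply: mxcvgM; [apply: mxcvg_inv => //; exact: cZ | exact: cYh].
  have uW : wronskian (shear_frame r *m Emx R n) (Yt x) \in unitmx by rewrite WE.
  have [e e0 he] := near_withinP (@mxcvg_near_unit _ _ _ FF _ _ _ cW uW).
  exists e => //; exists (fun=> shear_frame r) => c d ac cx xd db xc dx.
  split.
  + split; last by move=> s _; exact: shear_frame_sp.
    by apply: continuous_subspaceT => s; exact: cst_continuous.
  + exists n => s; rewrite in_itv /= => /andP[cs sd].
    apply/mxrank_unit/he; first by rewrite /= in_itv /= (le_trans ac) // (le_trans sd).
      exact: lt_le_trans cs.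
    exact: le_lt_trans dx.
  + exists n => s _; rewrite -mulmxA shear_frame_E mul_row_col mul1mx mul0mx addr0.
    exact: mxrank1.
- by exists p, t, Rk.
Qed.

Lemma maslov_oscillation : maslov_index a b Y Yh = oscillation_number a b Yt.
Proof.
have [Phi hPhi] := maslov_primitive_exists hab hY hYh.
rewrite (maslov_index_primitive hab hY hYh hPhi).
have [p [t [Rk hd]]] := oscillation_data_exists.
apply/esym/xget_value.
  by exists p, t, Rk; split=> //; apply/esym; exact: oscillation_value_primitive hd.
by move=> N [p' [t' [Rk' [hd' ->]]]]; exact: oscillation_value_primitive hd'.
Qed.

End OscillationData.

Section ContinuityOfZ.
Variables (R : realType) (n : nat) (a b : R) (Y : R -> 'M[R]_(n + n, n)).
Hypothesis hY : lagrangian_path a b Y.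

Lemma mxcvg_Kmx s : s \in `[a, b] ->
  mxcvg (within `[a, b] (nbhs s)) (fun x => Kmx (Y x)) (Kmx (Y s)).
Proof.
move=> sab; have cY := mxcvg_path hY.1 sab.
have FF : Filter (within `[a, b] (nbhs s)) by exact: within_filter.
have spec x : x \in `[a, b] ->
    posdef (Kmx (Y x)) /\ Kmx (Y x) *m Kmx (Y x) = invmx ((Y x)^T *m Y x).
  by move=> /hY.2 [_ rY]; exact: inv_sqrtmxP (gram_posdef rY).
apply: (mxcvg_sqrt (P := fun x => invmx ((Y x)^T *m Y x))).
- exact: (spec s sab).1.
- by rewrite near_withinE; apply: filterE => x; exact: spec.
- rewrite (spec s sab).2; apply: mxcvg_inv.
    by apply: mxcvgM => //; exact: mxcvg_tr.
  exact: gram_unitmx (hY.2 _ sab).2.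
Qed.

Lemma mxcvg_Zmx s : s \in `[a, b] ->
  mxcvg (within `[a, b] (nbhs s)) (fun x => Zmx (Y x)) (Zmx (Y s)).
Proof.
move=> sab; have cY := mxcvg_path hY.1 sab; have cK := mxcvg_Kmx sab.
have FF : Filter (within `[a, b] (nbhs s)) by exact: within_filter.
have c2 : mxcvg (within `[a, b] (nbhs s)) (fun x => Y x *m Kmx (Y x)) (Y s *m Kmx (Y s)).
  exact: mxcvgM.
have c1 : mxcvg (within `[a, b] (nbhs s)) (fun x => Jmx R n *m Y x *m Kmx (Y x))
    (Jmx R n *m Y s *m Kmx (Y s)).
  by apply: mxcvgM => //; apply: mxcvgM => //; exact: mxcvg_cst.
move=> i j; case: (split_ordP j) => k ->.
  by rewrite row_mxEl; under eq_fun do rewrite row_mxEl; exact: c1.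
by rewrite row_mxEr; under eq_fun do rewrite row_mxEr; exact: c2.
Qed.

End ContinuityOfZ.

(** * Lidskii angles *)

Section Expi.
Variable R : realType.

Lemma expi_period (x : R) (k : int) : expi (x + 2 * pi * k%:~R) = expi x.
Proof.
have h (m : nat) (y : R) : expi (y + 2 * pi * m%:R) = expi y.
  elim: m => [|m IH]; first by rewrite mulr0 addr0.
  rewrite -[RHS]IH; have -> : y + 2 * pi * m.+1%:R = y + 2 * pi * m%:R + pi *+ 2.
    by rewrite -natr1 mulr2n; ring.
  by rewrite /expi cosD2pi sinD2pi.
case: k => m; first exact: h.
rewrite NegzE -[LHS](h m.+1); congr expi.
by rewrite mulrNz -pmulrn; ring.
Qed.

Lemma expi_inj (x y : R) : 0 <= x < 2 * pi -> 0 <= y < 2 * pi ->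
  expi x = expi y -> x = y.
Proof.
wlog xy : x y / x <= y.
  move=> h hx hy e; have [xy|yx] := leP x y; first exact: h.
  by apply/esym; apply: h => //; exact: ltW.
move=> /andP[x0 _] /andP[_ y2] [cxy sxy]; pose z := (y - x) / 2.
have z0 : 0 <= z by rewrite divr_ge0 // subr_ge0.
have : cos (z + z) = 1.
  have -> : z + z = y - x by rewrite /z; field.
  by rewrite cosB cxy sxy -!expr2 cos2Dsin2.
rewrite cosD -!expr2 => e; have sz : sin z ^+ 2 = 0 by have := cos2Dsin2 z; lra.
have [zp|] := ltP 0 z; last by move=> z'; rewrite /z in z0 z'; lra.
have : 0 < sin z by apply: sin_gt0_pi; rewrite zp /= /z; lra.
by move: sz => /eqP; rewrite expf_eq0 /= => /eqP ->; rewrite ltxx.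
Qed.

Lemma angle_mod (phi : R) (q : int) :
  2 * pi * q%:~R <= phi < 2 * pi * (q + 1)%:~R ->
  0 <= phi - 2 * pi * q%:~R < 2 * pi.
Proof. by rewrite intrD mulr1z => /andP[h1 h2]; apply/andP; split; lra. Qed.

Lemma expi_mod (phi : R) (q : int) : expi (phi - 2 * pi * q%:~R) = expi phi.
Proof. by rewrite -[LHS](expi_period _ q) subrK. Qed.

Lemma arc_indicator (phi eps : R) (q : int) : 0 < eps -> eps < pi ->
  2 * pi * q%:~R <= phi < 2 * pi * (q + 1)%:~R ->
  `[< ((@expi R) @` [set` `[0, eps[]) (expi phi) >] = (phi - 2 * pi * q%:~R < eps).
Proof.
move=> e0 epi hq; have hm := angle_mod hq.
have p0 := @pi_gt0 R.
apply/asboolP/idP => [[th /=]|h].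
  rewrite in_itv /= => /andP[t0 te] e.
  have <- : th = phi - 2 * pi * q%:~R; last by [].
  apply: expi_inj => //; last by rewrite expi_mod.
  by rewrite t0 /=; lra.
exists (phi - 2 * pi * q%:~R); last exact: expi_mod.
by rewrite /= in_itv /= h andbT; case/andP: hm.
Qed.

Lemma floor_angle_uniq (phi : R) (q k : int) :
  2 * pi * q%:~R <= phi < 2 * pi * (q + 1)%:~R ->
  2 * pi * k%:~R <= phi < 2 * pi * (k + 1)%:~R -> q = k.
Proof.
have p0 : 0 < 2 * pi :> R by rewrite mulr_gt0 ?pi_gt0.
move=> /andP[h1 h2] /andP[h3 h4].
have := le_lt_trans h1 h4; have := le_lt_trans h3 h2.
rewrite !(ltr_pM2l p0) !ltr_int; lia.
Qed.

Lemma arc_indicator_near (F : set_system R) {FF : Filter F} (D : set R)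
    (phi : R -> R) (q : R -> int) (s eps : R) :
  D s -> (\forall x \near F, D x) -> phi x @[x --> F] --> phi s ->
  (forall x, D x -> 2 * pi * (q x)%:~R <= phi x < 2 * pi * (q x + 1)%:~R) ->
  0 < eps -> eps < pi -> expi (phi s) != expi eps ->
  \forall x \near F,
    (`[< ((@expi R) @` [set` `[0, eps[]) (expi (phi x)) >] : nat)%:Z
    - (`[< ((@expi R) @` [set` `[0, eps[]) (expi (phi s)) >] : nat)%:Z = q x - q s.
Proof.
move=> Ds nD cphi hq e0 epi ne; have p0 := @pi_gt0 R.
have := angle_mod (hq s Ds).
have [psi psiE] : exists psi, psi = phi s - 2 * pi * (q s)%:~R by eexists.
rewrite -psiE => /andP[psi0 psi2].
have psie : psi != eps.
  by apply: contraNneq ne => <-; rewrite psiE expi_mod.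
pose d := if psi == 0 then eps else Num.min psi (Num.min (2 * pi - psi) `|psi - eps|).
have d0 : 0 < d.
  rewrite /d; case: eqVneq => // psin; rewrite !lt_min subr_gt0 psi2 normr_gt0 subr_eq0 psie.
  by rewrite lt_neqAle eq_sym psin psi0.
have hd := cvgr_dist_lt _ _ cphi _ d0.
apply: filterS2 nD (hd _) => x Dx dx.
rewrite (arc_indicator e0 epi (hq x Dx)) (arc_indicator e0 epi (hq s Ds)) -psiE.
have qE k : 2 * pi * k%:~R <= phi x < 2 * pi * (k + 1)%:~R -> q x = k.
  exact: floor_angle_uniq (hq x Dx).
have [z zE] : exists z, z = phi x - 2 * pi * (q s)%:~R by eexists.
have zpsi : phi s - phi x = psi - z by rewrite psiE zE; ring.
rewrite zpsi in dx; move: dx; rewrite /d; case: eqVneq => [pz|pn].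
  rewrite pz sub0r normrN => /ltr_normlP[h1 h2].
  have [z0|z0] := leP 0 z.
    have -> : q x = q s.
      by apply: qE; rewrite intrD mulr1z; apply/andP; split; lra.
    by rewrite -zE h2 e0 !subrr.
  have -> : q x = q s - 1.
    apply: qE; rewrite subrK intrB mulr1z; apply/andP; split; lra.
  rewrite e0 intrB mulr1z (_ : _ < eps = false); first by rewrite [RHS]addrAC subrr.
  by apply/negbTE; rewrite -leNgt; lra.
rewrite !lt_min => /and3P[h1 h2 h3].
have {h1} : 0 < z < 2 * pi.
  move: h1 h2 => /ltr_normlP[_ a1] /ltr_normlP[a2 a3]; apply/andP; split; lra.
move=> /andP[z0 z2].
have -> : q x = q s.
  by apply: qE; rewrite intrD mulr1z; apply/andP; split; lra.
rewrite -zE; have -> : (z < eps) = (psi < eps); last by rewrite !subrr.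
move: h3; have [pe|pe] := ltP psi eps.
  have nd : psi - eps < 0 by rewrite subr_lt0.
  rewrite (ltr0_norm nd) => /ltr_normlP[h h'].
  by apply/idP; lra.
have nn : 0 <= psi - eps by rewrite subr_ge0.
rewrite (ger0_norm nn) => /ltr_normlP[h h'].
by apply/negbTE; rewrite -leNgt; lra.
Qed.

End Expi.

Section Diagonalization.
Variables (F : fieldType) (n : nat).
Implicit Types (A G W H D P : 'M[F]_n) (d : 'rV[F]_n).

Lemma char_poly_similar_diag A P d : P \in unitmx ->
  A = invmx P *m diag_mx d *m P -> char_poly A = \prod_(i < n) ('X - (d 0 i)%:P).
Proof.
move=> uP ->; transitivity (char_poly (diag_mx d)); last first.
  rewrite char_poly_trig ?diag_mx_is_trig //.
  by apply: eq_bigr => i _; rewrite mxE eqxx.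
rewrite /char_poly; pose pC (B : 'M[F]_n) := map_mx polyC B.
have e : pC (invmx P) *m pC P = 1%:M by rewrite /pC -map_mxM mulVmx // map_mx1.
have -> : char_poly_mx (invmx P *m diag_mx d *m P) =
    pC (invmx P) *m char_poly_mx (diag_mx d) *m pC P.
  rewrite /char_poly_mx !map_mxM -!/(pC _) mulmxBr mulmxBl; congr (_ - _).
  by rewrite mul_mx_scalar -scalemxAl e scalemx1.
by rewrite !det_mulmx mulrAC -det_mulmx e det1 mul1r.
Qed.

Lemma cayley_diag G W H D P d (q i : F) : P \in unitmx -> D \in unitmx ->
  H = invmx P *m diag_mx d *m P -> G = D + q *: (H *m D) -> W = - (H *m D) ->
  G + i *: W \in unitmx ->
  exists (V : 'M[F]_n) (l : 'rV[F]_n), V \in unitmx /\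
    invmx (G + i *: W) *m (G - i *: W) = invmx V *m diag_mx l *m V.
Proof.
move=> uP uD HE -> ->; pose V := P *m D.
have uV : V \in unitmx by rewrite unitmx_mul uP.
have E (c : F) : D + q *: (H *m D) + c *: - (H *m D) =
    invmx P *m diag_mx (\row_k (1 + (q - c) * d 0 k)) *m V.
  have -> : diag_mx (\row_k (1 + (q - c) * d 0 k)) = 1%:M + (q - c) *: diag_mx d.
    rewrite -diag_const_mx -linearZ -linearD /=; congr diag_mx.
    by apply/rowP => k; rewrite !mxE.
  rewrite mulmxDr mulmxDl mulmx1 /V mulKmx // -scalemxAr -scalemxAl mulmxA -HE.
  by rewrite scalerN -scaleNr -addrA -scalerDl.
have -> : D + q *: (H *m D) - i *: - (H *m D) =
    D + q *: (H *m D) + (- i) *: - (H *m D) by rewrite scaleNr.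
rewrite !E opprK; clearbody V => uA; set l1 := \row_k _ in uA *; set l2 := \row_k _.
have l10 k : l1 0 k != 0.
  move: uA; rewrite !unitmx_mul => /andP[/andP[_]] + _.
  rewrite unitmxE det_diag unitfE => /prodf_neq0; exact.
exists V, (\row_k (l2 0 k / l1 0 k)); split=> //.
have -> : diag_mx l2 = diag_mx l1 *m diag_mx (\row_k (l2 0 k / l1 0 k)).
  rewrite mulmx_diag; congr diag_mx; apply/rowP => k.
  by rewrite [RHS]mxE [X in _ * X]mxE mulrC divfK.
apply: (canLR (mulKmx uA)); rewrite -!mulmxA; congr (_ *m (_ *m _)).
by rewrite mulKVmx.
Qed.

Lemma similar_diag_conj A B (K : 'M[F]_n) : K \in unitmx ->
  (exists (V : 'M[F]_n) (l : 'rV[F]_n), V \in unitmx /\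
    A = invmx V *m diag_mx l *m V) ->
  B = invmx K *m A *m K ->
  exists (V : 'M[F]_n) (l : 'rV[F]_n), V \in unitmx /\
    B = invmx V *m diag_mx l *m V.
Proof.
move=> uK [V [l [uV ->]]] ->; exists (V *m K), l; split.
  by rewrite unitmx_mul uV.
by rewrite invmxM // !mulmxA.
Qed.

End Diagonalization.

Section LidskiiAngles.
Variables (R : realType) (n : nat).
Implicit Types (Y Yh : 'M[R]_(n + n, n)).
Local Notation toC := (map_mx (real_complex R)).

Lemma lidskii_diag Y Yh : lagrangian_plane Y -> lagrangian_plane Yh ->
  exists (V : 'M[R[i]]_n) (l : 'rV[R[i]]_n), V \in unitmx /\
    lidskii_mx (invmx (Zmx Y) *m Zmx Yh) = invmx V *m diag_mx l *m V.
Proof.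
move=> LY LYh; have [_ _ uKh _] := Kmx_spec LYh.
have uKhc : toC (Kmx Yh) \in unitmx by rewrite toC_unitmx.
have u1 : mx_addi (Y^T *m Yh) (wronskian Y Yh) \in unitmx.
  have [_ uCb] := lagrangian_unitmx LY; have [uCh _] := lagrangian_unitmx LYh.
  by rewrite -pencil_addi unitmx_mul unitmx_tr uCb.
have [q [_ _ uD _]] := chart_exists LY LYh LYh (@ltr01 R).
have [P [d [uP HE _]]] := chart_mx_diag LY LYh uD.
apply: (similar_diag_conj uKhc _ (lidskii_factor LY LYh)).
set H := chart_mx q Y Yh in HE; set D := Y^T *m Yh + q *: wronskian Y Yh in uD.
have WE : wronskian Y Yh = - (H *m D).
  by rewrite /H /chart_mx mulNmx opprK -mulmxA mulVmx // mulmx1.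
have GE : Y^T *m Yh = D + q *: (H *m D).
  by rewrite -[H *m D]opprK -WE scalerN /D addrK.
apply: (@cayley_diag _ _ _ _ (toC H) (toC D) (toC P) (map_mx (real_complex R) d)
          (real_complex R q)).
- by rewrite toC_unitmx.
- by rewrite toC_unitmx.
- by rewrite HE !map_mxM map_invmx map_diag_mx.
- by rewrite {1}GE map_mxD map_mxZ map_mxM.
- by rewrite {1}WE map_mxN map_mxM.
- exact: u1.
Qed.

Lemma ell_angles Y Yh (phi : 'I_n -> R) (eps : R) :
  lagrangian_plane Y -> lagrangian_plane Yh -> 0 < eps -> eps < pi ->
  lidskii_angles (invmx (Zmx Y) *m Zmx Yh) phi ->
  ell (Gamma Y Yh) eps =
  (\sum_(j < n) `[< ((@expi R) @` [set` `[0%R, eps[]) (expi (phi j)) >])%N.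
Proof.
move=> LY LYh e0 epi hphi; have [V [l [uV eV]]] := lidskii_diag LY LYh.
pose S (z : R[i]) := `[< ((@expi R) @` [set` `[0, eps[]) z >].
have perm : perm_eq [seq l 0 i | i <- index_enum 'I_n] [seq expi (phi j) | j <- index_enum 'I_n].
  apply: prod_XsubC_eq; rewrite !big_map.
  by rewrite -(char_poly_similar_diag uV eV) hphi.
transitivity (\sum_(th \in [set` `[0%R, eps[])
    \rank (eigenspace (lidskii_mx (invmx (Zmx Y) *m Zmx Yh)) (expi th)))%N.
  apply: eq_fsbigr => th _.
  have h := etrans (rank_Gamma (th / 2) LY LYh) (esym (rank_lidskii (th / 2) LY LYh)).
  rewrite -splitr in h.
  exact: etrans (rank_eigenspace _ _) (etrans (congr1 (subn n) h) (esym (rank_eigenspace _ _))).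
have p0 := @pi_gt0 R.
have inj : set_inj [set` `[0, eps[] (@expi R).
  move=> x y; rewrite !inE /= !in_itv /= => /andP[x0 xe] /andP[y0 ye].
  by apply: expi_inj; apply/andP; split=> //; lra.
rewrite (sum_rank_eigenspace uV eV inj).
transitivity (\sum_(z <- [seq l 0%R i | i <- index_enum 'I_n]) S z)%N.
  by rewrite big_map.
by rewrite (perm_big _ perm) big_map.
Qed.

Lemma lidskii_angle_neq Y Yh (phi : 'I_n -> R) (eps : R) j :
  lagrangian_plane Y -> lagrangian_plane Yh ->
  lidskii_angles (invmx (Zmx Y) *m Zmx Yh) phi ->
  Gamma Y Yh - (expi (pi + eps))%:M \in unitmx ->
  expi (phi j) != expi eps.
Proof.
move=> LY LYh hphi uG; apply/eqP => e.
have : eigenvalue (lidskii_mx (invmx (Zmx Y) *m Zmx Yh)) (expi eps).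
  by rewrite eigenvalue_root_char hphi -e (bigD1 j) //= rootM root_XsubC eqxx.
have h := etrans (rank_lidskii (eps / 2) LY LYh) (esym (rank_Gamma (eps / 2) LY LYh)).
rewrite -splitr in h.
rewrite /eigenvalue -mxrank_eq0 => /negP; apply; apply/eqP.
apply: etrans (rank_eigenspace _ _) _.
by apply: etrans (congr1 (subn n) (etrans h (mxrank_unit uG))) (subnn n).
Qed.

End LidskiiAngles.

Lemma lidskii_primitive (R : realType) (n : nat) (a b : R)
    (Y Yh : R -> 'M[R]_(n + n, n)) (phi : 'I_n -> R -> R) (q : 'I_n -> R -> int) :
  lagrangian_path a b Y -> lagrangian_path a b Yh ->
  (forall j, {within `[a, b], continuous (phi j)}) ->
  (forall t, t \in `[a, b] ->
     lidskii_angles (invmx (Zmx (Y t)) *m Zmx (Yh t)) (fun j => phi j t)) ->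
  (forall j t, t \in `[a, b] ->
     2 * pi * (q j t)%:~R <= phi j t < 2 * pi * (q j t + 1)%:~R) ->
  maslov_primitive Y Yh a b (fun s => \sum_(j < n) q j s).
Proof.
move=> hY hYh cphi hphi hq s sab eps e0 epi uG.
have LY := hY.2; have LYh := hYh.2.
have FF : Filter (within `[a, b] (nbhs s)) by exact: within_filter.
have near_j (j : 'I_n) : \forall x \near within `[a, b] (nbhs s),
    (`[< ((@expi R) @` [set` `[0, eps[]) (expi (phi j x)) >] : nat)%:Z
    - (`[< ((@expi R) @` [set` `[0, eps[]) (expi (phi j s)) >] : nat)%:Z = q j x - q j s.
  apply: (@arc_indicator_near R _ FF [set` `[a, b]] (phi j) (q j) s eps) => //.
  - exact: withinT.
  - by have /subspace_continuousP := cphi j; apply.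
  - by move=> x; exact: hq.
  - exact: lidskii_angle_neq (LY s sab) (LYh s sab) (hphi s sab) uG.
have := filter_forall FF near_j.
rewrite !near_withinE; apply: filterS => x h xab.
have ex := ell_angles (LY x xab) (LYh x xab) e0 epi (hphi x xab).
have es := ell_angles (LY s sab) (LYh s sab) e0 epi (hphi s sab).
apply: etrans (congr2 (fun u v : nat => u%:Z - v%:Z) ex es) _.
rewrite !(big_morph Posz PoszD (erefl _)) -!sumrB.
by apply: eq_bigr => j _; exact: h.
Qed.

Unset Implicit Arguments.
Set Strict Implicit.
Set Printing Implicit Defensive.

Theorem theorem4p2 (R : realType) (n : nat) (a b : R) (hab : a < b)
    (Y Yh : R -> 'M[R]_(n + n, n))
    (hY : lagrangian_path a b Y) (hYh : lagrangian_path a b Yh) :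
  (forall (phi : 'I_n -> R -> R) (q : 'I_n -> R -> int),
      (forall j, {within `[a, b], continuous (phi j)}) ->
      (forall t, t \in `[a, b] ->
        lidskii_angles (invmx (Zmx (Y t)) *m Zmx (Yh t))
                       (fun j => phi j t)) ->
      (forall j t, t \in `[a, b] ->
        2 * pi * (q j t)%:~R <= phi j t < 2 * pi * (q j t + 1)%:~R) ->
      maslov_index a b Y Yh = \sum_(j < n) (q j b - q j a))
  /\ (forall Z : R -> 'M[R]_(n + n),
      symplectic_path_on a b Z ->
      (forall t, t \in `[a, b] -> Y t = Z t *m Emx R n) ->
      maslov_index a b Y Yh =
      oscillation_number a b (fun t => invmx (Z t) *m Yh t))
  /\ (let Yt := fun t => invmx (Zmx (Y t)) *m Yh t in
      maslov_index a b Y Yh = oscillation_number a b Yt /\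
      forall t, t \in `[a, b] ->
        Yt t = col_mx (- (Kmx (Y t) *m wronskian (Y t) (Yh t)))
                      (Kmx (Y t) *m (Y t)^T *m Yh t)).
Proof.
split=> [phi q cphi hphi hq|].
  by rewrite (maslov_index_primitive hab hY hYh (lidskii_primitive hY hYh cphi hphi hq)) sumrB.
split=> [Z [cZ sZ] YZ|Yt].
  apply: (@maslov_oscillation R n a b hab Y Yh Z (fun=> 1%:M) hY hYh) => s sab.
    exact: mxcvg_path.
  by split; [exact: sZ | exact: unitmx1 | rewrite mulmx1 YZ].
split.
  apply: (@maslov_oscillation R n a b hab Y Yh (fun s => Zmx (Y s)) (fun s => Kmx (Y s)) hY hYh)
    => s sab; first exact: mxcvg_Zmx.
  have [_ _ uK _] := Kmx_spec (hY.2 s sab); split=> //.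
    exact: Zmx_symplectic (hY.2 s sab).
  by rewrite /Zmx /Emx mul_row_col mulmx0 mulmx1 add0r.
move=> t tab; have LY := hY.2 t tab; have [_ sK _ _] := Kmx_spec LY.
rewrite /Yt invmx_row_mx; last exact: Zmx_symplectic LY.
rewrite !wronskianF !wronskianMl sK wronskian_Jl.
by rewrite mulmxA.
Qed.
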